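(* Let $\mathsf{D}_{\mathrm{ET}}$ be a regular Entropy-Transport distance induced by $(a,F,\ell)$, with induced Sturm-Entropy-Transport distance $\mathbf{D}_{\mathrm{ET}}$. Let $(X_1,d_1,\mu_1)$ and $(X_2,d_2,\mu_2)$ be two metric measure spaces. Then: (i) There exist a measure $\gamma\in\mathscr{M}(X_1\times X_2)$, with marginals $\gamma_1,\gamma_2$, and a pseudo-metric coupling $\hat d$ between $d_1$ and $d_2$ such that $$\mathbf{D}_{\mathrm{ET}}^{1/a}\big((X_1,d_1,\mu_1),(X_2,d_2,\mu_2)\big)=\sum_{i=1}^2D_F(\gamma_i\|\mu_i)+\int_{X_1\times X_2}\ell\big(\hat d(x,y)\big)\,d\gamma(x,y).$$ (ii) There exist a complete and separable metric space $(\tilde X,\tilde d)$ and isometric embeddings $\psi^1:\mathsf{supp}(\mu_1)\to\tilde X$, $\psi^2:\mathsf{supp}(\mu_2)\to\tilde X$ such that $$\mathbf{D}_{\mathrm{ET}}\big((X_1,d_1,\mu_1),(X_2,d_2,\mu_2)\big)=(\mathsf{D}_{\mathrm{ET}})_{\tilde d}(\psi^1_\sharp\mu_1,\psi^2_\sharp\mu_2),$$ where $(\mathsf{D}_{\mathrm{ET}})_{\tilde d}$ denotes the Entropy-Transport distance computed in the space $(\tilde X,\tilde d)$.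
   Context: For a complete separable metric space $X$, $\mathscr{M}(X)$ denotes the set of finite nonnegative Borel measures on $X$, endowed with the weak topology (duality with bounded continuous functions). $\Gamma_0(\mathbb{R}_+)$ is the set of convex, lower semicontinuous $F:[0,\infty)\to[0,\infty]$ with $F(1)=0$; $F'_\infty:=\lim_{s\to\infty}F(s)/s$, and $F$ is superlinear if $F'_\infty=+\infty$. The $F$-divergence is $D_F(\gamma\|\mu):=\int_X F(\sigma)\,d\mu+F'_\infty\,\gamma^\perp(X)$, where $\gamma=\sigma\mu+\gamma^\perp$ is the Lebesgue decomposition of $\gamma$ with respect to $\mu$ (with $\infty\cdot 0=0$). The Entropy-Transport cost induced by $F$ and a lower semicontinuous cost $c:X\times X\to[0,\infty]$ is $$\mathrm{ET}(\mu_1,\mu_2):=\inf_{\gamma\in\mathscr{M}(X\times X)}\Big\{D_F(\gamma_1\|\mu_1)+D_F(\gamma_2\|\mu_2)+\int_{X\times X} c\,d\gamma\Big\},$$ where $\gamma_i=(\pi^i)_\sharp\gamma$ are the marginals of $\gamma$. Regular Entropy-Transport distance induced by $(a,F,\ell)$: here $a\in(0,1]$, $F\in\Gamma_0(\mathbb{R}_+)$ is superlinear and finite valued, $\ell:[0,\infty)\to[0,\infty]$ is continuous, convex, with $\ell(s)=0$ iff $s=0$; for every complete separable metric space $(X,d)$ one sets $\mathsf{D}_{\mathrm{ET}}:=\mathrm{ET}^a$ on $\mathscr{M}(X)$, with $\mathrm{ET}$ induced by $F$ and $c(x_1,x_2)=\ell(d(x_1,x_2))$, and it is required that, for every complete separable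 metric space $(X,d)$, $\mathsf{D}_{\mathrm{ET}}$ is a complete and separable metric on $\mathscr{M}(X)$ inducing the weak topology. A metric measure space is a triple $(X,d,\mu)$ with $(X,d)$ a complete separable metric space and $\mu\in\mathscr{M}(X)$; $\mathsf{supp}(\mu)$ is the support of $\mu$. The Sturm-Entropy-Transport distance is $$\mathbf{D}_{\mathrm{ET}}\big((X_1,d_1,\mu_1),(X_2,d_2,\mu_2)\big):=\inf\ \mathsf{D}_{\mathrm{ET}}(\psi^1_\sharp\mu_1,\psi^2_\sharp\mu_2),$$ the infimum over all complete separable metric spaces $(\hat X,\hat d)$ and isometric embeddings $\psi^i:\mathsf{supp}(\mu_i)\to\hat X$, $i=1,2$ (with $\mathsf{D}_{\mathrm{ET}}$ computed in $(\hat X,\hat d)$). A pseudo-metric coupling between $d_1$ and $d_2$ is a finite valued pseudo-metric $\hat d$ (symmetric, zero on the diagonal, triangle inequality) on the disjoint union $X_1\sqcup X_2$ whose restriction to $X_i\times X_i$ is $d_i$, $i=1,2$. *)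

(* Defs.v *)
From HB Require Import structures.
From mathcomp Require Import all_boot all_order all_algebra.
From mathcomp Require Import all_classical all_reals all_analysis.

Set Implicit Arguments.
Unset Strict Implicit.
Unset Printing Implicit Defensive.

Import Order.TTheory GRing.Theory Num.Theory.
Import numFieldNormedType.Exports.

Local Open Scope classical_set_scope.
Local Open Scope ring_scope.

HB.mixin Record isSeparable T & Topological T := {
  separable_dense : exists2 A : set T, countable A & dense A
}.

(* Complete separable metric spaces; as measurable types are pointed in the
   library, the spaces are nonempty. *)
#[short(type="polishMetricType")]
HB.structure Definition PolishMetric (R : realType) :=
  {T of Complete T & Metric R T & isSeparable T}.

HB.instance Definition _ (S T : ptopologicalType) := Pointed.on (S * T)%type.

Section borel_measures.
Variable R : realType.

Definition borel (T : ptopologicalType) := g_sigma_algebraType (@open T).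

(* Library measures are functions on all sets, so elements of [fmeasure T] may
   differ while representing the same Borel measure; [fmeasure_eq] is equality
   of Borel measures. *)
Definition fmeasure (T : ptopologicalType) : Type :=
  {finite_measure set (borel T) -> \bar R}.

HB.instance Definition _ (T : ptopologicalType) := gen_eqMixin (fmeasure T).
HB.instance Definition _ (T : ptopologicalType) := gen_choiceMixin (fmeasure T).

Definition fmeasure_eq (T : ptopologicalType) (mu nu : fmeasure T) :=
  forall A : set (borel T), measurable A -> mu A = nu A.

Definition Cb (T : ptopologicalType) :=
  {f : T -> R | continuous f /\ exists M : R, forall x, `|f x| <= M}.

Definition integrate_Cb (T : ptopologicalType) (mu : fmeasure T) :
    prod_topology (fun _ : Cb T => R) :=
  fun f => (\int[mu]_(x in [set: borel T]) sval f x)%R.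

Definition weak_fmeasure (T : ptopologicalType) :=
  initial_topology (@integrate_Cb T).

Lemma continuous_borel_measurable (S T : ptopologicalType) (f : S -> T) :
  continuous f -> measurable_fun [set: borel S] (f : borel S -> borel T).
Proof.
move=> /continuousP cf; apply: (@measurability _ _ (borel S) (borel T) _ _ (@open T)) => //.
by move=> _ [U oU <-]; rewrite setTI; apply: sub_sigma_algebra; exact: cf.
Qed.

Lemma fst_continuous (S T : ptopologicalType) : continuous (@fst S T).
Proof. by move=> [x y]; exact: cvg_fst. Qed.

Lemma snd_continuous (S T : ptopologicalType) : continuous (@snd S T).
Proof. by move=> [x y]; exact: cvg_snd. Qed.

Section image_measure.
Context (S T : ptopologicalType) (f : S -> T) (cf : continuous f).
Variable mu : fmeasure S.

Definition cpush_fun : set (borel T) -> \bar R := fun A => mu (f @^-1` A).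

Let m0 : cpush_fun set0 = 0%E.
Proof. by rewrite /cpush_fun preimage_set0 measure0. Qed.

Let mge0 (A : set (borel T)) : (0 <= cpush_fun A)%E. Proof. exact: measure_ge0. Qed.

Let mpre (A : set (borel T)) :
  measurable A -> measurable (f @^-1` A : set (borel S)).
Proof.
by move=> mA; rewrite -[X in measurable X]setTI;
   exact: (continuous_borel_measurable cf).
Qed.

Let msigma : semi_sigma_additive cpush_fun.
Proof.
move=> F mF tF mUF; rewrite /cpush_fun preimage_bigcup.
apply: measure_semi_sigma_additive.
- by move=> n; exact: mpre.
- apply/trivIsetP => /= i j _ _ ij; rewrite -preimage_setI.
  by move/trivIsetP : tF => /(_ _ _ _ _ ij) ->//; rewrite preimage_set0.
- by rewrite -preimage_bigcup; exact: mpre.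
Qed.

HB.instance Definition _ := isMeasure.Build _ _ _ cpush_fun m0 mge0 msigma.

Let mfin : fin_num_fun cpush_fun.
Proof. by move=> A mA; apply: fin_num_measure; exact: mpre. Qed.

HB.instance Definition _ := Measure_isFinite.Build _ _ _ cpush_fun mfin.

Definition cpush : fmeasure T := cpush_fun.

End image_measure.


Definition marginal1 (S T : ptopologicalType)
    (gamma : fmeasure (S * T)%type) : fmeasure S :=
  cpush (@fst_continuous S T) gamma.

Definition marginal2 (S T : ptopologicalType)
    (gamma : fmeasure (S * T)%type) : fmeasure T :=
  cpush (@snd_continuous S T) gamma.

Definition supp (T : ptopologicalType) (mu : fmeasure T) : set T :=
  [set x | forall U : set T, open U -> U x -> (0 < mu U)%E].

End borel_measures.

Section isometric_embeddings.
Variable R : realType.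

Record isometric_embedding (X Y : metricType R) (A : set X) := {
  isom_fun :> A -> Y;
  isom_mdist : forall x y : A,
    mdist (isom_fun x) (isom_fun y) = mdist (set_val x) (set_val y)
}.

Context (X Y : polishMetricType R).
Variables (mu : fmeasure R X) (psi : isometric_embedding Y (supp mu)).

Definition push_supp_fun : set (borel Y) -> \bar R :=
  fun A => mu (set_val @` (psi @^-1` A)).

Let closed_supp : closed (supp mu).
Proof.
rewrite -openC openE => x /= /existsNP[U /not_implyP[oU /not_implyP[Ux mU]]].
apply: (filterS _ (open_nbhs_nbhs (conj oU Ux))) => y Uy sy.
exact/mU/sy.
Qed.

Let mimg (A : set (borel Y)) :
  measurable A -> measurable (set_val @` (psi @^-1` A) : set (borel X)).
Proof.
have msupp : measurable (supp mu : set (borel X)).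
  rewrite -[X in measurable X]setCK; apply: measurableC.
  by apply: sub_sigma_algebra; rewrite /= openC.
pose C := [set A : set (borel Y) |
  measurable (set_val @` (psi @^-1` A) : set (borel X))].
suff sC : <<s @open Y >> `<=` C by exact: sC.
apply: smallest_sub; first split.
- by rewrite /C /= preimage_set0 image_set0.
- move=> B CB; rewrite setTD /C /=.
  rewrite (_ : _ @` _ = supp mu `\` set_val @` (psi @^-1` B)).
    exact: measurableD.
  apply/seteqP; split => [_ [p nBp <-]|x [sx nBx]].
    split; first exact: set_valP.
    by move=> [q Bq /val_inj qp]; apply: nBp; rewrite -qp.
  exists (SigSub (mem_set sx)) => // Bx; apply: nBx.
  by exists (SigSub (mem_set sx)).
- move=> B CB; rewrite /C /= preimage_bigcup image_bigcup.
  by apply: bigcupT_measurable => n; exact: CB.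
- move=> U oU; rewrite /C /=.
  pose V := \bigcup_(pe in [set pe : supp mu * R |
    (0 < pe.2)%R /\ ball (psi pe.1) pe.2 `<=` U]) ball (set_val pe.1) pe.2.
  rewrite (_ : _ @` _ = V `&` supp mu).
    apply: measurableI => //; apply: sub_sigma_algebra.
    apply: bigcup_open => -[p e] /= _; rewrite openE => x /=.
    rewrite ballEmdist /= => pxe.
    apply/nbhs_ballP; exists (e - mdist (set_val p) x)%R => /=.
      by rewrite subr_gt0.
    move=> y; rewrite !ballEmdist /= => xy.
    by rewrite (le_lt_trans (metric_triangle _ x _))// -ltrBrDl.
  apply/seteqP; split => [_ [p Up <-]|x [[[p e] /= [e0 peU] pex] sx]].
    split; last exact: set_valP.
    move: oU; rewrite openE => /(_ _ Up) /nbhs_ballP[e /= e0 eU].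
    by exists (p, e) => //=; exact: ballxx.
  exists (SigSub (mem_set sx)) => //=; apply: peU.
  by move: pex; rewrite !ballEmdist /= isom_mdist.
Qed.

Let m0 : push_supp_fun set0 = 0%E.
Proof. by rewrite /push_supp_fun preimage_set0 image_set0 measure0. Qed.

Let mge0 (A : set (borel Y)) : (0 <= push_supp_fun A)%E.
Proof. exact: measure_ge0. Qed.

Let msigma : semi_sigma_additive push_supp_fun.
Proof.
move=> F mF tF mUF; rewrite /push_supp_fun preimage_bigcup image_bigcup.
apply: measure_semi_sigma_additive.
- by move=> n; exact: mimg.
- apply/trivIsetP => /= i j _ _ ij; apply/seteqP; split => // x.
  move=> [[a /= Fa <-] [b /= Fb /val_inj ba]].
  move/trivIsetP : tF => /(_ _ _ I I ij) Fij.
  suff : (F i `&` F j) (psi a) by rewrite Fij.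
  by split; [exact: Fa|rewrite -ba].
- by rewrite -image_bigcup -preimage_bigcup; exact: mimg.
Qed.

HB.instance Definition _ := isMeasure.Build _ _ _ push_supp_fun m0 mge0 msigma.

Let mfin : fin_num_fun push_supp_fun.
Proof. by move=> A mA; apply: fin_num_measure; exact: mimg. Qed.

HB.instance Definition _ := Measure_isFinite.Build _ _ _ push_supp_fun mfin.

(* [psi] is defined on the support only, hence the image under [set_val] in
   [push_supp_fun] instead of a plain [pushforward]. *)
Definition push_supp : fmeasure R Y := push_supp_fun.

End isometric_embeddings.

Section entropy_transport.
Variable R : realType.
Local Open Scope ereal_scope.

(* Functions on the half-line [0, +oo[ are total functions on [R] whose values
   at negative arguments are irrelevant. *)
Definition convex_on_nneg (f : R -> \bar R) :=
  forall x y t : R, (0 <= x)%R -> (0 <= y)%R -> (0 <= t <= 1)%R ->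
    f (t * x + (1 - t) * y)%R <= t%:E * f x + (1 - t)%:E * f y.

Record Gamma0 (F : R -> \bar R) : Prop := {
  Gamma0_ge0 : forall s, (0 <= s)%R -> 0 <= F s;
  Gamma0_convex : convex_on_nneg F;
  Gamma0_lsc : lower_semicontinuous (F : subspace `[0%R, +oo[ -> \bar R);
  Gamma0_1 : F 1%R = 0
}.

Definition recession (F : R -> \bar R) : \bar R :=
  lim (F s * (s^-1)%:E @[s --> +oo%R]).

Definition superlinear (F : R -> \bar R) := recession F = +oo.

Definition finite_valued (F : R -> \bar R) :=
  forall s, (0 <= s)%R -> F s \is a fin_num.

Record lebesgue_decomposition (T : ptopologicalType) (gamma mu : fmeasure R T)
    (sigma : borel T -> R) (gperp : fmeasure R T) : Prop := {
  ld_measurable : measurable_fun [set: borel T] sigma;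
  ld_ge0 : forall x, (0 <= sigma x)%R;
  ld_sum : forall A : set (borel T), measurable A ->
    gamma A = \int[mu]_(x in A) (sigma x)%:E + gperp A;
  ld_singular : exists2 N : set (borel T), measurable N &
    mu N = 0 /\ gperp (~` N) = 0
}.

(* [xget] selects a version of the Lebesgue decomposition; it exists since the
   measures are finite, its density is unique up to [mu]-negligible sets, and
   its singular part is unique as a Borel measure. *)
Definition F_divergence (T : ptopologicalType) (F : R -> \bar R)
    (gamma mu : fmeasure R T) : \bar R :=
  let p := xget ((fun=> 0%R) : borel T -> R, mzero : fmeasure R T)
    [set p | lebesgue_decomposition gamma mu p.1 p.2] in
  \int[mu]_x F (p.1 x) + recession F * p.2 [set: borel T].

Definition ET (T : ptopologicalType) (F : R -> \bar R) (c : T * T -> \bar R)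
    (mu1 mu2 : fmeasure R T) : \bar R :=
  ereal_inf [set F_divergence F (marginal1 gamma) mu1 +
                 F_divergence F (marginal2 gamma) mu2 +
                 \int[gamma]_z c z | gamma in [set: fmeasure R (T * T)%type]].

Definition ET_dist (a : R) (F l : R -> \bar R) (X : polishMetricType R)
    (mu1 mu2 : fmeasure R X) : \bar R :=
  ET F (fun z => l (mdist z.1 z.2)) mu1 mu2 `^ a.

Record cost_profile (l : R -> \bar R) : Prop := {
  cost_ge0 : forall s, (0 <= s)%R -> 0 <= l s;
  cost_continuous : {within `[0%R, +oo[, continuous l};
  cost_convex : convex_on_nneg l;
  cost_eq0 : forall s, (0 <= s)%R -> (l s = 0 <-> s = 0%R)
}.

(* The metric is spelled out on representatives: [D] vanishes exactly on equal
   Borel measures, see [fmeasure_eq]. *)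
Record metrizes_weak (T : ptopologicalType)
    (D : fmeasure R T -> fmeasure R T -> \bar R) : Prop := {
  mw_fin : forall mu nu, D mu nu \is a fin_num;
  mw_ge0 : forall mu nu, 0 <= D mu nu;
  mw_eq0 : forall mu nu, D mu nu = 0 <-> fmeasure_eq mu nu;
  mw_sym : forall mu nu, D mu nu = D nu mu;
  mw_triangle : forall mu nu xi, D mu xi <= D mu nu + D nu xi;
  mw_complete : forall u : nat -> fmeasure R T,
    (forall e : R, (0 < e)%R -> exists N : nat, forall m n : nat,
      (N <= m)%N -> (N <= n)%N -> D (u m) (u n) < e%:E) ->
    exists mu, forall e : R, (0 < e)%R -> exists N : nat, forall n : nat,
      (N <= n)%N -> D (u n) mu < e%:E;
  mw_separable : exists2 S : set (fmeasure R T), countable S &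
    forall mu (e : R), (0 < e)%R -> exists2 nu, S nu & D mu nu < e%:E;
  mw_weak : forall U : set (fmeasure R T),
    open (U : set (weak_fmeasure R T)) <->
    forall mu, U mu -> exists2 e : R, (0 < e)%R &
      [set nu | D mu nu < e%:E] `<=` U
}.

Record regular_ET (a : R) (F l : R -> \bar R) : Prop := {
  reg_a : (0 < a <= 1)%R;
  reg_Gamma0 : Gamma0 F;
  reg_superlinear : superlinear F;
  reg_finite : finite_valued F;
  reg_cost : cost_profile l;
  reg_metric : forall X : polishMetricType R,
    metrizes_weak (@ET_dist a F l X)
}.

Definition sturm_ET (a : R) (F l : R -> \bar R) (X1 X2 : polishMetricType R)
    (mu1 : fmeasure R X1) (mu2 : fmeasure R X2) : \bar R :=
  ereal_inf [set r | exists (Y : polishMetricType R)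
    (psi1 : isometric_embedding Y (supp mu1))
    (psi2 : isometric_embedding Y (supp mu2)),
    r = ET_dist a F l (push_supp psi1) (push_supp psi2)].

Record pseudometric_coupling (X1 X2 : metricType R)
    (d : X1 + X2 -> X1 + X2 -> R) : Prop := {
  pmc_diag : forall p, d p p = 0%R;
  pmc_sym : forall p q, d p q = d q p;
  pmc_triangle : forall p q r, (d p r <= d p q + d q r)%R;
  pmc_inl : forall x y : X1, d (inl x) (inl y) = mdist x y;
  pmc_inr : forall x y : X2, d (inr x) (inr y) = mdist x y
}.

End entropy_transport.

(* Main.v *)
(* A coupling of the two metrics restricts to a "bridge" [h : X1 -> X2 -> R].
   For a plan [g] on [X1 * X2] and a bridge [h], let [E g h] be the
   entropy-transport energy with cost [l (h x y)].

   [E] has a minimizer.  Along a minimizing sequence the entropy bounds and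
   superlinearity make the marginals uniformly absolutely continuous with
   respect to [mu1] and [mu2], so the plans are almost concentrated on finitely
   many small balls; discretizing them there shows that a subsequence is Cauchy
   for the complete distance [D_ET] of [X1 * X2], hence weakly convergent.
   Bridges are equi-Lipschitz: either a subsequence converges pointwise to a
   bridge, or they diverge everywhere, and then the limit plan vanishes.  The
   divergences are lower semicontinuous because uniform absolute continuity
   upgrades weak convergence of the marginals to setwise convergence.

   The minimum of [E] is the Sturm distance to the power [1 / a].  Plans on
   an ambient space pull back to [X1 * X2] along the inverses of the embeddings,
   and the ambient distance dominates a bridge on the supports;
   conversely, the metric quotient of [X1 + X2] for the optimal coupling is an
   ambient space where the minimum is attained. *)

Require Import Defs.
From HB Require Import structures.
From mathcomp Require Import all_boot all_order all_algebra.
From mathcomp Require Import all_classical all_reals all_analysis.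
From mathcomp Require Import measurable_realfun ring lra.

Set Implicit Arguments.
Unset Strict Implicit.
Unset Printing Implicit Defensive.

Import Order.TTheory GRing.Theory Num.Theory.
Import numFieldNormedType.Exports.

Local Open Scope classical_set_scope.
Local Open Scope ring_scope.

(** * Convex functions on the half-line *)

(** Weak compactness of the plans is drawn from the hypothesis itself: [reg_metric] holds in every
    Polish space, hence in [X1 * X2] with the max metric, and its completeness and topology clauses
    take the place of Prokhorov's theorem. An infinite recession excludes singular parts as soon as
    the energy is finite, so only densities are followed to the limit; finiteness of [F 0] makes the
    null plan an admissible competitor and prices the mass lost when a plan is discretized. In the
    transport term both the plan and the cost vary along the sequence, which weak convergence alone
    does not handle: the costs are first bounded below by truncated infima over tails, which are
    fixed bounded continuous functions. Embeddings are defined on the supports only, whereas a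
    coupling lives on the whole spaces: an infimum over paths extends the ambient distance to a
    bridge. Diverging bridges do no harm, because a null limit plan has the same energy for every
    bridge. *)

Section convex_half_line.
Context {R : realType} (f : R -> R).
Hypothesis f_ge0 : forall s : R, 0 <= s -> 0 <= f s.
Hypothesis f_convex : forall x y t : R, 0 <= x -> 0 <= y -> 0 <= t <= 1 ->
  f (t * x + (1 - t) * y) <= t * f x + (1 - t) * f y.
Hypothesis f_lsc : forall t e : R, 0 <= t -> 0 < e -> exists2 d : R, 0 < d &
  forall s : R, 0 <= s -> `|s - t| < d -> f t - e < f s.

Lemma convex_three_slopes (s q t : R) : 0 <= s -> s < q -> q < t ->
  (f q - f s) * (t - q) <= (f t - f q) * (q - s).
Proof.
move=> s0 sq qt.
have ts : 0 < t - s by rewrite subr_gt0 (lt_trans sq).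
pose c := (t - q) / (t - s).
have c01 : 0 <= c <= 1.
  by apply/andP; split; [apply: divr_ge0; lra|rewrite ler_pdivrMr//; lra].
have t0 : 0 <= t by rewrite (le_trans s0)// ltW// (lt_trans sq).
have := f_convex s0 t0 c01.
have -> : c * s + (1 - c) * t = q by rewrite /c; field; rewrite gt_eqF.
rewrite -(ler_pM2l ts) => h.
have e1 : (t - s) * (c * f s + (1 - c) * f t) = (t - q) * f s + (q - s) * f t.
  by rewrite /c; field; rewrite gt_eqF.
by move: h; rewrite e1; lra.
Qed.

(** The left derivative works: it is the supremum of the slopes of the chords ending at [q], and by
    the three-slopes inequality every slope to the right bounds it. The family is nonempty because
    [q > 0]. *)
Lemma convex_subgradient (q : R) : 0 < q ->
  exists p, forall t, 0 <= t -> f q + p * (t - q) <= f t.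
Proof.
move=> q0.
pose S := [set (f q - f s) / (q - s) | s in [set s | 0 <= s < q]].
have ubS t : q < t -> ubound S ((f t - f q) / (t - q)).
  move=> qt _ [s /= /andP[s0 sq] <-].
  rewrite ler_pdivrMr ?subr_gt0// mulrAC ler_pdivlMr ?subr_gt0//.
  exact: convex_three_slopes.
have S0 : S !=set0 by exists ((f q - f 0) / (q - 0)), 0 => //=; rewrite lexx.
have hS : has_sup S.
  by split => //; exists ((f (q + 1) - f q) / (q + 1 - q)); apply: ubS; lra.
exists (sup S) => t t0; case: (ltgtP t q) => [tq|qt|->].
- have : (f q - f t) / (q - t) <= sup S.
    by apply: ub_le_sup; [case: hS|exists t => //=; rewrite t0].
  by rewrite ler_pdivrMr ?subr_gt0//; lra.
- have : sup S <= (f t - f q) / (t - q) by apply: ge_sup => //; exact: ubS.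
  by rewrite ler_pdivlMr ?subr_gt0//; lra.
- by rewrite subrr mulr0 addr0.
Qed.

(* If [p] is a subgradient at [q > t], evaluating it at [2 q - t] gives
   [f q + p (t - q) >= 2 f q - f (2 q - t)], which tends to [f t] as [q]
   decreases to [t], including at the endpoint [t = 0]. *)
Lemma convex_lsc_affine_sup : exists al be : nat -> R,
  (forall n t, 0 <= t -> al n * t + be n <= f t) /\
  (forall t e, 0 <= t -> 0 < e -> exists n, f t - e < al n * t + be n).
Proof.
(* Tangent lines at the positive rationals, indexed by their codes; every other index receives the
   zero function, a minorant since [f >= 0]. *)
have /choice[ab hab] : forall n : nat, exists p : R * R,
    (forall t, 0 <= t -> p.1 * t + p.2 <= f t) /\
    (forall q : rat, unpickle n = Some q -> 0 < ratr q :> R ->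
       p.2 = f (ratr q) - p.1 * ratr q).
  move=> n; case: (pselect (exists2 q : rat, unpickle n = Some q & 0 < ratr q :> R)).
    move=> [q nq q0]; have [p hp] := convex_subgradient q0.
    exists (p, f (ratr q) - p * ratr q); split => /= [t t0|q'].
      by have := hp _ t0; lra.
    by rewrite nq => -[<-].
  move=> nex; exists (0, 0); split => /= [t t0|q nq q0].
    by rewrite mul0r addr0 f_ge0.
  by exfalso; apply: nex; exists q.
exists (fun n => (ab n).1), (fun n => (ab n).2); split.
  by move=> n; have [] := hab n.
move=> t e t0 e0.
have e4 : 0 < e / 4 by rewrite divr_gt0.
have [d d0 hd] := f_lsc t0 e4.
pose D := `|f (t + 1) - f t| + 1.
have D0 : 0 < D by rewrite ltr_wpDl.
(* A rational [q] in []t, t + m / 2[] has [c = 2 (q - t) <= m]: then [q] is in reach of the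
   semicontinuity at [t], [c <= 1], and [c D <= e / 4]. *)
pose m := Num.min d (Num.min 1 (e / 4 / D)).
have m0 : 0 < m by rewrite !lt_min d0 ltr01 divr_gt0.
have /rat_in_itvoo[q] : t < t + m / 2 by rewrite ltrDl divr_gt0.
rewrite in_itv/= => /andP[tq qm].
have [h1 h2] := hab (pickle q); exists (pickle q).
have q0 : 0 < ratr q :> R by exact: le_lt_trans tq.
rewrite (h2 q) ?pickleK//.
set Q : R := ratr q in tq qm q0 *.
have [md m1 me] : [/\ m <= d, m <= 1 & m <= e / 4 / D].
  by split; rewrite !ge_min lexx ?orbT.
have := h1 (2 * Q - t) ltac:(lra); rewrite (h2 q) ?pickleK// -/Q => h3.
have h4 : f t - e / 4 < f Q by apply: hd; [exact: ltW|rewrite gtr0_norm; lra].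
(* The upper bound comes from the chord over [[t, t + 1]], so it also holds at [t = 0], where no
   chord to the left exists. *)
have h5 : f (2 * Q - t) <= f t + e / 4.
  pose c := 2 * Q - 2 * t.
  have c01 : 0 <= c <= 1 by apply/andP; split; rewrite /c; lra.
  have := f_convex (_ : 0 <= t + 1) t0 c01.
  have -> : c * (t + 1) + (1 - c) * t = 2 * Q - t by rewrite /c; ring.
  move=> /(_ ltac:(lra)) h; apply: (le_trans h).
  have cm : c <= m by rewrite /c; lra.
  have : c * (f (t + 1) - f t) <= m * D.
    apply: (@le_trans _ _ (c * D)).
      apply: ler_wpM2l; first by case/andP: c01.
      by rewrite /D (le_trans (ler_norm _))// lerDl.
    by apply: ler_wpM2r => //; exact: ltW.
  have : m * D <= e / 4 by rewrite -ler_pdivlMr.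
  lra.
lra.
Qed.

(** Starting at 0 keeps the maxima nonnegative, as monotone convergence requires; for a nonnegative
    [f] the supremum is unchanged. *)
Fixpoint affine_max (al be : nat -> R) (J : nat) (t : R) : R :=
  if J is K.+1 then Num.max (affine_max al be K t) (al K * t + be K) else 0.

Lemma affine_max_nd al be t : nondecreasing_seq (affine_max al be ^~ t).
Proof.
by apply/nondecreasing_seqP => J; rewrite /= le_max lexx.
Qed.

Lemma affine_max_ge0 al be J t : 0 <= affine_max al be J t.
Proof.
exact: (@affine_max_nd al be t 0%N J).
Qed.

Lemma measurable_affine_max al be J : measurable_fun setT (affine_max al be J).
Proof.
elim: J => [|J ih]; first exact: measurable_cst.
apply: measurable_maxr => //.
by apply: measurable_funD => //; exact: measurable_funM.
Qed.

Lemma affine_max_le al be J t : 0 <= t ->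
  (forall n t, 0 <= t -> al n * t + be n <= f t) -> affine_max al be J t <= f t.
Proof.
move=> t0 h; elim: J => [|J ih]; first exact: f_ge0.
by rewrite /= ge_max ih h.
Qed.

Lemma cvg_affine_max al be t : 0 <= t ->
  (forall n t, 0 <= t -> al n * t + be n <= f t) ->
  (forall t e, 0 <= t -> 0 < e -> exists n, f t - e < al n * t + be n) ->
  affine_max al be J t @[J --> \oo] --> f t.
Proof.
move=> t0 h1 h2; apply/cvgrPdist_lt => e e0.
have [n hn] := h2 _ _ t0 e0; exists n.+1 => // J /= nJ.
have h3 := affine_max_le J t0 h1.
rewrite ger0_norm ?subr_ge0//.
have := affine_max_nd al be t nJ; rewrite /= ge_max => /andP[_ h4].
lra.
Qed.

End convex_half_line.

(** * Densities of finite measures *)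

(** An alias that carries the proof of finiteness, so that the finite-measure structure can be
    attached to it. *)
Definition finite_measure_of d (T : measurableType d) (R : realType)
  (m : {measure set T -> \bar R}) & fin_num_fun m : set T -> \bar R := m.

Section finite_measure_of.
Context d (T : measurableType d) (R : realType).
Variables (m : {measure set T -> \bar R}) (fm : fin_num_fun m).

HB.instance Definition _ := Measure.on (finite_measure_of fm).

HB.instance Definition _ :=
  Measure_isFinite.Build _ _ _ (finite_measure_of fm) fm.

End finite_measure_of.

Section finite_measures.
Context d (T : measurableType d) (R : realType).
Local Open Scope ereal_scope.

Lemma finite_measure_add (m1 m2 : {finite_measure set T -> \bar R}) :
  exists n : {finite_measure set T -> \bar R}, forall A, n A = m1 A + m2 A.
Proof.
have fm : fin_num_fun (measure_add m1 m2).
  move=> A mA; rewrite (_ : _ A = m1 A + m2 A); last exact: measure_addE.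
  by rewrite fin_numD !fin_num_measure.
by exists (finite_measure_of fm) => A; rewrite -measure_addE.
Qed.

Lemma finite_measure_sum (m : {finite_measure set T -> \bar R}^nat) (n : nat) :
  exists s : {finite_measure set T -> \bar R},
    forall A, s A = \sum_(k < n) m k A.
Proof.
have fm : fin_num_fun (msum m n).
  by move=> A mA; apply/sum_fin_numP => /= k _ _; exact: fin_num_measure.
by exists (finite_measure_of fm).
Qed.

Lemma finite_measure_scale (r : R) (m : {finite_measure set T -> \bar R}) :
  (0 <= r)%R -> exists s : {finite_measure set T -> \bar R},
    forall A, s A = r%:E * m A.
Proof.
by move=> r0; exists (mscale (NngNum r0) m).
Qed.

Lemma finite_measure_restr (m : {finite_measure set T -> \bar R}) D :
  measurable D -> exists s : {finite_measure set T -> \bar R},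
    forall A, s A = m (A `&` D).
Proof. by move=> mD; exists (mrestr m mD). Qed.

Definition has_density (nu mu : set T -> \bar R) (sigma : T -> R) :=
  [/\ measurable_fun setT sigma, (forall x, (0 <= sigma x)%R) &
      forall A, measurable A -> nu A = \int[mu]_(x in A) (sigma x)%:E].

Lemma dominates_has_density (nu mu : {finite_measure set T -> \bar R}) :
  (forall A, measurable A -> mu A = 0 -> nu A = 0) ->
  exists sigma, has_density nu mu sigma.
Proof.
move=> numu; have [|f [f0 ffin fint fE]] := @radon_nikodym_sigma_finite _ _ _ mu nu.
  exact/null_content_dominatesP.
exists (fine \o f); split => [|x|A mA].
- apply: measurableT_comp; first exact: fine_measurable.
  exact: measurable_int fint.
- by rewrite /= fine_ge0.
- by rewrite fE//; apply: eq_integral => x _; rewrite /= fineK.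
Qed.

Lemma has_density_ae_eq (nu mu : {finite_measure set T -> \bar R}) s1 s2 :
  has_density nu mu s1 -> has_density nu mu s2 ->
  ae_eq mu setT (EFin \o s1) (EFin \o s2).
Proof.
move=> [ms1 s10 E1] [ms2 s20 E2]; apply: integral_ae_eq => //.
- apply/integrableP; split; first exact/measurable_EFinP.
  under eq_integral do rewrite /= ger0_norm//.
  by rewrite -E1// ltey_eq fin_num_measure.
- exact/measurable_EFinP.
- by move=> E _ mE; rewrite -E1// -E2.
Qed.

(** A Radon-Nikodym density exceeds 1 only on a null set, since [s - 1] integrates to
    [nu B - mu B <= 0] over [B = {s > 1}]. Truncation turns the almost everywhere bound into a
    pointwise one. *)
Lemma has_density_le1 (nu mu : {finite_measure set T -> \bar R}) :
  (forall A, measurable A -> nu A <= mu A) ->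
  exists2 sigma, has_density nu mu sigma & forall x, (sigma x <= 1)%R.
Proof.
move=> numu; have [A mA mu0|s [ms s0 sE]] := @dominates_has_density nu mu.
  by apply/eqP; rewrite -measure_le0 -mu0 numu.
exists (fun x => Num.min (s x) 1%R); last first.
  by move=> x; rewrite ge_min lexx orbT.
have ms' : measurable_fun setT (fun x => Num.min (s x) 1%R).
  by apply: measurable_minr.
split => // [x|A mA]; first by rewrite le_min s0 ler01.
rewrite sE//; pose B := [set x | (1 < s x)%R].
have mB : measurable B.
  rewrite (_ : B = s @^-1` `]1%R, +oo[); last first.
    by apply/seteqP; split => x; rewrite /B /= in_itv/= andbT.
  by rewrite -[X in measurable X]setTI; exact: ms.
have ints : mu.-integrable B (fun x => (s x)%:E).
  apply/integrableP; split; first exact/measurable_EFinP/measurable_funTS.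
  rewrite (eq_integral (fun x => (s x)%:E)); last first.
    by move=> x _; rewrite /= ger0_norm.
  by rewrite -sE// ltey_eq fin_num_measure.
have intB : \int[mu]_(x in B) `|(s x - 1)%:E| = 0.
  apply/eqP; rewrite eq_le integral_ge0// andbT.
  rewrite (eq_integral (fun x => (s x)%:E + (- 1)%:E)); last first.
    by move=> x; rewrite inE /B /= => x1; rewrite -EFinD ger0_norm// subr_ge0 ltW.
  rewrite integralD//; last exact: finite_measure_integrable_cst.
  rewrite -sE// (integral_cst _ mB) EFinN mulN1e sube_le0.
  exact: numu.
have mB1 : measurable_fun B (fun x => (s x - 1)%:E).
  apply/measurable_EFinP; apply: measurable_funB => //.
  exact: measurable_funTS.
have /(ae_eq_integral_abs mu mB mB1)[N [mN N0 BN]] := intB.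
apply: ge0_ae_eq_integral => //.
- exact/measurable_EFinP/measurable_funTS.
- exact/measurable_EFinP/measurable_funTS.
- by move=> x _; rewrite lee_fin.
- by move=> x _; rewrite lee_fin le_min s0 ler01.
- exists N; split => // x /= /not_implyP[Ax sx]; apply: BN => /=.
  apply/not_implyP; have [sx1|sx1] := leP (s x) 1%R.
    by exfalso; apply: sx; rewrite min_l.
  by split => //; case => /eqP; rewrite gt_eqF// subr_gt0.
Qed.
End finite_measures.

(** * The F-divergence *)

Section lebesgue_decomposition.
Context (R : realType) (T : ptopologicalType).
Local Open Scope ereal_scope.

(** Von Neumann's argument: let [h] be the density of [mu] with respect to [gamma + mu]. The set
    [{h = 0}] is [mu]-null and carries the singular part; off it, a [mu]-null set is null for the
    sum, hence for [gamma]. *)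
Lemma lebesgue_decomposition_exists (gamma mu : fmeasure R T) :
  exists sigma gperp, lebesgue_decomposition gamma mu sigma gperp.
Proof.
have [la laE] := finite_measure_add gamma mu.
have [A mA|h [mh h0 hE]] := @dominates_has_density _ _ _ mu la.
  move=> /eqP; rewrite laE padde_eq0 ?measure_ge0// => /andP[_ /eqP//].
pose N := h @^-1` [set 0%R].
have mN : measurable N by rewrite -[N]setTI; apply: mh.
have mNC : measurable (~` N) by exact: measurableC.
have [g1 g1E] := finite_measure_restr gamma mNC.
have [g2 g2E] := finite_measure_restr gamma mN.
have [A mA A0|s [ms s0 sE]] := @dominates_has_density _ _ _ g1 mu.
  have mAN : measurable (A `&` ~` N) by exact: measurableI.
  have mhA : measurable_fun A (EFin \o h).
    exact/measurable_EFinP/measurable_funTS.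
  have : \int[la]_(x in A) `|(h x)%:E| = 0.
    under eq_integral do rewrite gee0_abs ?lee_fin//.
    by rewrite -hE.
  move=> /(ae_eq_integral_abs la mA mhA)[M [mM M0 AM]].
  rewrite g1E; apply/eqP; rewrite -measure_le0.
  rewrite (@le_trans _ _ (la (A `&` ~` N)))//.
    by rewrite laE leeDl.
  rewrite -M0 le_measure ?inE// => x [Ax Nx]; apply: AM => /=.
  by apply/not_implyP; split => // -[].
exists s, g2; split => // [A mA|].
  rewrite -sE// g1E g2E -measureU//; first by rewrite -setIUr setUC setUv setIT.
  - exact: measurableI.
  - exact: measurableI.
  - by rewrite setIACA setICl setI0.
exists N => //; split; last by rewrite g2E setICl measure0.
rewrite hE// (eq_integral (cst 0)) ?integral0// => x; rewrite inE /N /=.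
by move=> ->.
Qed.

End lebesgue_decomposition.

Section F_divergence_theory.
Context (R : realType) (F : R -> \bar R).
Hypothesis F_Gamma0 : Gamma0 F.
Hypothesis F_finite : finite_valued F.
Hypothesis F_superlinear : superlinear F.
Local Open Scope ereal_scope.

Let f := fine \o F.

Let FE s : (0 <= s)%R -> F s = (f s)%:E.
Proof. by move=> s0; rewrite fineK// F_finite. Qed.

Let f_ge0 s : (0 <= s)%R -> (0 <= f s)%R.
Proof. by move=> s0; rewrite fine_ge0// Gamma0_ge0. Qed.

Let f_convex (x y t : R) : (0 <= x -> 0 <= y -> 0 <= t <= 1 ->
  f (t * x + (1 - t) * y) <= t * f x + (1 - t) * f y)%R.
Proof.
move=> x0 y0 t01; have := Gamma0_convex F_Gamma0 x0 y0 t01.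
rewrite !FE//; case/andP : t01 => t0 t1.
by rewrite addr_ge0// mulr_ge0// subr_ge0.
Qed.

Let f_lsc (t e : R) : (0 <= t)%R -> (0 < e)%R -> exists2 d, (0 < d)%R &
  forall s, (0 <= s)%R -> (`|s - t| < d)%R -> (f t - e < f s)%R.
Proof.
move=> t0 e0; have := Gamma0_lsc F_Gamma0 (x := t) (a := (f t - e)%R).
rewrite FE// lte_fin ltrBlDr ltrDl => /(_ e0)[V tV hV].
have t0' : `[0%R, +oo[%classic t by rewrite /= in_itv/= t0.
have [d /= d0 hd] : within `[0%R, +oo[ (nbhs t) V by rewrite nbhs_subspace_in.
exists d => // s s0 st; have : V s.
  by apply: hd => /=; [rewrite distrC|rewrite in_itv/= s0].
by move/hV; rewrite FE.
Qed.

Let aff : exists al be : nat -> R,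
  (forall n t, (0 <= t -> al n * t + be n <= f t)%R) /\
  (forall t e, (0 <= t)%R -> (0 < e)%R ->
    exists n, (f t - e < al n * t + be n)%R).
Proof. exact: convex_lsc_affine_sup f_ge0 f_convex f_lsc. Qed.

Lemma F_affine_approx : exists al be : nat -> R,
  [/\ (forall n t, (0 <= t)%R -> (al n * t + be n)%:E <= F t),
      (forall J t, (0 <= t)%R -> (affine_max al be J t)%:E <= F t) &
      (forall t, (0 <= t)%R ->
        (affine_max al be J t)%:E @[J --> \oo] --> F t)].
Proof.
have [al [be [h1 h2]]] := aff; exists al, be; split => [n t t0|J t t0|t t0].
- by rewrite FE// lee_fin h1.
- by rewrite FE// lee_fin (affine_max_le f_ge0).
- by rewrite FE//; apply: cvg_EFin; [exact: nearW|exact: cvg_affine_max].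
Qed.

Lemma measurable_F_comp d (T : measurableType d) (s : T -> R) :
  measurable_fun setT s -> (forall x, (0 <= s x)%R) ->
  measurable_fun setT (F \o s).
Proof.
move=> ms s0; have [al [be [_ _ h]]] := F_affine_approx.
apply: (@emeasurable_fun_cvg _ _ _ _ (fun J x => (affine_max al be J (s x))%:E)).
  move=> J; apply/measurable_EFinP.
  exact: (measurableT_comp (measurable_affine_max al be J)).
by move=> x _; exact: h.
Qed.

Lemma F_divergence_ge0 (T : ptopologicalType) (gamma mu : fmeasure R T) :
  0 <= F_divergence F gamma mu.
Proof.
have [s [g gs]] := lebesgue_decomposition_exists gamma mu.
rewrite /F_divergence; set P := [set p | _]; set p0 := (X in xget X).
have [_ s0 _ _] : P (xget p0 P) by apply: (@xgetPex _ p0 P); exists (s, g).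
rewrite adde_ge0 ?integral_ge0// => [x _|]; first exact: Gamma0_ge0.
by rewrite mule_ge0// F_superlinear.
Qed.

(** The version selected by [xget] may differ from [s]. Its singular part sits on a [mu]-null set,
    which [gamma] does not charge, so it vanishes; the two densities then agree almost
    everywhere. *)
Lemma F_divergenceE (T : ptopologicalType) (gamma mu : fmeasure R T) s :
  has_density gamma mu s -> F_divergence F gamma mu = \int[mu]_x F (s x).
Proof.
move=> gs; have [ms s0 sE] := gs.
rewrite /F_divergence; set P := [set p | _]; set p0 := (X in xget X).
have : P (xget p0 P).
  apply: (@xgetPex _ p0 P); exists (s, mzero : fmeasure R T); split => //=.
    by move=> A mA; rewrite /mzero adde0 sE.
  by exists set0 => //; rewrite measure0.
case: (xget p0 P) => s' g [/= ms' s'0 s'E [N mN [muN gN]]].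
have gN0 : g N = 0.
  have : gamma N = 0.
    rewrite sE// null_set_integral//; first exact/measurable_EFinP/measurable_funTS.
  move=> /eqP; rewrite s'E// padde_eq0 ?measure_ge0 ?integral_ge0//.
    by move=> /andP[_ /eqP].
  by move=> x _; rewrite lee_fin.
have gT : g setT = 0.
  have mNC : measurable (~` N) by exact: measurableC.
  have -> : [set: borel T] = N `|` ~` N by rewrite setUv.
  apply: (etrans (measureU g mN mNC (setICr N))).
  exact: etrans (f_equal2 adde gN0 gN) (adde0 0).
rewrite gT mule0 adde0.
have gs' : has_density gamma mu s'.
  split => // A mA; rewrite s'E//.
  rewrite (_ : g A = 0) ?adde0//; apply/eqP; rewrite -measure_le0 -gT.
  by rewrite le_measure ?inE.
have [M [mM M0 sM]] := has_density_ae_eq gs gs'.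
apply: ge0_ae_eq_integral => //.
- exact: measurable_F_comp.
- exact: measurable_F_comp.
- by move=> x _; exact: Gamma0_ge0.
- by move=> x _; exact: Gamma0_ge0.
- exists M; split => // x /= h; apply: sM => /= h'; apply: h => _.
  by have := h' I => /= -[->].
Qed.

(** Infinite recession charges any positive singular mass with [+oo]. *)
Lemma F_divergence_lty (T : ptopologicalType) (gamma mu : fmeasure R T) :
  F_divergence F gamma mu < +oo -> exists s, has_density gamma mu s.
Proof.
have [s [g gs]] := lebesgue_decomposition_exists gamma mu.
rewrite /F_divergence; set P := [set p | _]; set p0 := (X in xget X).
have : P (xget p0 P) by apply: (@xgetPex _ p0 P); exists (s, g).
case: (xget p0 P) => {gs}{}s {}g [/= ms s0 sE _] fin.
have gT : g setT = 0.
  apply/eqP; rewrite eq_le measure_ge0 andbT leNgt; apply/negP => g0.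
  move: fin; rewrite F_superlinear gt0_mulye// addey ?ltxx//.
  by rewrite gt_eqF// (lt_le_trans ltNy0)// integral_ge0// => x _; exact: Gamma0_ge0.
exists s; split => // A mA; rewrite sE//.
rewrite (_ : g A = 0) ?adde0//; apply/eqP; rewrite -measure_le0 -gT.
by rewrite le_measure ?inE.
Qed.

Lemma F_divergence_refl (T : ptopologicalType) (gamma mu : fmeasure R T) :
  fmeasure_eq gamma mu -> F_divergence F gamma mu = 0.
Proof.
move=> gmu; rewrite (@F_divergenceE _ _ _ (cst 1%R)).
  rewrite /= (eq_integral (cst 0)) ?integral0// => x _.
  exact: Gamma0_1.
by split => // A mA; have /= -> := integral_cst mu mA 1; rewrite mul1e gmu.
Qed.

(** The density takes values in [[0, 1]], where convexity and [F 1 = 0] give [F s <= (1 - s) F 0].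
    Thus [F 0] is the price of each unit of mass left out. *)
Lemma F_divergence_le (T : ptopologicalType) (gamma mu : fmeasure R T) :
  (forall A : set (borel T), measurable A -> gamma A <= mu A) ->
  F_divergence F gamma mu <= F 0%R * (mu setT - gamma setT).
Proof.
move=> gmu; have [s gs s1] := has_density_le1 gmu; have [ms s0 sE] := gs.
have F00 : 0 <= F 0%R by exact: Gamma0_ge0.
rewrite (F_divergenceE gs).
have mF : measurable_fun setT (fun x => F 0%R * (1 - s x)%:E).
  rewrite FE//; apply/measurable_EFinP.
  by apply: measurable_funM => //; exact: measurable_funB.
apply: (@le_trans _ _ (\int[mu]_x (F 0%R * (1 - s x)%:E))).
  apply: ge0_le_integral => //.
  - by move=> x _; exact: Gamma0_ge0.
  - exact: measurable_F_comp.
  - move=> x _; have x01 : (0 <= s x <= 1)%R by rewrite s0 s1.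
    have := Gamma0_convex F_Gamma0 ler01 (lexx 0%R) x01.
    by rewrite Gamma0_1// mule0 add0e mulr1 mulr0 addr0 muleC.
have m1s : measurable_fun setT (fun x => (1 - s x)%:E).
  by apply/measurable_EFinP; exact: measurable_funB.
rewrite ge0_integralZl//; last by move=> x _; rewrite lee_fin subr_ge0.
apply: lee_wpmul2l => //; rewrite leeBrDr ?fin_num_measure// sE//.
rewrite -ge0_integralD//; last 3 first.
- by move=> x _; rewrite lee_fin subr_ge0.
- by move=> x _; rewrite lee_fin.
- exact/measurable_EFinP.
under eq_integral do rewrite -EFinD subrK.
by have /= -> := integral_cst mu measurableT 1; rewrite mul1e.
Qed.

Lemma superlinear_bound (c : R) : (0 < c)%R -> exists2 K, (0 <= K)%R &
  forall s, (0 <= s)%R -> s%:E <= K%:E + c%:E * F s.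
Proof.
move=> c0.
have : F s * (s^-1)%:E @[s --> +oo%R] --> +oo.
  rewrite -F_superlinear /recession; set G := (X in cvg_to X _).
  (* A [lim] without convergence takes the default value [point], which is not [+oo]; so the
     equation on [recession] already contains the convergence. *)
  have [//|ncvg] := pselect (cvg G).
  have := F_superlinear; rewrite /superlinear /recession dvgP//.
move=> /cvgeyPge/(_ c^-1%R)[K [_ hK]].
pose M := (Num.max K 0 + 1)%R.
have M0 : (0 < M)%R by rewrite ltr_wpDl// le_max lexx orbT.
have KM : (K < M)%R by rewrite ltr_pwDr// le_max lexx.
exists M => [|s s0]; first exact: ltW.
have [sM|sM] := leP s M.
  rewrite (@le_trans _ _ M%:E)// leeDl//.
  by apply: mule_ge0; [rewrite lee_fin ltW|exact: Gamma0_ge0].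
have sgt0 : (0 < s)%R by exact: lt_trans sM.
have /hK : (K < s)%R by exact: lt_trans sM.
rewrite FE// -!EFinM lee_fin ler_pdivlMr// ler_pdivrMl// => h.
by rewrite -EFinD lee_fin (le_trans h)// lerDr ltW.
Qed.

(** The de la Vallee-Poussin criterion: integrate [s <= K + c F s] over [A] with [c = e / (C + 1)],
    so that [c C <= e]. [K] depends on neither the measures nor the space. *)
Lemma F_divergence_unif_bound (C e : R) : (0 <= C)%R -> (0 < e)%R ->
  exists2 K, (0 <= K)%R & forall (T : ptopologicalType) (gamma mu : fmeasure R T),
    F_divergence F gamma mu <= C%:E ->
    forall A : set (borel T), measurable A -> gamma A <= K%:E * mu A + e%:E.
Proof.
move=> C0 e0; have c0 : (0 < e / (C + 1))%R by rewrite divr_gt0// ltr_wpDl.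
have [K K0 hK] := superlinear_bound c0.
exists K => // T gamma mu gC A mA.
have [|s gs] := @F_divergence_lty _ gamma mu; first exact: le_lt_trans gC (ltry _).
have [ms s0 sE] := gs.
rewrite (F_divergenceE gs) in gC; rewrite sE//.
have mF := measurable_F_comp ms s0.
apply: (@le_trans _ _ (\int[mu]_(x in A) (K%:E + (e / (C + 1))%:E * F (s x)))).
  apply: ge0_le_integral => //.
  - by move=> x _; rewrite lee_fin.
  - exact/measurable_EFinP/measurable_funTS.
  - by apply: emeasurable_funD => //; apply: measurable_funeM; exact: measurable_funTS.
  - by move=> x _; exact: hK.
rewrite ge0_integralD//; first last.
- by apply: measurable_funeM; exact: measurable_funTS.
- by move=> x _; apply: mule_ge0; [rewrite lee_fin ltW|exact: Gamma0_ge0].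
rewrite (integral_cst _ mA) leeD2l// ge0_integralZl//; first last.
- by rewrite lee_fin ltW.
- by move=> x _; exact: Gamma0_ge0.
- exact: measurable_funTS.
apply: (@le_trans _ _ ((e / (C + 1))%:E * C%:E)).
  rewrite lee_pmul2l// (le_trans _ gC)// ge0_subset_integral//.
  by move=> x _; exact: Gamma0_ge0.
rewrite lee_fin mulrAC ler_pdivrMr ?ltr_wpDl// ler_pM2l//.
by rewrite lerDl.
Qed.

End F_divergence_theory.

(** * Polish metric spaces and their Borel measures *)

Section product_metric.
Context {R : realType}.

Section metric.
Context (X Y : metricType R).
Implicit Types p q : X * Y.

(** The max metric is the one whose balls are the products of balls of the existing product
    uniformity. *)
Let dist p q := Num.max (mdist p.1 q.1) (mdist p.2 q.2).

Let dist_ge0 p q : 0 <= dist p q.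
Proof. by rewrite le_max mdist_ge0. Qed.

Let dist_positivity p q : dist p q = 0 -> p = q.
Proof.
case: p q => [x y] [x' y'] /eqP; rewrite eq_le ge_max /= => /andP[/andP[xx' yy'] _].
by congr pair; apply: mdist_positivity; apply/eqP;
  rewrite eq_le mdist_ge0 andbT.
Qed.

Let ballEdist p (e : R) : ball p e = [set q | dist p q < e].
Proof.
apply/seteqP; split => q /=.
  by move=> [] /=; rewrite !ballEmdist/= /dist gt_max => -> ->.
by rewrite /dist gt_max => /andP[? ?]; split; rewrite /= ballEmdist.
Qed.

HB.instance Definition _ := PseudoMetric_isMetric.Build R (X * Y)%type
  dist_ge0 dist_positivity ballEdist.

End metric.

Section complete.
Context (X Y : completeType).

Let prod_cauchy_cvg (F : set_system (X * Y)) :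
  ProperFilter F -> cauchy F -> cvg F.
Proof.
move=> FF cF.
have c1 : cauchy (fst @ F).
  move=> A entA; have [|[P Q] /= [FP FQ] PQA] := cF [set pq | A (pq.1.1, pq.2.1)].
    exists (A, setT); first by split => //; exact: filterT.
    by move=> [[a b] [c e]] /= [Aac _]; exists ((a, c), (b, e)).
  exists (fst @` P, fst @` Q) => /=.
    by split; [move: FP|move: FQ]; apply: filterS => p Pp; exists p.
  by move=> [_ _] /= [[p Pp <-] [q Qq <-]]; exact: (PQA (p, q)).
have c2 : cauchy (snd @ F).
  move=> A entA; have [|[P Q] /= [FP FQ] PQA] := cF [set pq | A (pq.1.2, pq.2.2)].
    exists (setT, A); first by split => //; exact: filterT.
    by move=> [[a b] [c e]] /= [_ Abe]; exists ((a, c), (b, e)).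
  exists (snd @` P, snd @` Q) => /=.
    by split; [move: FP|move: FQ]; apply: filterS => p Pp; exists p.
  by move=> [_ _] /= [[p Pp <-] [q Qq <-]]; exact: (PQA (p, q)).
have {c1}Fx : cvg (fst @ F) by exact: cauchy_cvg c1.
have {c2}Fy : cvg (snd @ F) by exact: cauchy_cvg c2.
apply/cvg_ex; exists (lim (fst @ F), lim (snd @ F)) => /= A [[P Q] /= [xP yQ] PQA].
have FP : F (fst @^-1` P) by exact: Fx.
have FQ : F (snd @^-1` Q) by exact: Fy.
suff : F A by [].
by apply: filterS (filterI FP FQ) => -[a b] [Pa Qb]; exact: PQA.
Qed.

HB.instance Definition _ := Uniform_isComplete.Build (X * Y)%type prod_cauchy_cvg.

End complete.

Section separable.
Context (X Y : polishMetricType R).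

Let prod_separable : exists2 A : set (X * Y), countable A & dense A.
Proof.
have [A cA dA] := @separable_dense R X; have [B cB dB] := @separable_dense R Y.
exists (A `*` B); first exact: countableX.
move=> O [[x y] Oxy] oO.
have [[P Q] /= [xP yQ] PQO] : nbhs (x, y) O by exact: open_nbhs_nbhs.
have [a [Pa Aa]] : P° `&` A !=set0.
  by apply: dA; [exists x; exact: xP|exact: open_interior].
have [b [Qb Bb]] : Q° `&` B !=set0.
  by apply: dB; [exists y; exact: yQ|exact: open_interior].
exists (a, b); split => //; apply: PQO; split => /=; exact: interior_subset.
Qed.

HB.instance Definition _ := isSeparable.Build (X * Y)%type prod_separable.

End separable.

End product_metric.

Section separable_metric.
Context {R : realType} (X : polishMetricType R).

Lemma separable_dense_seq : exists z : nat -> X,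
  forall x e, 0 < e -> exists n, ball (z n) e x.
Proof.
have [A cA dA] := @separable_dense R X.
move: cA => /pfcard_geP[A0|[z]].
  have [||x] := dA setT; [by exists point|exact: openT|].
  by rewrite A0 => -[].
exists z => x e e0.
have [|y [xy Ay]] := dA (ball x e)° _ (open_interior _).
  by exists x; exact: nbhsx_ballx.
have [n _ zny] : [set z n | n in setT] y by exact: surj.
by exists n; apply: ball_sym; rewrite zny; exact: interior_subset.
Qed.

(** The candidates are the balls with centers in a dense sequence and radii [1 / (k + 1)]. One that
    fails [P] gets radius 0, that is, becomes empty, so the family is indexed by all of [nat]. [P]
    will be inclusion in an open set, or inclusion in a null open set. *)
Lemma lindelof_ball (P : set X -> Prop) (A : set X) :
  (forall V W, V `<=` W -> P W -> P V) -> P set0 ->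
  (forall x, A x -> exists2 U, open_nbhs x U & P U) ->
  exists (c : nat -> X) (r : nat -> R),
    A `<=` \bigcup_n ball (c n) (r n) /\ forall n, P (ball (c n) (r n)).
Proof.
move=> PS P0 AP; have [z hz] := separable_dense_seq.
pose c n := if @unpickle (nat * nat)%type n is Some (i, k) then z i else point.
pose s n : R := if @unpickle (nat * nat)%type n is Some (i, k) then k.+1%:R^-1 else 0.
pose r n := if pselect (P (ball (c n) (s n))) then s n else 0.
exists c, r; split => [x /AP[U [oU Ux] PU]|n]; last first.
  rewrite /r; case: (pselect _) => //= _.
  by apply: PS P0 => y; rewrite ballEmdist/= ltNge mdist_ge0.
move: oU; rewrite openE => /(_ _ Ux) /nbhs_ballP[e /= e0 xeU].
(* Half the radius, since a ball around [z k] that contains [x] must still fit into [ball x e]. *)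
have e2 : 0 < e / 2 by rewrite divr_gt0.
pose n := Num.truncn (e / 2)^-1.
have ne : (n.+1%:R^-1 : R) <= e / 2.
  by rewrite -[leRHS]invrK lef_pV2 ?posrE ?invr_gt0// ltW// truncnS_gt.
have [k zkx] := hz x n.+1%:R^-1 ltac:(by []).
exists (pickle (k, n)) => //.
suff kP : P (ball (c (pickle (k, n))) (s (pickle (k, n)))).
  have -> : r (pickle (k, n)) = n.+1%:R^-1.
    by rewrite /r; case: (pselect _) => //= _; rewrite /s pickleK.
  by rewrite /c pickleK.
rewrite /c /s pickleK; apply: PS PU => y zky.
apply: xeU; rewrite [e]splitr; apply: (@ball_triangle _ _ (z k)).
  by apply: le_ball ne _ _; exact: ball_sym.
exact: le_ball ne _ zky.
Qed.

Lemma open_bigcup_ball (U : set X) : open U ->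
  exists (c : nat -> X) (r : nat -> R), U = \bigcup_n ball (c n) (r n).
Proof.
move=> oU; have [||x Ux|c [r [Ucr crU]]] := @lindelof_ball (fun V => V `<=` U) U.
- by move=> V W; exact: subset_trans.
- by [].
- by exists U.
- by exists c, r; apply/seteqP; split => // x [n _]; exact: crU.
Qed.

Lemma ball_open_metric (x : X) (e : R) : open (ball x e).
Proof.
rewrite openE => y; rewrite ballEmdist /= => xy.
apply/nbhs_ballP; exists (e - mdist x y) => /=; first by rewrite subr_gt0.
move=> w; rewrite !ballEmdist /= => yw.
by rewrite (le_lt_trans (metric_triangle _ y _))// -ltrBrDl.
Qed.

End separable_metric.

(** * Borel measurability and images of measures *)

Section borel_sets.
Context (R : realType) (T : ptopologicalType).

Lemma open_borel (U : set (borel T)) : open (U : set T) -> measurable U.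
Proof. exact: sub_sigma_algebra. Qed.

Lemma closed_borel (C : set (borel T)) : closed (C : set T) -> measurable C.
Proof.
move=> cC; rewrite -[C]setCK; apply: measurableC; apply: open_borel.
exact: closed_openC.
Qed.

Lemma continuous_emeasurable (f : T -> \bar R) :
  continuous f -> measurable_fun [set: borel T] f.
Proof.
move=> /continuousP cf.
apply: (measurability _ (ErealGenOInfty.measurableE R)) => // _ [_ [r ->] <-].
rewrite setTI; apply: open_borel; apply: (cf `]r%:E, +oo[%classic).
rewrite (_ : [set` _] = [set y | r%:E < y]%E); first exact: open_ereal_gt_ereal.
by apply/seteqP; split => y; rewrite /= in_itv/= andbT.
Qed.

Lemma continuous_borel_real (f : T -> R) :
  continuous f -> measurable_fun [set: borel T] f.
Proof.
move=> cf; apply/measurable_EFinP; apply: continuous_emeasurable => x.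
by apply: cvg_EFin; [exact: nearW|exact: cf].
Qed.

Lemma measurable_borel d (S : measurableType d) (f : S -> borel T) :
  (forall U : set T, open U -> measurable (f @^-1` U)) ->
  measurable_fun setT f.
Proof.
move=> hf; apply: (@measurability _ _ S (borel T) _ _ (@open T)) => //.
by move=> _ [U oU <-]; rewrite setTI; exact: hf.
Qed.

Lemma measurable_borel_closed d (S : measurableType d) (f : S -> borel T) :
  (forall C : set T, closed C -> measurable (f @^-1` C)) ->
  measurable_fun setT f.
Proof.
move=> hf; apply: measurable_borel => U oU.
rewrite -[U]setCK preimage_setC; apply: measurableC.
exact: (hf (~` U) (open_closedC oU)).
Qed.

End borel_sets.

Section pushforward_fmeasure.
Context (R : realType) (S T : ptopologicalType) (f : S -> T).
Hypothesis mf : measurable_fun [set: borel S] (f : borel S -> borel T).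
Local Open Scope ereal_scope.

Let mpre (A : set (borel T)) :
  measurable A -> measurable (f @^-1` A : set (borel S)).
Proof. by move=> mA; rewrite -[X in measurable X]setTI; exact: mf. Qed.

(** [cpush] takes continuous maps only, whereas the inverses of the embeddings, extended by a
    constant, are merely measurable. *)
Lemma fmeasure_push (mu : fmeasure R S) :
  exists nu : fmeasure R T, forall A, nu A = mu (f @^-1` A).
Proof.
pose m : set (borel T) -> \bar R := fun A => mu (f @^-1` A).
have m0 : m set0 = 0 by rewrite /m preimage_set0 measure0.
have mge0 (A : set (borel T)) : 0 <= m A by exact: measure_ge0.
have msigma : semi_sigma_additive m.
  move=> B mB tB mUB; rewrite /m preimage_bigcup.
  apply: measure_semi_sigma_additive.
  - by move=> n; exact: mpre.
  - apply/trivIsetP => /= i j _ _ ij; rewrite -preimage_setI.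
    by move/trivIsetP : tB => /(_ _ _ _ _ ij) ->//; rewrite preimage_set0.
  - by rewrite -preimage_bigcup; exact: mpre.
pose mm : {measure set (borel T) -> \bar R} :=
  HB.pack m (isMeasure.Build _ _ _ m m0 mge0 msigma).
have fm : fin_num_fun mm by move=> A mA; apply: fin_num_measure; exact: mpre.
by exists (finite_measure_of fm).
Qed.

Lemma integral_push (mu : fmeasure R S) (nu : fmeasure R T) (g : borel T -> \bar R) :
  (forall A : set (borel T), measurable A -> nu A = mu (f @^-1` A)) ->
  measurable_fun setT g -> (forall y, 0 <= g y) ->
  forall A : set (borel T), measurable A ->
  \int[nu]_(y in A) g y = \int[mu]_(x in f @^-1` A) g (f x).
Proof.
move=> nuE mg g0 A mA.
have mgA : measurable_fun A g by exact: measurable_funTS.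
have g0' : {in A, forall y, 0 <= g y} by move=> y _; exact: g0.
rewrite -[RHS](ge0_integral_pushforward mf mu mA mgA g0').
by apply: eq_measure_integral => B mB _; exact: nuE.
Qed.

End pushforward_fmeasure.

Section metric_borel.
Context (R : realType).
Local Open Scope ereal_scope.

(** By separability an open set of the product is a countable union of balls of the max metric, and
    these are rectangles. *)
Lemma measurable_pair_borel d (S : measurableType d) (X Y : polishMetricType R)
    (f : S -> borel X) (g : S -> borel Y) :
  measurable_fun setT f -> measurable_fun setT g ->
  measurable_fun setT (fun s => (f s, g s) : borel (X * Y)%type).
Proof.
move=> mf mg; apply: measurable_borel => U oU.
have [c [r ->]] := open_bigcup_ball oU; rewrite preimage_bigcup.
apply: bigcupT_measurable => n.
rewrite (_ : _ @^-1` _ = f @^-1` ball (c n).1 (r n) `&`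
                         g @^-1` ball (c n).2 (r n)) //.
apply: measurableI; rewrite -[X in measurable X]setTI.
- by apply: mf => //; apply: open_borel; exact: ball_open_metric.
- by apply: mg => //; apply: open_borel; exact: ball_open_metric.
Qed.

Lemma supp_closed (X : polishMetricType R) (mu : fmeasure R X) : closed (supp mu).
Proof.
rewrite -openC openE => x /= /existsNP[U /not_implyP[oU /not_implyP[Ux mU]]].
apply: (filterS _ (open_nbhs_nbhs (conj oU Ux))) => y Uy sy.
exact/mU/sy.
Qed.

(** The complement of the support is covered by null open sets, hence by countably many balls each
    inside one of them. *)
Lemma supp_full (X : polishMetricType R) (mu : fmeasure R X) :
  mu (~` supp mu) = 0.
Proof.
pose P (V : set X) := exists U : set X, [/\ open U, V `<=` U & mu U = 0].
have [||x /existsNP[U /not_implyP[oU /not_implyP[Ux mU]]]|c [r [cov crP]]] :=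
  @lindelof_ball _ X P (~` supp mu).
- by move=> V W VW [U [oU WU U0]]; exists U; split => //; exact: subset_trans WU.
- by exists set0; split; [exact: open0| |exact: measure0].
- exists U => //; exists U; split => //; apply/eqP.
  by rewrite -measure_le0 leNgt; exact/negP.
have mB n : measurable (ball (c n) (r n) : set (borel X)).
  by apply: open_borel; exact: ball_open_metric.
apply/eqP; rewrite -measure_le0.
have mS : measurable (~` supp mu : set (borel X)).
  by apply: measurableC; apply: closed_borel; exact: supp_closed.
have /= := measure_sigma_subadditive mu mB mS cov.
move=> /le_trans; apply; rewrite eseries0// => n _ _.
have [U [oU nU U0]] := crP n; apply/eqP; rewrite -measure_le0 -U0.
by rewrite le_measure ?inE//; exact: open_borel.
Qed.

Lemma urysohn_closed_open (X : polishMetricType R) (C U : set X) :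
  closed C -> open U -> C `<=` U -> exists f : X -> R,
  [/\ continuous f, (forall x, 0 <= f x <= 1)%R, (forall x, C x -> f x = 1%R) &
      (forall x, ~ U x -> f x = 0%R)].
Proof.
move=> cC oU CU.
have : uniform_separator (~` U) C.
  have /(@normal_separatorP R) := @pseudometric_normal R X; apply => //.
    exact: open_closedC.
  by apply/disjoints_subset; exact: subsetC.
move=> /(@uniform_separatorP _ R)[f [cf f01 f0 f1]].
exists f; split => // [x|x Cx|x Ux].
- by have /= := f01 (f x) (ex_intro2 _ _ x I erefl); rewrite in_itv.
- by apply: (f1 (f x)); exists x.
- by apply: (f0 (f x)); exists x.
Qed.

Lemma finite_measure_bigcup_approx d (T : measurableType d)
    (mu : {finite_measure set T -> \bar R}) (B : (set T)^nat) (e : R) :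
  (forall n, measurable (B n)) -> nondecreasing_seq B -> (0 < e)%R ->
  exists n, mu (\bigcup_k B k `\` B n) <= e%:E.
Proof.
move=> mB ndB e0; pose G n := \bigcup_k B k `\` B n.
have mU : measurable (\bigcup_k B k) by exact: bigcupT_measurable.
have mG n : measurable (G n) by exact: measurableD.
have G0 : \bigcap_n G n = set0.
  by apply/seteqP; split => // x Gx; have [[k _ Bk] _] := Gx 0%N I;
    have [] := Gx k I.
have : mu \o G @ \oo --> mu (\bigcap_n G n).
  apply: nonincreasing_cvg_mu => //.
  - by rewrite ltey_eq fin_num_measure.
  - by rewrite G0.
  - move=> m n mn; apply/subsetPset => x [Ux Bnx]; split => // Bmx.
    by apply: Bnx; have /subsetPset := ndB _ _ mn; exact.
rewrite G0 measure0 => /fine_cvgP[_] /cvgr0Pnorm_le/(_ e e0)[n _ hn].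
exists n; have := hn n (leqnn n); rewrite /= ger0_norm ?fine_ge0// -lee_fin.
by rewrite fineK ?fin_num_measure.
Qed.

(** The sets that can be approximated in this way form a sigma-algebra, and it contains the open
    sets. *)
Lemma fmeasure_regular (X : polishMetricType R) (mu : fmeasure R X)
  (A : set (borel X)) (e : R) : measurable A -> (0 < e)%R ->
  exists C U : set X, [/\ closed C, open U, C `<=` A, A `<=` U &
    mu (U `\` C) <= e%:E].
Proof.
have sep (D V : set X) : closed D -> open V -> measurable (V `\` D : set (borel X)).
  by move=> cD oV; apply: measurableD; [exact: open_borel|exact: closed_borel].
pose K := [set A : set (borel X) | forall e : R, (0 < e)%R ->
  exists C U : set X, [/\ closed C, open U, C `<=` A, A `<=` U &
    mu (U `\` C) <= e%:E]].
move=> mA; move=> e0; suff KA : K A by exact: KA.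
move: {e e0}A mA; suff sK : <<s (@open X) >> `<=` K by exact: sK.
apply: smallest_sub; first split => [e e0|B KB e e0|B KB e e0].
- exists set0, set0; split => //; [exact: closed0|exact: open0|].
  by rewrite setD0 measure0 lee_fin ltW.
- have [D [V [cD oV DB BV DV]]] := KB e e0.
  exists (~` V), (~` D); split.
  + exact: open_closedC.
  + exact: closed_openC.
  + by rewrite setTD; exact: subsetC.
  + by rewrite setTD; exact: subsetC.
  + by rewrite (_ : _ `\` _ = V `\` D)// !setDE setCK setIC.
- have e2 n : (0 < e / 2 / (2 ^ n.+1)%:R)%R by rewrite !divr_gt0 ?ltr0n ?expn_gt0.
  have /choice[D /choice[V DV]] : forall n, exists D, exists V : set X,
     [/\ closed D, open V, D `<=` B n, B n `<=` V &
         mu (V `\` D) <= (e / 2 / (2 ^ n.+1)%:R)%:E].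
    by move=> n; exact: KB.
  (* The union of all the [D n] need not be closed. A finite union loses at most [e / 2]; the other
     half of [e] is shared among the [V n] geometrically. *)
  pose E k := \big[setU/set0]_(n < k) D n.
  have cE k : closed (E k).
    by rewrite /E; apply: closed_bigsetU => n _; have [] := DV n.
  have ndE : nondecreasing_seq (E : (set (borel X))^nat).
    by apply/nondecreasing_seqP => k; apply/subsetPset; rewrite /E big_ord_recr; left.
  have [k Ek] := @finite_measure_bigcup_approx _ (borel X) mu E (e / 2)
    (fun k => closed_borel (cE k)) ndE ltac:(by rewrite divr_gt0).
  have EB k' : E k' `<=` \bigcup_n B n.
    rewrite /E; elim: k' => [|k' ih]; first by rewrite big_ord0.
    rewrite big_ord_recr /= => x [/ih//|Dx]; exists k' => //.
    by have [_ _ + _ _] := DV k'; apply.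
  exists (E k), (\bigcup_n V n); split => //.
  + by apply: bigcup_open => n _; have [] := DV n.
  + by apply: subset_bigcup => n _; have [] := DV n.
  have mVD n : measurable (V n `\` D n : set (borel X)).
    by have [cD oV _ _ _] := DV n; exact: sep.
  have mEk : measurable (\bigcup_n E n `\` E k : set (borel X)).
    apply: measurableD; last exact: closed_borel.
    by apply: bigcupT_measurable => n; exact: closed_borel.
  have mU : measurable (\bigcup_n (V n `\` D n) : set (borel X)).
    exact: bigcupT_measurable.
  apply: (@le_trans _ _ (mu (\bigcup_n (V n `\` D n) `|` (\bigcup_n E n `\` E k)))).
    apply: le_measure; rewrite ?inE; first 2 last.
    + move=> x [[n _ Vx] Ekx]; have [[m _ Dx]|nD] := pselect ((\bigcup_n D n) x).
        right; split => //; exists m.+1 => //.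
        by rewrite /E big_ord_recr; right.
      by left; exists n => //; split => // Dx; apply: nD; exists n.
    + apply: sep => //; apply: bigcup_open => n _; by have [] := DV n.
    + exact: measurableU.
  rewrite (le_trans (measureU2 mu mU mEk))// [e in leRHS]splitr EFinD leeD//.
  have /= := measure_sigma_subadditive mu mVD mU (fun x h => h).
  move=> /le_trans; apply; apply: le_trans (epsilon_trick0 xpredT _); last first.
    by rewrite divr_ge0// ltW.
  by apply: lee_nneseries => // n _; have [] := DV n.
- move=> U oU e e0.
  (* The points at distance at least [1 / (n + 1)] from the complement of [U]; these closed sets
     increase to [U]. *)
  pose C n := ~` \bigcup_(y in ~` U) ball y n.+1%:R^-1.
  have cC n : closed (C n).
    by apply: open_closedC; apply: bigcup_open => y _; exact: ball_open_metric.
  have ndC : nondecreasing_seq (C : (set (borel X))^nat).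
    move=> m n mn; apply/subsetPset; apply: subsetC => x [y Uy yx].
    exists y => //; apply: le_ball yx.
    by rewrite lef_pV2 ?posrE// ler_nat.
  have UC : \bigcup_n C n = U.
    apply/seteqP; split => x.
      move=> [n _ Cx]; apply: contrapT => Ux; apply: Cx; exists x => //.
      by apply: ballxx; rewrite invr_gt0.
    move: oU; rewrite openE => oU /[dup] Ux /oU /nbhs_ballP[r /= r0 xrU].
    exists (Num.truncn r^-1) => // -[y Uy yx]; apply: Uy; apply: xrU.
    apply: ball_sym; apply: le_ball yx.
    by rewrite -[leRHS]invrK lef_pV2 ?posrE ?invr_gt0// ltW// truncnS_gt.
  have [n Cn] := @finite_measure_bigcup_approx _ (borel X) mu C e
    (fun k => closed_borel (cC k)) ndC e0.
  exists (C n), U; split => //; last by move: Cn; rewrite UC.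
  by rewrite -UC => x Cx; exists n.
Qed.

End metric_borel.

(** * Invariance of the divergence under essentially injective maps *)

Section divergence_push.
Context (R : realType) (F : R -> \bar R).
Hypothesis F_Gamma0 : Gamma0 F.
Hypothesis F_finite : finite_valued F.
Hypothesis F_superlinear : superlinear F.
Context (X Y : ptopologicalType) (f : X -> Y) (g : Y -> X).
Hypothesis mf : measurable_fun [set: borel X] (f : borel X -> borel Y).
Hypothesis mg : measurable_fun [set: borel Y] (g : borel Y -> borel X).
Local Open Scope ereal_scope.

Lemma integral_push_cancel (mu : fmeasure R X) (nu : fmeasure R Y)
    (S : set (borel X)) (u : borel X -> \bar R) :
  measurable S -> mu (~` S) = 0 -> (forall x, S x -> g (f x) = x) ->
  (forall B : set (borel Y), measurable B -> nu B = mu (f @^-1` B)) ->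
  measurable_fun setT u -> (forall x, 0 <= u x) ->
  forall B : set (borel Y), measurable B ->
  \int[nu]_(y in B) u (g y) = \int[mu]_(x in f @^-1` B) u x.
Proof.
move=> mS S0 gf nuE mu_ u0 B mB.
have mug : measurable_fun [set: borel Y] (fun y => u (g y)).
  exact: (measurableT_comp mu_ mg).
rewrite (integral_push mf nuE mug)//.
have mfB : measurable (f @^-1` B : set (borel X)).
  by rewrite -[X in measurable X]setTI; exact: mf.
apply: ge0_ae_eq_integral => //.
- apply: measurable_funTS.
  exact: (measurableT_comp mug mf).
- exact: measurable_funTS.
- exists (~` S); split => //; first exact: measurableC.
  by move=> x /= h Sx; apply: h => _; rewrite gf.
Qed.

(* [f] may be injective on a set of full [mu]-measure only; [g] is its inverse
   there, so that a density [s] becomes [s \o g]. *)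
Lemma F_divergence_push (mu gamma : fmeasure R X) (nu gamma' : fmeasure R Y)
    (S : set (borel X)) :
  measurable S -> mu (~` S) = 0 -> (forall x, S x -> g (f x) = x) ->
  (forall B : set (borel Y), measurable B -> nu B = mu (f @^-1` B)) ->
  (forall B : set (borel Y), measurable B -> gamma' B = gamma (f @^-1` B)) ->
  F_divergence F gamma mu < +oo ->
  F_divergence F gamma' nu = F_divergence F gamma mu.
Proof.
move=> mS S0 gf nuE gE /(F_divergence_lty F_Gamma0 F_superlinear)[s gs].
have [ms s0 sE] := gs.
rewrite (F_divergenceE F_Gamma0 F_finite gs).
have ms' : measurable_fun setT (EFin \o s) by exact/measurable_EFinP.
rewrite (@F_divergenceE _ _ F_Gamma0 F_finite _ _ _ (s \o g)).
  have mFs := measurable_F_comp F_Gamma0 F_finite ms s0.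
  rewrite -(setTI setT); have := integral_push_cancel mS S0 gf nuE mFs.
  move=> /(_ _ setT measurableT); rewrite preimage_setT setTI; apply.
  by move=> x; exact: Gamma0_ge0.
split => [|y|B mB].
- by apply: measurableT_comp => //; exact: mg.
- exact: s0.
- rewrite gE// sE; last by rewrite -[X in measurable X]setTI; exact: mf.
  by rewrite -(integral_push_cancel mS S0 gf nuE ms').
Qed.

End divergence_push.

(** * Cost profiles *)

Section cost.
Context (R : realType) (l : R -> \bar R).
Hypothesis l_cost : cost_profile l.
Local Open Scope ereal_scope.

Lemma cost_nd (s t : R) : (0 <= s <= t)%R -> l s <= l t.
Proof.
move=> /andP[s0 st]; have [t0|t0] := eqVneq t 0%R.
  by rewrite (_ : s = t)//; apply/eqP; rewrite eq_le st t0.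
have tp : (0 < t)%R by rewrite lt_neqAle eq_sym t0 (le_trans s0).
have st01 : (0 <= s / t <= 1)%R.
  by rewrite divr_ge0//= ?(ltW tp)// ler_pdivrMr// mul1r.
have l0 : l 0%R = 0 by apply/cost_eq0.
have := cost_convex l_cost (ltW tp) (lexx 0%R) st01.
rewrite l0 mule0 adde0 mulr0 addr0 divfK// => /le_trans; apply.
rewrite -[leRHS]mul1e; apply: lee_wpmul2r; first exact: cost_ge0 (ltW tp).
by rewrite lee_fin; case/andP : st01.
Qed.

(** Values of [l] at negative arguments are arbitrary; the norm turns continuity within the
    half-line into continuity on the whole line. *)
Lemma cost_continuous_norm : continuous (fun s : R => l `|s|%R).
Proof.
move=> s V Vl; have s0 : `[0%R, +oo[%classic `|s|%R by rewrite /= in_itv/= normr_ge0.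
have W : within `[0%R, +oo[ (nbhs `|s|%R) (l @^-1` V).
  by rewrite nbhs_subspace_in//; exact: (cost_continuous l_cost).
have : \forall t \near s, `[0%R, +oo[%classic `|t|%R -> V (l `|t|%R).
  exact: (norm_continuous W).
by apply: filterS => t; apply; rewrite /= in_itv/= normr_ge0.
Qed.

Lemma continuous_cost_comp (T : topologicalType) (h : T -> R) :
  continuous h -> (forall x, 0 <= h x)%R -> continuous (l \o h).
Proof.
move=> ch h0.
have -> : l \o h = (fun s : R => l `|s|%R) \o h.
  by apply/funext => x /=; rewrite ger0_norm.
by move=> x; apply: continuous_comp; [exact: ch|exact: cost_continuous_norm].
Qed.

Lemma cost_small (e : R) : (0 < e)%R -> exists2 d : R, (0 < d)%R &
  forall s : R, (0 <= s <= d)%R -> l s <= e%:E.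
Proof.
move=> e0; have l0 : l 0%R = 0 by apply/cost_eq0.
have : \forall s \near (0%R : R), l `|s|%R < e%:E.
  have := @cost_continuous_norm 0%R [set u | u < e%:E]; apply.
  apply: open_nbhs_nbhs; split; first exact: open_ereal_lt_ereal.
  by rewrite /= normr0 l0.
move=> [d /= d0 hd]; exists (d / 2)%R; first by rewrite divr_gt0.
move=> s /andP[s0 sd]; have := hd s; rewrite /= sub0r normrN (ger0_norm s0).
move=> h; apply/ltW/h; rewrite (le_lt_trans sd)// ltr_pdivrMr//.
by rewrite mulr_natr mulr2n ltrDl.
Qed.

End cost.

Section lipschitz.
Context (R : realType) (X Y : metricType R).

Lemma lipschitz2_continuous (h : X -> Y -> R) :
  (forall x x' y y', `|h x y - h x' y'| <= mdist x x' + mdist y y') ->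
  continuous (fun p : X * Y => h p.1 p.2).
Proof.
move=> hL -[x y]; apply/cvgrPdist_lt => e e0.
have e2 : 0 < e / 2 by rewrite divr_gt0.
exists (ball x (e / 2), ball y (e / 2)); first by split; exact: nbhsx_ballx.
move=> [x' y'] /= []; rewrite !ballEmdist /= => xx' yy'.
by rewrite (le_lt_trans (hL _ _ _ _))// [ltRHS]splitr ltrD.
Qed.

End lipschitz.

Lemma mdist_continuous (R : realType) (X : metricType R) :
  continuous (fun p : X * X => mdist p.1 p.2).
Proof.
apply: lipschitz2_continuous => x x' y y'; rewrite ler_norml; apply/andP; split.
- have := metric_triangle x' x y'; have := metric_triangle x y y'.
  by rewrite (metric_sym x' x); lra.
- have := metric_triangle x x' y; have := metric_triangle x' y' y.
  by rewrite (metric_sym y' y); lra.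
Qed.

(** * Precompactness for the Entropy-Transport distance *)

Section discretize.
Context (R : realType) (F l : R -> \bar R).
Hypothesis F_Gamma0 : Gamma0 F.
Hypothesis F_finite : finite_valued F.
Hypothesis F_superlinear : superlinear F.
Hypothesis l_cost : cost_profile l.
Context (Z : polishMetricType R).
Local Open Scope ereal_scope.

Let c (p : Z * Z) := l (mdist p.1 p.2).

Lemma cost_mdist_continuous : continuous c.
Proof.
apply: (continuous_cost_comp l_cost (@mdist_continuous R Z)) => p.
exact: mdist_ge0.
Qed.

Lemma cost_mdist_measurable : measurable_fun [set: borel (Z * Z)%type] c.
Proof. apply: continuous_emeasurable; exact: cost_mdist_continuous. Qed.

Lemma cost_mdist_ge0 p : 0 <= c p.
Proof. by apply: cost_ge0 => //; exact: mdist_ge0. Qed.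

Lemma discrete_fmeasure (z : nat -> Z) (w : nat -> R) (N : nat) :
  (forall i, (0 <= w i)%R) ->
  exists om : fmeasure R Z, forall A : set (borel Z),
    om A = \sum_(i < N) (w i * \1_A (z i))%:E.
Proof.
move=> w0.
have /choice[m mE] : forall i, exists m : fmeasure R Z, forall A : set (borel Z),
    m A = (w i * \1_A (z i))%:E.
  move=> i; pose dz : fmeasure R Z := \d_(z i : borel Z).
  by have [m mE] := finite_measure_scale dz (w0 i); exists m => A; rewrite mE.
have [om omE] := finite_measure_sum m N.
by exists om => A; rewrite omE; apply: eq_bigr => i _; rewrite mE.
Qed.

(* The plan moves, inside each cell [P i], a fraction of [gamma] of mass [w i]
   to the center [z i]. *)
Lemma ET_discretize (P : nat -> set (borel Z)) (z : nat -> Z) (w : nat -> R)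
    (N : nat) (e : R) (gamma om : fmeasure R Z) :
  (forall i, measurable (P i)) -> trivIset setT P ->
  (forall i, P i `<=` ball (z i) e) -> (0 < e)%R ->
  (forall i, (0 <= w i)%R) -> (forall i, (w i)%:E <= gamma (P i)) ->
  (forall A : set (borel Z), om A = \sum_(i < N) (w i * \1_A (z i))%:E) ->
  ET F c gamma om <= F 0%R * (gamma setT - \sum_(i < N) (w i)%:E) +
                     l e * \sum_(i < N) (w i)%:E.
Proof.
move=> mP tP Pz e0 w0 wP omE.
(* The fraction of the cell that is moved. On a null cell [w i] vanishes as well, and division by
   zero yields the correct fraction 0. *)
pose k i := (w i / fine (gamma (P i)))%R.
have k0 i : (0 <= k i)%R by rewrite divr_ge0// fine_ge0.
have kE i : (k i)%:E * gamma (P i) = (w i)%:E.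
  have gP : gamma (P i) \is a fin_num by rewrite fin_num_measure.
  rewrite -(fineK gP) -EFinM /k; have [g0|g0] := eqVneq (fine (gamma (P i))) 0%R.
    rewrite g0 mulr0; congr EFin; apply/eqP; rewrite eq_le w0/=.
    by rewrite -lee_fin -g0 fineK.
  by rewrite divfK.
have k1 i : (k i <= 1)%R.
  have gP : gamma (P i) \is a fin_num by rewrite fin_num_measure.
  have := wP i; rewrite -(fineK gP) lee_fin /k.
  have [->|g0] := eqVneq (fine (gamma (P i))) 0%R; first by rewrite invr0 mulr0.
  by rewrite ler_pdivrMr ?mul1r// lt_neqAle eq_sym g0 fine_ge0.
have mz i : measurable_fun [set: borel Z] (fun x => (x, z i) : borel (Z * Z)%type).
  apply: (@measurable_pair_borel R _ (borel Z) Z Z) => //; exact: measurable_cst.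
have /choice[m mE] : forall i, exists m : fmeasure R (Z * Z)%type,
    forall A : set (borel (Z * Z)%type),
    m A = (k i)%:E * gamma ([set x | A (x, z i)] `&` P i).
  move=> i; have [m1 m1E] := finite_measure_restr gamma (mP i).
  have [m2 m2E] := fmeasure_push (mz i) m1.
  have [m3 m3E] := finite_measure_scale m2 (k0 i).
  by exists m3 => A; rewrite m3E m2E m1E.
have [G GE] := finite_measure_sum m N.
apply: (@le_trans _ _ (F_divergence F (marginal1 G) gamma +
  F_divergence F (marginal2 G) om + \int[G]_p c p)).
  by apply: ereal_inf_lbound; exists G.
have mG1 A : marginal1 G A = \sum_(i < N) (k i)%:E * gamma (A `&` P i).
  by transitivity (G (fst @^-1` A)) => //; rewrite GE; apply: eq_bigr => i _; rewrite mE.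
(* The second marginal is exactly [om]; the cost consists of the mass left behind and of transport
   over distances below [e]. *)
have -> : F_divergence F (marginal2 G) om = 0.
  apply: F_divergence_refl => // A mA.
  transitivity (G (snd @^-1` A)) => //; rewrite GE omE.
  apply: eq_bigr => i _; rewrite mE indicE.
  have [zA|zA] := pselect (A (z i)).
    rewrite mem_set// mulr1 -kE; congr (_ * gamma _).
    by apply/seteqP; split => // x [].
  rewrite memNset// mulr0 (_ : _ `&` _ = set0) ?measure0 ?mule0//.
  by apply/seteqP; split => // x [].
have GT : G setT = \sum_(i < N) (w i)%:E.
  rewrite GE; apply: eq_bigr => i _; rewrite mE -kE; congr (_ * gamma _).
  by apply/seteqP; split => // x [].
rewrite adde0; apply: leeD.
  rewrite -GT (_ : G setT = marginal1 G setT)//.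
  apply: F_divergence_le => // A mA; rewrite mG1.
  apply: (@le_trans _ _ (\sum_(i < N) gamma (A `&` P i))).
    apply: lee_sum => i _; rewrite -[leRHS]mul1e lee_wpmul2r//.
    by rewrite lee_fin.
  have mAP i : measurable (A `&` P i) by exact: measurableI.
  have mU : measurable (\big[setU/set0]_(i < N) (A `&` P i)).
    exact: bigsetU_measurable.
  have <- : gamma (\big[setU/set0]_(i < N) (A `&` P i)) =
            \sum_(i < N) gamma (A `&` P i).
    apply: (@measure_semi_additive_ord_I _ _ _ gamma (fun i => A `&` P i)) => //.
    move=> i j _ _ [x [[_ Pix] [_ Pjx]]]; apply: tP => //.
    by exists x.
  apply: le_measure; rewrite ?inE// => x.
  by rewrite -(@bigcup_mkord _ N (fun i => A `&` P i)) => -[i _ []].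
pose B := [set p : Z * Z | (mdist p.1 p.2 < e)%R].
have mB : measurable (B : set (borel (Z * Z)%type)).
  apply: open_borel.
  have /continuousP/(_ _ (@open_lt _ e)) := @mdist_continuous R Z.
  by [].
have GB : G (~` B) = 0.
  rewrite GE big1// => i _; rewrite mE (_ : _ `&` _ = set0) ?measure0 ?mule0//.
  apply/seteqP; split => // x [/= Bx /Pz]; rewrite ballEmdist/= => zx; apply: Bx.
  by rewrite /B/= metric_sym.
rewrite (ge0_negligible_integral (measurableC mB) measurableT cost_mdist_measurable _ GB); last first.
  by move=> p _; exact: cost_mdist_ge0.
rewrite setTD setCK -GT.
apply: (@le_trans _ _ (\int[G]_(p in B) l e)).
  apply: ge0_le_integral => //.
  - by move=> p _; exact: cost_mdist_ge0.
  - exact: measurable_funTS cost_mdist_measurable.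
  - move=> p Bp; apply: (cost_nd l_cost); rewrite mdist_ge0/= ltW//.
rewrite integral_cst// lee_wpmul2l//; first exact: cost_ge0 (ltW e0).
by rewrite le_measure ?inE.
Qed.

End discretize.

(** Tychonoff gives a cluster point [c] in a product of segments; [phi k >= k] is an index at which
    the coordinates up to [k] are within [1 / (k + 1)] of [c]. The condition [k <= phi k] replaces
    monotonicity and suffices for passing to limits. *)
Lemma diagonal_subsequence (R : realType) (u : nat -> nat -> R) (B : nat -> R) :
  (forall i n, `|u i n| <= B i) ->
  exists (phi : nat -> nat) (c : nat -> R), (forall k, (k <= phi k)%N) /\
    forall i, u i (phi k) @[k --> \oo] --> c i.
Proof.
move=> uB.
pose K i : set R := `[- B i, B i]%classic.
pose U (n : nat) : prod_topology (fun _ : nat => R) := fun i => u i n.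
have cK : compact [set f : prod_topology (fun _ : nat => R) | forall i, K i (f i)].
  by apply: tychonoff => i; exact: segment_compact.
have [|c [_ clc]] := cK (U @ \oo) _.
  exists 0%N => // n _ /= i.
  by rewrite /K /U /= in_itv/= -ler_norml; exact: uB.
have near_c (k : nat) : nbhs c [set f : prod_topology (fun _ : nat => R) |
    forall i, (i <= k)%N -> `|c i - f i| < k.+1%:R^-1].
  have H m : nbhs c [set f : prod_topology (fun _ : nat => R) |
      forall i, (i < m)%N -> `|c i - f i| < k.+1%:R^-1].
    elim: m => [|m ih]; first exact: filterS filterT.
    have hm : nbhs c [set f : prod_topology (fun _ : nat => R) |
        `|c m - f m| < k.+1%:R^-1].
      have := @proj_continuous nat (fun=> R) m c (ball (c m) k.+1%:R^-1).
      by apply; apply: nbhsx_ballx; rewrite invr_gt0.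
    apply: filterS (filterI ih hm) => f [fi fm] i; rewrite ltnS leq_eqVlt.
    by move=> /predU1P[->//|]; exact: fi.
  by apply: filterS (H k.+1) => f hf i ik; apply: hf.
have /choice[phi hphi] : forall k : nat, exists n, (k <= n)%N /\
    forall i, (i <= k)%N -> `|c i - u i n| < k.+1%:R^-1.
  move=> k; have [|f [[n /= kn <-] hf]] := clc (U @` [set n | (k <= n)%N]) _ _ (near_c k).
    by exists k => // n /= kn; exists n.
  by exists n; split.
exists phi, c; split=> [k|i]; first by have [] := hphi k.
apply/cvgrPdist_lt => e e0.
exists (maxn i (Num.truncn e^-1)) => // k /=; rewrite geq_max => /andP[ik ek].
have [_ /(_ i ik)] := hphi k; move=> /lt_le_trans; apply.
rewrite -[leRHS]invrK lef_pV2 ?posrE ?invr_gt0//.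
by rewrite (le_trans (ltW (truncnS_gt _)))// ler_nat.
Qed.

Lemma eval_continuous (I : Type) (K : I -> topologicalType) (i : I) :
  continuous (fun f : prod_topology K => f i).
Proof.
move=> f V Vf; have : f --> (f : prod_topology K) by exact: cvg_id.
move=> /cvg_sup/(_ i); apply.
exact: (@initial_continuous _ _ (fun f : forall i, K i => f i) f V Vf).
Qed.

Section precompact.
Context (R : realType) (a : R) (F l : R -> \bar R).
Hypothesis reg : regular_ET a F l.
Context (Z : polishMetricType R).
Local Open Scope ereal_scope.

Let F_Gamma0 := reg_Gamma0 reg.
Let F_finite := reg_finite reg.
Let F_superlinear := reg_superlinear reg.
Let l_cost := reg_cost reg.
Let a0 : (0 < a)%R. Proof. by case/andP : (reg_a reg). Qed.
Let D := @ET_dist R a F l Z.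
Let mw := reg_metric reg Z.

Lemma ET_ge0 (T : polishMetricType R) (mu nu : fmeasure R T) :
  0 <= ET F (fun z => l (mdist z.1 z.2)) mu nu.
Proof.
apply: le_ereal_inf_tmp => _ [g _ <-].
apply: adde_ge0; first by apply: adde_ge0; exact: F_divergence_ge0.
by apply: integral_ge0 => p _; exact: cost_mdist_ge0.
Qed.

Lemma ET_dist_le (T : polishMetricType R) (mu nu : fmeasure R T) (r : R) :
  (0 <= r)%R -> ET F (fun z => l (mdist z.1 z.2)) mu nu <= r%:E ->
  ET_dist a F l mu nu <= (r `^ a)%:E.
Proof.
move=> r0 h; rewrite /ET_dist -poweR_EFin; apply: gt0_ler_poweR => //.
- exact: ltW.
- by rewrite in_itv/= ET_ge0 leey.
- by rewrite in_itv/= lee_fin r0 leey.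
Qed.

(** Along a subsequence the masses of all cells, at all scales, converge. Two late members are then
    compared through one discrete measure, which puts at each center the smaller of their two cell
    masses and is close to both of them. *)
Lemma ET_precompact (gamma : nat -> fmeasure R Z) (M : R) :
  (forall n, gamma n setT <= M%:E) ->
  (forall e : R, (0 < e)%R -> exists (z : nat -> Z) (N : nat), forall n,
    gamma n (~` \bigcup_(i < N) ball (z i) e) <= e%:E) ->
  exists (phi : nat -> nat) (g : fmeasure R Z), (forall k, (k <= phi k)%N) /\
    forall e : R, (0 < e)%R -> exists N : nat, forall k,
      (N <= k)%N -> D (gamma (phi k)) g < e%:E.
Proof.
move=> gM tight.
have M0 : (0 <= M)%R by rewrite -lee_fin (le_trans _ (gM 0%N)).
pose ek (k : nat) : R := k.+1%:R^-1%R.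
have ek0 k : (0 < ek k)%R by rewrite invr_gt0.
have /choice[z /choice[N zN]] := fun k => tight (ek k) (ek0 k).
pose P k : nat -> set (borel Z) := seqDU (fun i => ball (z k i) (ek k)).
have mP k i : measurable (P k i).
  apply: measurableD; first by apply: open_borel; exact: ball_open_metric.
  by apply: bigsetU_measurable => j _; apply: open_borel; exact: ball_open_metric.
have tP k : trivIset setT (P k) by exact: trivIset_seqDU.
have Pz k i : P k i `<=` ball (z k i) (ek k) by exact: subDsetl.
pose u (j n : nat) : R :=
  if @unpickle (nat * nat)%type j is Some (k, i) then fine (gamma n (P k i)) else 0%R.
have uM j n : (`|u j n| <= M)%R.
  rewrite /u; case: (unpickle j) => [[k i]|]; last by rewrite normr0.
  rewrite ger0_norm ?fine_ge0// -lee_fin fineK ?fin_num_measure//.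
  by rewrite (le_trans _ (gM n))// le_measure ?inE.
have [phi [c [phik uc]]] := diagonal_subsequence uM.
have cvgP k i : fine (gamma (phi n) (P k i)) @[n --> \oo] --> c (pickle (k, i)).
  by have := uc (pickle (k, i)); rewrite /u pickleK.
have mPU k : measurable (\big[setU/set0]_(i < N k) P k i).
  exact: bigsetU_measurable.
have sumP k n : gamma n (\big[setU/set0]_(i < N k) P k i) =
    \sum_(i < N k) gamma n (P k i).
  apply: (@measure_semi_additive_ord_I _ _ _ (gamma n) (P k)) => //.
  exact: sub_trivIset (tP k).
have rest k n : gamma n setT <= \sum_(i < N k) gamma n (P k i) + (ek k)%:E.
  rewrite -sumP; have mU := mPU k.
  have bU : \big[setU/set0]_(i < N k) P k i = \bigcup_(i < N k) ball (z k i) (ek k).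
    rewrite bigcup_mkord.
    exact: (esym (bigsetU_seqDU (fun i => ball (z k i) (ek k)) (N k))).
  rewrite bU in mU *.
  apply: le_trans; last by apply: leeD2l; exact: (zN k n).
  apply: le_trans; last by apply: measureU2 => //; exact: measurableC.
  by rewrite setUv.
have cauchy (e : R) : (0 < e)%R -> exists N : nat, forall m n : nat,
    (N <= m)%N -> (N <= n)%N -> D (gamma (phi m)) (gamma (phi n)) < e%:E.
  (* The target for [ET] before the power [a] is taken, so that each of the two comparisons costs
     [e / 4]. *)
  move=> e0; pose rho := ((e / 4) `^ a^-1)%R.
  have e4 : (0 < e / 4)%R by rewrite divr_gt0.
  have rho0 : (0 < rho)%R by rewrite powR_gt0.
  have rhoa : (rho `^ a = e / 4)%R.
    by rewrite -powRrM mulVf ?gt_eqF// powRr1// ltW.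
  pose f0 := fine (F 0%R).
  have F0E : F 0%R = f0%:E by rewrite fineK// F_finite.
  have f00 : (0 <= f0)%R by rewrite fine_ge0// Gamma0_ge0.
  have f01 : (0 < f0 + 1)%R by rewrite ltr_wpDl.
  have M1 : (0 < M + 1)%R by rewrite ltr_wpDl.
  have [d d0 hd] := cost_small l_cost (divr_gt0 (divr_gt0 rho0 (ltr0Sn _ 1)) M1).
  (* The mass left behind is at most [2 q]: [q] outside the cells and [q] from the discrepancy of
     cell masses. At price [F 0] this is at most [rho / 2]; transport takes the other half, whence
     the choice of [d]. *)
  pose q := (rho / 4 / (f0 + 1))%R.
  have q0 : (0 < q)%R by rewrite !divr_gt0.
  pose k := Num.truncn (Num.min d q)^-1.
  have km : (ek k <= Num.min d q)%R.
    rewrite /ek -[leRHS]invrK lef_pV2 ?posrE ?invr_gt0 ?lt_min ?d0//.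
    exact: ltW (truncnS_gt _).
  have [kd kq] : (ek k <= d)%R /\ (ek k <= q)%R.
    by move: km; rewrite le_min => /andP.
  pose x n i := fine (gamma (phi n) (P k i)).
  have x0 n i : (0 <= x n i)%R by rewrite fine_ge0.
  have xE n i : gamma (phi n) (P k i) = (x n i)%:E by rewrite fineK ?fin_num_measure.
  have half (m n : nat) (om : fmeasure R Z) :
      (\sum_(i < N k) `|x m i - x n i| <= q)%R ->
      (forall A : set (borel Z),
        om A = \sum_(i < N k) (Num.min (x m i) (x n i) * \1_A (z k i))%:E) ->
      D (gamma (phi m)) om <= (e / 4)%:E.
    move=> mnq omE; pose w i := Num.min (x m i) (x n i).
    have w0 i : (0 <= w i)%R by rewrite le_min !x0.
    have wx i : (w i)%:E <= gamma (phi m) (P k i).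
      by rewrite xE lee_fin ge_min lexx.
    rewrite -rhoa; apply: ET_dist_le; first exact: ltW.
    apply: le_trans (ET_discretize F_Gamma0 F_finite l_cost
      (mP k) (tP k) (Pz k) (ek0 k) w0 wx omE) _.
    have gT : gamma (phi m) setT \is a fin_num by rewrite fin_num_measure.
    have sxT : (\sum_(i < N k) x m i <= fine (gamma (phi m) setT))%R.
      rewrite -lee_fin fineK// -sumEFin.
      under eq_bigr do rewrite -xE.
      by rewrite -sumP le_measure ?inE.
    have sw : (\sum_(i < N k) w i <= M)%R.
      rewrite (@le_trans _ _ (\sum_(i < N k) x m i))%R//.
        by apply: ler_sum => i _; rewrite ge_min lexx.
      by rewrite (le_trans sxT)// -lee_fin fineK.
    have sg : (fine (gamma (phi m) setT) - \sum_(i < N k) w i <= q + q)%R.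
      rewrite lerBlDr.
      have := rest k (phi m); rewrite -(fineK gT).
      under eq_bigr do rewrite xE.
      rewrite sumEFin -EFinD lee_fin => /le_trans; apply.
      rewrite [leRHS]addrC addrA lerD//.
      rewrite (le_trans _ (lerD (lexx _) mnq))// -big_split/=.
      apply: ler_sum => i _; rewrite /w minEle; case: ifPn => [xmn|].
        by rewrite lerDl.
      by rewrite -ltNge => /ltW xmn; rewrite ger0_norm ?subr_ge0//; lra.
    have lek : l (ek k) <= (rho / 2 / (M + 1))%:E.
      by apply: hd; rewrite ltW//=.
    have [r lr] : exists r, l (ek k) = r%:E.
      exists (fine (l (ek k))); rewrite fineK// ge0_fin_numE.
        by rewrite (le_lt_trans lek)// ltry.
      by apply: cost_ge0 => //; exact: ltW.
    have r0 : (0 <= r)%R by rewrite -lee_fin -lr; apply: cost_ge0 => //; exact: ltW.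
    move: lek; rewrite lr lee_fin => lek.
    rewrite F0E -(fineK gT) sumEFin -EFinB -!EFinM -EFinD lee_fin.
    rewrite [leRHS]splitr; apply: lerD.
      apply: (@le_trans _ _ (f0 * (q + q))%R); first exact: ler_wpM2l.
      apply: (@le_trans _ _ ((f0 + 1) * (q + q))%R).
        by apply: ler_wpM2r; [rewrite addr_ge0// ltW|rewrite lerDl].
      by rewrite /q le_eqVlt; apply/orP; left; apply/eqP; field; rewrite gt_eqF.
    apply: (@le_trans _ _ (rho / 2 / (M + 1) * M)%R).
      by apply: ler_pM => //; exact: sumr_ge0.
    rewrite mulrAC ler_pdivrMr// ler_pM2l ?divr_gt0// lerDl//.
  (* Two such deviations add up to [q / (N k + 1)] per cell, hence to at most [q] over the [N k]
     cells. *)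
  have : exists K : nat, forall n, (K <= n)%N -> forall i, (i < N k)%N ->
      (`|c (pickle (k, i)) - x n i| <= q / 2 / (N k).+1%:R)%R.
    have qN : (0 < q / 2 / (N k).+1%:R)%R by rewrite !divr_gt0.
    move: qN; set b := (q / 2 / _)%R => qN.
    elim: (N k) => [|j [K hK]]; first by exists 0%N.
    have /cvgrPdist_le/(_ _ qN)[K' _ hK'] := cvgP k j.
    exists (maxn K K') => n; rewrite geq_max => /andP[Kn K'n] i.
    rewrite ltnS leq_eqVlt => /predU1P[->|]; [exact: hK'|exact: hK].
  move=> [K hK]; exists K => m n Km Kn.
  have [om omE] := discrete_fmeasure (z k) (N k)
    (fun i => ltac:(by rewrite le_min !x0) : (0 <= Num.min (x m i) (x n i))%R).
  have mn : (\sum_(i < N k) `|x m i - x n i| <= q)%R.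
    apply: (@le_trans _ _ (\sum_(i < N k) q / (N k).+1%:R))%R.
      apply: ler_sum => i _; rewrite (_ : x m i - x n i =
        (c (pickle (k, i : nat)) - x n i) - (c (pickle (k, i : nat)) - x m i))%R; last lra.
      rewrite (le_trans (ler_normB _ _))//.
      rewrite (_ : q / _ = q / 2 / (N k).+1%:R + q / 2 / (N k).+1%:R)%R; last first.
        by field; rewrite addrC natr1 pnatr_eq0.
      by apply: lerD; [exact: hK Kn _ _|exact: hK Km _ _].
    rewrite sumr_const card_ord -[leLHS]mulr_natr mulrAC ler_pdivrMr//.
    by rewrite ler_pM2l// ler_nat.
  apply: (@le_lt_trans _ _ ((e / 4)%:E + (e / 4)%:E)).
    apply: le_trans (mw_triangle mw _ om _) _; apply: leeD; first exact: half omE.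
    rewrite (mw_sym mw); apply: (half n m) => // [|A].
      by under eq_bigr do rewrite distrC.
    by rewrite omE; apply: eq_bigr => i _; rewrite minC.
  by rewrite -EFinD lte_fin; lra.
have [g hg] := mw_complete mw cauchy.
by exists phi, g.
Qed.

(** The measures whose integral of [f] is within [e] of that of [g] form a weakly open set, which by
    [mw_weak] contains a [D]-ball around [g]. *)
Lemma ET_dist_weak (gamma : nat -> fmeasure R Z) (g : fmeasure R Z) :
  (forall e : R, (0 < e)%R -> exists N : nat, forall k,
      (N <= k)%N -> D (gamma k) g < e%:E) ->
  forall f : Z -> R, continuous f -> (exists M : R, forall x, `|f x| <= M)%R ->
  (\int[gamma k]_(x in [set: borel Z]) f x)%R @[k --> \oo] -->
  (\int[g]_(x in [set: borel Z]) f x)%R.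
Proof.
move=> Dg f cf bf; pose fb : Cb R Z := exist _ f (conj cf bf).
apply/cvgrPdist_lt => e e0.
pose U := [set nu : fmeasure R Z |
  (`|(\int[g]_(x in [set: borel Z]) f x)%R - (\int[nu]_(x in [set: borel Z]) f x)%R| < e)%R].
have oU : open (U : set (weak_fmeasure R Z)).
  pose pr (u : prod_topology (fun _ : Cb R Z => R)) := u fb.
  exists (pr @^-1` ball (\int[g]_(x in [set: borel Z]) f x)%R e) => //.
  have /continuousP := @eval_continuous (Cb R Z) (fun=> R) fb.
  by apply; exact: ball_open.
have [|r r0 rU] := (mw_weak mw U).1 oU g; first by rewrite /U/= subrr normr0.
have [N hN] := Dg r r0.
exists N => // k /= Nk; apply: rU => /=; rewrite (mw_sym mw); exact: hN.
Qed.

End precompact.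

(** * Lower semicontinuity of the divergence *)

Section setwise.
Context (R : realType) (X : polishMetricType R).
Variables (gamma : nat -> fmeasure R X) (g mu : fmeasure R X).
Hypothesis weak : forall f : X -> R, continuous f ->
  (exists M : R, forall x, `|f x| <= M) ->
  (\int[gamma k]_(x in [set: borel X]) f x)%R @[k --> \oo] -->
  (\int[g]_(x in [set: borel X]) f x)%R.
Hypothesis equi : forall e : R, 0 < e -> exists2 K : R, 0 <= K &
  forall k (A : set (borel X)), measurable A ->
    (gamma k A <= K%:E * mu A + e%:E)%E.
Local Open Scope ereal_scope.

Lemma integral_between (nu : fmeasure R X) (f : X -> R) (C U A : set X) :
  closed C -> open U -> continuous f -> (forall x, 0 <= f x <= 1)%R ->
  (forall x, C x -> f x = 1%R) -> (forall x, ~ U x -> f x = 0%R) ->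
  nu C <= (\int[nu]_(x in [set: borel X]) f x)%:E <= nu U.
Proof.
move=> cC oU cf f01 f1 f0.
have f0' x : (0 <= f x)%R by case/andP : (f01 x).
have mC : measurable (C : set (borel X)) by exact: closed_borel.
have mU : measurable (U : set (borel X)) by exact: open_borel.
have mf : measurable_fun [set: borel X] (EFin \o f).
  by apply/measurable_EFinP; exact: continuous_borel_real cf.
have fle1 : \int[nu]_(x in [set: borel X]) (f x)%:E <= nu U.
  apply: (@le_trans _ _ (\int[nu]_(x in [set: borel X]) (\1_U x)%:E)).
    apply: ge0_le_integral => //.
    - by move=> x _; rewrite lee_fin.
    - by apply/measurable_EFinP; exact: measurable_indic.
    - move=> x _; rewrite lee_fin indicE.
      have [Ux|Ux] := pselect (U x); first by rewrite mem_set//; case/andP : (f01 x).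
      by rewrite f0.
  by rewrite integral_indic// setIT.
have ffin : \int[nu]_(x in [set: borel X]) (f x)%:E \is a fin_num.
  rewrite ge0_fin_numE; last by apply: integral_ge0 => x _; rewrite lee_fin.
  by rewrite (le_lt_trans fle1)// ltey_eq fin_num_measure.
rewrite /Rintegral fineK// fle1 andbT.
have <- : \int[nu]_(x in [set: borel X]) (\1_C x)%:E = nu C.
  by rewrite integral_indic// setIT.
apply: ge0_le_integral => //.
- by apply/measurable_EFinP; exact: measurable_indic.
- move=> x _; rewrite lee_fin indicE.
  have [Cx|Cx] := pselect (C x); first by rewrite f1// mem_set.
  by rewrite memNset.
Qed.

(** Take [C] closed inside [A], adapted to [g], and [U] open around [A], adapted to [mu]. A
    continuous function between them carries the bound on the [gamma k] over to [g], as both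
    [g A - g C] and [mu U - mu A] are small. *)
Lemma weak_limit_equi (e : R) : (0 < e)%R -> exists2 K : R, (0 <= K)%R &
  forall A : set (borel X), measurable A -> g A <= K%:E * mu A + e%:E.
Proof.
move=> e0; have e3 : (0 < e / 3)%R by rewrite divr_gt0.
have [K K0 hK] := equi e3; exists K => // A mA.
have K1 : (0 < K + 1)%R by rewrite ltr_wpDl.
have [D [U [cD oU DA AU UD]]] := fmeasure_regular mu mA (divr_gt0 e3 K1).
have [C [V [cC oV CA AV VC]]] := fmeasure_regular g mA e3.
have [f [cf f01 f1 f0]] := urysohn_closed_open cC oU (subset_trans CA AU).
have mU : measurable (U : set (borel X)) by exact: open_borel.
have mC : measurable (C : set (borel X)) by exact: closed_borel.
have mD : measurable (D : set (borel X)) by exact: closed_borel.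
have mV : measurable (V : set (borel X)) by exact: open_borel.
have gAC : g A <= g C + (e / 3)%:E.
  apply: (@le_trans _ _ (g (C `|` (V `\` C)))).
    apply: le_measure; rewrite ?inE//; first by apply: measurableU => //; exact: measurableD.
    by move=> x Ax; have [Cx|Cx] := pselect (C x); [left|right; split => //; exact: AV].
  apply: le_trans (measureU2 g mC (measurableD mV mC)) _.
  by apply: leeD2l.
have muU : mu U <= mu A + (e / 3 / (K + 1))%:E.
  apply: (@le_trans _ _ (mu (A `|` (U `\` D)))).
    apply: le_measure; rewrite ?inE//; first by apply: measurableU => //; exact: measurableD.
    by move=> x Ux; have [Dx|Dx] := pselect (D x); [left; exact: DA|right].
  apply: le_trans (measureU2 mu mA (measurableD mU mD)) _.
  by apply: leeD2l.
have fgC k := integral_between (gamma k) C cC oU cf f01 f1 f0.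
have /andP[gC _] := integral_between g C cC oU cf f01 f1 f0.
have bf : exists M : R, forall x, (`|f x| <= M)%R.
  by exists 1%R => x; have /andP[? ?] := f01 x; rewrite ger0_norm.
have lim : (\int[g]_(x in [set: borel X]) f x)%:E <= K%:E * mu U + (e / 3)%:E.
  have muUf : mu U \is a fin_num by rewrite fin_num_measure.
  rewrite -(fineK muUf) -EFinM -EFinD lee_fin.
  apply: (cvgr_to_le (weak cf bf)).
  near=> k; have /andP[_ h] := fgC k; rewrite -lee_fin (le_trans h)//.
  by rewrite EFinD EFinM fineK//; exact: hK.
apply: (le_trans gAC); apply: (@le_trans _ _ (K%:E * mu U + (e / 3)%:E + (e / 3)%:E)).
  by rewrite leeD2r// (le_trans gC).
apply: (@le_trans _ _ (K%:E * mu A + (e / 3)%:E + (e / 3)%:E + (e / 3)%:E)).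
  rewrite !leeD2r//.
  apply: (@le_trans _ _ (K%:E * (mu A + (e / 3 / (K + 1))%:E))).
    by apply: lee_wpmul2l => //; rewrite lee_fin.
  rewrite ge0_muleDr ?lee_fin//; last by rewrite divr_ge0// ?ltW// divr_gt0.
  rewrite leeD2l// lee_fin mulrCA; apply: ler_piMr; first exact: ltW.
  by rewrite ler_pdivrMr// mul1r lerDl.
have muAf : mu A \is a fin_num by rewrite fin_num_measure.
by rewrite -(fineK muAf) -EFinM -!EFinD lee_fin; lra.
Unshelve. all: by end_near. Qed.

(** Choose [C] and [U] around [A] with [mu] of their difference small. Uniform absolute continuity
    makes that difference small for [g] and every [gamma k] at once, so a single continuous function
    replaces the indicator of [A] for all of them. *)
Lemma weak_limit_setwise (A : set (borel X)) : measurable A ->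
  fine (gamma k A) @[k --> \oo] --> fine (g A).
Proof.
move=> mA; apply/cvgrPdist_le => e e0.
have e4 : (0 < e / 6)%R by rewrite divr_gt0.
have [K1 K10 hK1] := equi e4.
have [K2 K20 hK2] := weak_limit_equi e4.
pose K := (K1 + K2 + 1)%R.
have K0 : (0 < K)%R by rewrite ltr_wpDl// addr_ge0.
have [C [U [cC oU CA AU UC]]] := fmeasure_regular mu mA (divr_gt0 e4 K0).
have [f [cf f01 f1 f0]] := urysohn_closed_open cC oU (subset_trans CA AU).
have mU : measurable (U : set (borel X)) by exact: open_borel.
have mC : measurable (C : set (borel X)) by exact: closed_borel.
have mUC : measurable (U `\` C : set (borel X)) by exact: measurableD.
have bf : exists M : R, forall x, (`|f x| <= M)%R.
  by exists 1%R => x; have /andP[? ?] := f01 x; rewrite ger0_norm.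
have small (nu : fmeasure R X) (L : R) : (0 <= L <= K)%R ->
    (forall A : set (borel X), measurable A -> nu A <= L%:E * mu A + (e / 6)%:E) ->
    (`|fine (nu A) - (\int[nu]_(x in [set: borel X]) f x)%R| <= e / 3)%R.
  move=> /andP[L0 LK] hL.
  have /andP[nC nU] := integral_between nu C cC oU cf f01 f1 f0.
  have CAU : nu C <= nu A <= nu U by rewrite !le_measure ?inE.
  have nuUC : nu U <= nu C + nu (U `\` C).
    rewrite -measureU//; last by rewrite setDE setICA setICr setI0.
    rewrite le_measure ?inE//; first exact: measurableU.
    by move=> x Ux; have [Cx|Cx] := pselect (C x); [left|right].
  have n3 : nu (U `\` C) <= (e / 3)%:E.
    apply: le_trans (hL _ mUC) _.
    have : L%:E * mu (U `\` C) <= (e / 6)%:E.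
      apply: (@le_trans _ _ (L%:E * (e / 6 / K)%:E)).
        by apply: lee_wpmul2l.
      rewrite lee_fin mulrCA; apply: ler_piMr; first exact: ltW.
      by rewrite ler_pdivrMr// mul1r.
    move=> h; apply: (@le_trans _ _ ((e / 6)%:E + (e / 6)%:E)).
      by rewrite leeD2r.
    by rewrite -EFinD lee_fin; lra.
  have fin B : measurable B -> nu B = (fine (nu B))%:E.
    by move=> mB; rewrite fineK// fin_num_measure.
  move: nC nU CAU nuUC n3; rewrite (fin _ mC) (fin _ mU) (fin _ mA) (fin _ mUC).
  rewrite -EFinD !lee_fin => nC nU /andP[? ?] ? ?.
  by rewrite ler_norml; apply/andP; split; lra.
have e3 : (0 < e / 3)%R by rewrite divr_gt0.
have /cvgrPdist_le/(_ _ e3) := weak cf bf.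
apply: filterS => k hk.
have gs := small g K2 ltac:(rewrite /K K20/=; lra) hK2.
have ks := small (gamma k) K1 ltac:(rewrite /K K10/=; lra) (hK1 k).
move: hk gs ks; rewrite !ler_norml => /andP[? ?] /andP[? ?] /andP[? ?].
by apply/andP; split; lra.
Qed.

End setwise.

Section liminf.
Context (R : realType).
Local Open Scope ereal_scope.
Implicit Types u v w : (\bar R)^nat.

Lemma le_limn_einf u (x : \bar R) :
  (forall e : R, (0 < e)%R -> \forall k \near \oo, x <= u k + e%:E) ->
  x <= limn_einf u.
Proof.
move=> h; apply/lee_addgt0Pr => e e0; have [N _ hN] := h e e0.
rewrite limn_einf_lim (cvg_lim _ (cvg_einfs_sup (u := u)))//.
apply: (@le_trans _ _ (einfs u N + e%:E)); last first.
  by apply: leeD2r; apply: ereal_sup_ubound; exists N.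
rewrite -leeBlDr//; apply: le_ereal_inf_tmp => _ [k /= Nk <-].
by rewrite EFinN leeBlDr//; exact: hN.
Qed.

Lemma limn_einf_add3_le u v w (b : \bar R) (e : R^nat) :
  (forall k, 0 <= u k) -> (forall k, 0 <= v k) -> (forall k, 0 <= w k) ->
  (forall k, u k + v k + w k <= b + (e k)%:E) -> e k @[k --> \oo] --> 0%R ->
  limn_einf u + limn_einf v + limn_einf w <= b.
Proof.
move=> u0 v0 w0 h e0.
have i0 x : (forall k, 0 <= x k) -> forall n, 0 <= einfs x n.
  by move=> x0 n; apply: le_ereal_inf_tmp => _ [k _ <-].
have il x n k : (n <= k)%N -> einfs x n <= x k.
  by move=> nk; apply: ereal_inf_lbound; exists k.
have cv x : (forall k, 0 <= x k) -> einfs x @ \oo --> limn_einf x.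
  by move=> x0; rewrite limn_einf_lim; exact: is_cvg_einfs.
have l0 x : (forall k, 0 <= x k) -> 0 <= limn_einf x.
  move=> x0; rewrite limn_einf_lim; apply: lime_ge; first exact: is_cvg_einfs.
  by near=> n; exact: i0.
have uvw : (einfs u n + einfs v n + einfs w n) @[n --> \oo] -->
    limn_einf u + limn_einf v + limn_einf w.
  apply: cvgeD; [|apply: cvgeD|exact: cv]; [|by apply: ge0_adde_def; rewrite inE l0|exact: cv|exact: cv].
  by apply: ge0_adde_def; rewrite inE ?adde_ge0 ?l0.
rewrite -(cvg_lim _ uvw)//; apply: lime_le; first by apply/cvg_ex; eexists; exact: uvw.
near=> n; apply/lee_addgt0Pr => r r0.
have /cvgrPdist_le/(_ _ r0)[N _ hN] := e0.
pose k := maxn n N; have nk : (n <= k)%N by rewrite leq_maxl.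
apply: (@le_trans _ _ (u k + v k + w k)).
  by rewrite !leeD// il.
rewrite (le_trans (h k))// leeD2l// lee_fin.
have := hN k (leq_maxr _ _); rewrite sub0r normrN => /(le_trans (ler_norm _)).
by [].
Unshelve. all: by end_near. Qed.

End liminf.

Section F_divergence_lsc.
Context (R : realType) (F : R -> \bar R).
Hypothesis F_Gamma0 : Gamma0 F.
Hypothesis F_finite : finite_valued F.
Hypothesis F_superlinear : superlinear F.
Context (X : polishMetricType R).
Variables (gamma : nat -> fmeasure R X) (g mu : fmeasure R X) (C : R).
Local Open Scope ereal_scope.
Hypothesis weak : forall f : X -> R, continuous f ->
  (exists M : R, forall x, `|f x| <= M)%R ->
  (\int[gamma k]_(x in [set: borel X]) f x)%R @[k --> \oo] -->
  (\int[g]_(x in [set: borel X]) f x)%R.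
Hypothesis C0 : (0 <= C)%R.
Hypothesis divC : forall k, F_divergence F (gamma k) mu <= C%:E.

Let equi (e : R) : (0 < e)%R -> exists2 K : R, (0 <= K)%R &
  forall k (A : set (borel X)), measurable A ->
    gamma k A <= K%:E * mu A + e%:E.
Proof.
move=> e0.
have [K K0 hK] := F_divergence_unif_bound F_Gamma0 F_finite F_superlinear C0 e0.
by exists K => // k A mA; exact: hK.
Qed.

Lemma weak_limit_has_density : exists s, has_density g mu s.
Proof.
apply: dominates_has_density => A mA A0; apply/eqP; rewrite -measure_le0.
apply/lee_addgt0Pr => e e0; have [K K0 hK] := weak_limit_equi weak equi e0.
by have := hK A mA; rewrite A0 mule0.
Qed.

Lemma has_density_affine (nu : fmeasure R X) s (al be : R) (B : set (borel X)) :
  has_density nu mu s -> measurable B ->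
  mu.-integrable B (fun x => (al * s x + be)%:E) /\
  \int[mu]_(x in B) (al * s x + be)%:E =
    (al * fine (nu B) + be * fine (mu B))%:E.
Proof.
move=> [ms s0 sE] mB.
have ints : mu.-integrable B (EFin \o s).
  apply/integrableP; split; first exact/measurable_EFinP/measurable_funTS.
  under eq_integral do rewrite /= ger0_norm//.
  by rewrite -sE// ltey_eq fin_num_measure.
have i1 : mu.-integrable B (fun x => al%:E * (s x)%:E) by exact: integrableZl.
have i2 : mu.-integrable B (fun=> be%:E) by exact: finite_measure_integrable_cst.
have E x : (al * s x + be)%:E = al%:E * (s x)%:E + be%:E by [].
under [X in integrable _ _ X]eq_fun do rewrite E.
under eq_integral do rewrite E.
split; first exact: integrableD.
rewrite integralD// integralZl// -sE// integral_cst//.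
by rewrite EFinD !EFinM !fineK// fin_num_measure.
Qed.

(* [F] is a countable supremum of affine functions, so [\int F (s x) dmu] is a
   supremum of sums of affine functions of values of [g], which converge
   setwise. *)
Lemma F_divergence_lsc :
  F_divergence F g mu <= limn_einf (fun k => F_divergence F (gamma k) mu).
Proof.
have [s gs] := weak_limit_has_density.
have /choice[t gt] : forall k, exists t, has_density (gamma k) mu t.
  move=> k; apply: (F_divergence_lty F_Gamma0 F_superlinear).
  by rewrite (le_lt_trans (divC k))// ltry.
have tE k := F_divergenceE F_Gamma0 F_finite (gt k).
rewrite (F_divergenceE F_Gamma0 F_finite gs).
have [al [be [h1 h2 h3]]] := F_affine_approx F_Gamma0 F_finite.
have s0 x : (0 <= s x)%R by have [] := gs.
have ms : measurable_fun setT s by have [] := gs.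
have t0 k x : (0 <= t k x)%R by have [] := gt k.
have mt k : measurable_fun setT (t k) by have [] := gt k.
have mG J : measurable_fun setT (fun x => (affine_max al be J (s x))%:E).
  apply/measurable_EFinP.
  exact: (measurableT_comp (measurable_affine_max al be J)).
have mFt k := measurable_F_comp F_Gamma0 F_finite (mt k) (t0 k).
have Ft0 k x : 0 <= F (t k x) by exact: Gamma0_ge0.
(* Quantifying over [B] lets the induction split the domain according to which argument of the
   maximum is larger: the hypothesis serves one piece, setwise convergence of an affine integral the
   other. *)
have key J : forall B : set (borel X), measurable B -> forall e : R, (0 < e)%R ->
    \forall k \near \oo, \int[mu]_(x in B) (affine_max al be J (s x))%:E <=
      \int[mu]_(x in B) F (t k x) + e%:E.
  elim: J => [|J ih] B mB e e0.
    near=> k; rewrite integral0; apply: adde_ge0; last by rewrite lee_fin ltW.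
    by apply: integral_ge0 => x _.
  have e2 : (0 < e / 2)%R by rewrite divr_gt0.
  pose A := [set x | (affine_max al be J (s x) < al J * s x + be J)%R].
  have mA : measurable (A : set (borel X)).
    rewrite (_ : A = setT `&` [set x |
      (affine_max al be J (s x))%:E < (al J * s x + be J)%:E]); last first.
      by apply/seteqP; split => x; rewrite /A/= lte_fin => //; case.
    apply: measurable_lte => //; apply/measurable_EFinP.
    by apply: measurable_funD => //; exact: measurable_funM.
  have mBA : measurable (B `&` A) by exact: measurableI.
  have mBA' : measurable (B `\` A) by exact: measurableD.
  have split (f : borel X -> \bar R) : measurable_fun setT f -> (forall x, 0 <= f x) ->
      \int[mu]_(x in B) f x = \int[mu]_(x in B `\` A) f x + \int[mu]_(x in B `&` A) f x.
    move=> mf f0; rewrite -ge0_integral_setU//; first last.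
    - by apply/disj_setPS => x [[_ nAx] [_ Ax]].
    - exact: measurable_funTS.
    - by rewrite setDE -setIUr (setUC (~` A)) setUv setIT.
  have aff : \forall k \near \oo,
      \int[mu]_(x in B `&` A) (al J * s x + be J)%:E <=
      \int[mu]_(x in B `&` A) F (t k x) + (e / 2)%:E.
    have [_ ->] := has_density_affine (al J) (be J) gs mBA.
    have cv : (al J * fine (gamma k (B `&` A)) + be J * fine (mu (B `&` A)))%R
        @[k --> \oo] -->
        (al J * fine (g (B `&` A)) + be J * fine (mu (B `&` A)))%R.
      apply: cvgD; last exact: cvg_cst.
      by apply: cvgMr; exact: (weak_limit_setwise weak equi mBA).
    have /cvgrPdist_le/(_ _ e2) := cv; apply: filterS => k.
    rewrite ler_norml => /andP[_]; rewrite lerBlDr => h.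
    apply: (@le_trans _ _ ((al J * fine (gamma k (B `&` A)) +
      be J * fine (mu (B `&` A)))%:E + (e / 2)%:E)).
      by move: h; rewrite -EFinD lee_fin (addrC (e / 2)%R).
    apply: leeD2r; have [ti <-] := has_density_affine (al J) (be J) (gt k) mBA.
    apply: le_integral => //; last by move=> x _; exact: h1.
    apply/integrableP; split; first exact: measurable_funTS (mFt k).
    under eq_integral do rewrite gee0_abs//.
    apply: (@le_lt_trans _ _ (\int[mu]_x F (t k x))).
      by apply: ge0_subset_integral => //; exact: mFt.
    by rewrite -tE (le_lt_trans (divC k))// ltry.
  have E1 : \int[mu]_(x in B `\` A) (affine_max al be J.+1 (s x))%:E =
      \int[mu]_(x in B `\` A) (affine_max al be J (s x))%:E.
    apply: eq_integral => x; rewrite inE /A /= => -[_ /negP]; rewrite -leNgt => h.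
    by rewrite max_l.
  have E2 : \int[mu]_(x in B `&` A) (affine_max al be J.+1 (s x))%:E =
      \int[mu]_(x in B `&` A) (al J * s x + be J)%:E.
    by apply: eq_integral => x; rewrite inE /A /= => -[_ h]; rewrite max_r// ltW.
  have G0 x : 0 <= (affine_max al be J.+1 (s x))%:E.
    by rewrite lee_fin affine_max_ge0.
  apply: filterS2 (ih _ mBA' _ e2) aff => k h4 h5.
  rewrite (split _ (mG J.+1) G0) E1 E2 (split _ (mFt k) (Ft0 k)).
  apply: le_trans (leeD h4 h5) _.
  by rewrite [in leRHS](splitr e) EFinD [leRHS]addeACA.
have -> : \int[mu]_x F (s x) =
    limn (fun J => \int[mu]_x (affine_max al be J (s x))%:E).
  rewrite -monotone_convergence//.
  - apply: eq_integral => x _; apply/esym/cvg_lim => //; exact: h3.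
  - by move=> J x _; rewrite lee_fin affine_max_ge0.
  - by move=> x _ m n mn; rewrite lee_fin; exact: affine_max_nd.
apply: lime_le.
  apply: ereal_nondecreasing_is_cvgn => m n mn.
  apply: ge0_le_integral => // [x _|x _]; rewrite lee_fin; first exact: affine_max_ge0.
  exact: affine_max_nd.
near=> J; apply: le_limn_einf => e e0.
by near do rewrite tE; exact: key.
Unshelve. all: by end_near. Qed.

End F_divergence_lsc.

(** * Bridges *)

Section bridges.
Context (R : realType) (X1 X2 : metricType R).

(* The part of a pseudo-metric coupling that lives on [X1 * X2]. *)
Record bridge (h : X1 -> X2 -> R) : Prop := {
  bridge_l : forall x x' y, h x y <= mdist x x' + h x' y;
  bridge_r : forall x y y', h x y <= h x y' + mdist y' y;
  bridge_dl : forall x x' y, mdist x x' <= h x y + h x' y;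
  bridge_dr : forall x y y', mdist y y' <= h x y + h x y'
}.

Lemma bridge_ge0 h x y : bridge h -> 0 <= h x y.
Proof.
by move=> bh; have := bridge_dl bh x x y; rewrite mdistxx; lra.
Qed.

Lemma bridge_lipschitz h : bridge h -> forall x x' y y',
  `|h x y - h x' y'| <= mdist x x' + mdist y y'.
Proof.
move=> bh x x' y y'; rewrite ler_norml; apply/andP; split.
- have := bridge_l bh x' x y'; have := bridge_r bh x y' y.
  by rewrite (metric_sym x' x); lra.
- have := bridge_l bh x x' y; have := bridge_r bh x' y y'.
  by rewrite (metric_sym y' y); lra.
Qed.

Lemma bridge_continuous h : bridge h -> continuous (fun p : X1 * X2 => h p.1 p.2).
Proof. by move=> bh; apply: lipschitz2_continuous; exact: bridge_lipschitz. Qed.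

Definition coupling_of (h : X1 -> X2 -> R) (p q : X1 + X2) : R :=
  match p, q with
  | inl x, inl x' => mdist x x'
  | inl x, inr y => h x y
  | inr y, inl x => h x y
  | inr y, inr y' => mdist y y'
  end.

Lemma pseudometric_coupling_of h :
  bridge h -> pseudometric_coupling (coupling_of h).
Proof.
move=> bh; split => //.
- by case=> x /=; rewrite mdistxx.
- by case=> x [] y //=; rewrite metric_sym.
- case=> [x|y] [x'|y'] [x''|y''] /=.
  + exact: metric_triangle.
  + exact: bridge_l.
  + exact: bridge_dl.
  + exact: bridge_r.
  + by rewrite addrC metric_sym; exact: bridge_l.
  + exact: bridge_dr.
  + by rewrite addrC (metric_sym y y'); exact: bridge_r.
  + exact: metric_triangle.
Qed.

Lemma bridge_cvg (h : nat -> X1 -> X2 -> R) (H : X1 -> X2 -> R) :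
  (forall n, bridge (h n)) -> (forall x y, h n x y @[n --> \oo] --> H x y) ->
  bridge H.
Proof.
move=> bh hH.
have c1 x x' y : (mdist x x' + h n x' y) @[n --> \oo] --> mdist x x' + H x' y.
  by apply: cvgD; [exact: cvg_cst|exact: hH].
have c2 x y y' : (h n x y' + mdist y' y) @[n --> \oo] --> H x y' + mdist y' y.
  by apply: cvgD; [exact: hH|exact: cvg_cst].
have c3 x y x' y' : (h n x y + h n x' y') @[n --> \oo] --> H x y + H x' y'.
  by apply: cvgD; exact: hH.
split=> [x x' y|x y y'|x x' y|x y y'].
- apply: (ler_cvg_to (hH x y) (c1 x x' y)); apply: nearW => n.
  exact: bridge_l.
- apply: (ler_cvg_to (hH x y) (c2 x y y')); apply: nearW => n.
  exact: bridge_r.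
- apply: (cvgr_to_ge (c3 x y x' y)); apply: nearW => n.
  exact: bridge_dl.
- apply: (cvgr_to_ge (c3 x y x y')); apply: nearW => n.
  exact: bridge_dr.
Qed.

(** The two spaces joined by an edge of length 1 from [x0] to [y0]. This is the default bridge
    wherever any bridge will do. *)
Lemma bridge_point (x0 : X1) (y0 : X2) :
  bridge (fun x y => mdist x x0 + 1 + mdist y0 y).
Proof.
split=> [x x' y|x y y'|x x' y|x y y'].
- by have := metric_triangle x x' x0; lra.
- by have := metric_triangle y0 y' y; lra.
- have := metric_triangle x x0 x'; rewrite (metric_sym x0 x').
  by have := mdist_ge0 y0 y; lra.
- have := metric_triangle y y0 y'; rewrite (metric_sym y y0).
  by have := mdist_ge0 x x0; lra.
Qed.

End bridges.

(** * Growth and truncation of the cost *)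

Section cost_growth.
Context (R : realType) (l : R -> \bar R).
Hypothesis l_cost : cost_profile l.
Local Open Scope ereal_scope.

(** Convexity between 0 and [s] gives [l 1 <= l s / s], and [l 1 > 0]. As [l 1] may be infinite, the
    slope is any positive real below it. *)
Lemma cost_linear_growth : exists2 c : R, (0 < c)%R &
  forall s : R, (1 <= s)%R -> (c * s)%:E <= l s.
Proof.
have l10 : 0 < l 1%R.
  rewrite lt_neqAle (cost_ge0 l_cost)// andbT; apply/eqP => /esym.
  by move/(cost_eq0 l_cost ler01)/eqP; rewrite oner_eq0.
have [c c0 cl] : exists2 c : R, (0 < c)%R & c%:E <= l 1%R.
  move: l10; case: (l 1%R) => [r|_|//]; last by exists 1%R; rewrite ?leey.
  by rewrite lte_fin => r0; exists r.
exists c => // s s1; have s0 : (0 < s)%R by rewrite (lt_le_trans ltr01).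
have s01 : (0 <= s^-1 <= 1)%R by rewrite invr_ge0 ltW//= invf_le1.
have l0 : l 0%R = 0 by apply/cost_eq0.
have := cost_convex l_cost (ltW s0) (lexx 0%R) s01.
rewrite l0 mule0 adde0 mulr0 addr0 mulVf ?gt_eqF// => h.
have : c%:E <= (s^-1)%:E * l s by exact: le_trans h.
case: (l s) (cost_ge0 l_cost (ltW s0)) => [r r0|_ _|//]; last by rewrite leey.
by rewrite -EFinM !lee_fin ler_pdivlMl// mulrC.
Qed.

Lemma cvg_mine_nat (u : nat -> \bar R) (L : \bar R) :
  u m @[m --> \oo] --> L -> (forall m, u m <= L) ->
  mine (u m) m%:R%:E @[m --> \oo] --> L.
Proof.
case: L => [r| |] uL uleL.
- have [N rN] : exists N : nat, (r <= N%:R)%R.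
    by exists (Num.truncn r).+1; rewrite ltW// truncnS_gt.
  apply: cvg_trans uL; apply: near_eq_cvg; exists N => // m /= Nm.
  rewrite /= min_l// (le_trans (uleL m))// lee_fin (le_trans rN)//.
  by rewrite ler_nat.
- apply/cvgeyPge => A; move/cvgeyPge : uL => /(_ A) [N _ hN].
  exists (maxn N (Num.truncn A).+1) => // m /=; rewrite geq_max => /andP[Nm Am].
  rewrite le_min hN//= lee_fin (le_trans (ltW (truncnS_gt _)))//.
  by rewrite ler_nat.
- apply: cvg_trans uL; apply: near_eq_cvg; apply: nearW => m.
  by have := uleL m; rewrite leeNy_eq => /eqP ->; rewrite min_l// leNye.
Qed.

Lemma continuous_fine_mine (T : topologicalType) (u : T -> \bar R) (r : R) :
  continuous u -> (forall x, 0 <= u x) ->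
  continuous (fun x => fine (mine (u x) r%:E)).
Proof.
move=> cu u0 x; case: (ltP r%:E (u x)) => [rx|xr].
  apply: cvg_near_cst.
  have : \forall y \near x, [set v | r%:E < v] (u y).
    by apply: cu; apply: open_nbhs_nbhs; split; [exact: open_ereal_gt_ereal|].
  by apply: filterS => y /= ry; rewrite !min_r// ltW.
have ux : u x = (fine (u x))%:E.
  by rewrite fineK// ge0_fin_numE// (le_lt_trans xr)// ltry.
have : u @ x --> (fine (u x))%:E by rewrite -ux; exact: cu.
move=> /fine_cvgP[ufin uc].
have : (fun y => Num.min (fine (u y)) r) @ x --> Num.min (fine (u x)) r.
  apply: (@continuous_min _ _ (fun y => fine (u y)) (fun=> r)) => //.
  exact: cvg_cst.
have E y : u y \is a fin_num -> fine (mine (u y) r%:E) = Num.min (fine (u y)) r.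
  by move=> yfin; rewrite -{1}(fineK yfin) -EFin_min.
rewrite /continuous_at E; last by rewrite ux.
apply: cvg_trans; apply: near_eq_cvg.
by apply: filterS ufin => y yfin /=; rewrite E.
Qed.

End cost_growth.

(** * Lower semicontinuity of the transport cost along varying bridges *)

Section cost_lsc.
Context (R : realType) (l : R -> \bar R).
Hypothesis l_cost : cost_profile l.
Context (X1 X2 : polishMetricType R).
Variables (gamma : nat -> fmeasure R (X1 * X2)%type) (g : fmeasure R (X1 * X2)%type).
Variable h : nat -> X1 -> X2 -> R.
Hypothesis bh : forall n, bridge (h n).
Hypothesis weak : forall f : X1 * X2 -> R, continuous f ->
  (exists M : R, forall x, `|f x| <= M) ->
  (\int[gamma k]_(x in [set: borel (X1 * X2)%type]) f x)%R @[k --> \oo] -->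
  (\int[g]_(x in [set: borel (X1 * X2)%type]) f x)%R.

(** Weak convergence needs an integrand that does not depend on [k]. The tail infimum is below every
    [h k] with [k >= m], grows with [m], and inherits the Lipschitz bound. *)
Definition bridge_tail (m : nat) (x : X1) (y : X2) : R :=
  inf [set h j x y | j in [set j | (m <= j)%N]].

Local Lemma tail_has_inf m x y : has_inf [set h j x y | j in [set j | (m <= j)%N]].
Proof.
split; first by exists (h m x y), m => /=.
by exists 0 => _ [j _ <-]; exact: bridge_ge0.
Qed.

Lemma bridge_tail_le m k x y : (m <= k)%N -> bridge_tail m x y <= h k x y.
Proof.
by move=> mk; apply: ge_inf; [have [] := tail_has_inf m x y|exists k].
Qed.

Lemma bridge_tail_ge m x y (b : R) :
  (forall k, (m <= k)%N -> b <= h k x y) -> b <= bridge_tail m x y.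
Proof.
move=> hb; apply: lb_le_inf; first by have [] := tail_has_inf m x y.
by move=> _ [k mk <-]; exact: hb.
Qed.

Lemma bridge_tail_ge0 m x y : 0 <= bridge_tail m x y.
Proof. by apply: bridge_tail_ge => k _; exact: bridge_ge0. Qed.

Lemma bridge_tail_nd x y : nondecreasing_seq (fun m => bridge_tail m x y).
Proof.
move=> m n mn; apply: bridge_tail_ge => k nk; apply: bridge_tail_le.
exact: leq_trans nk.
Qed.

Lemma bridge_tail_lipschitz m x x' y y' :
  `|bridge_tail m x y - bridge_tail m x' y'| <= mdist x x' + mdist y y'.
Proof.
have half a b c d : bridge_tail m a b <= bridge_tail m c d + (mdist a c + mdist b d).
  rewrite -lerBlDr; apply: bridge_tail_ge => k mk; rewrite lerBlDr.
  apply: (le_trans (bridge_tail_le a b mk)).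
  by have := bridge_lipschitz (bh k) a c b d; rewrite ler_norml => /andP[_]; lra.
rewrite ler_norml; apply/andP; split.
- by have := half x' y' x y; rewrite (metric_sym x' x) (metric_sym y' y); lra.
- by have := half x y x' y'; lra.
Qed.

Lemma bridge_tail_cvg x y (H : R) : h n x y @[n --> \oo] --> H ->
  bridge_tail m x y @[m --> \oo] --> H /\ forall m, bridge_tail m x y <= H.
Proof.
move=> hH; have le m : bridge_tail m x y <= H.
  apply: (cvgr_to_ge hH); exists m => // k /= mk; exact: bridge_tail_le.
split => //; apply/cvgrPdist_le => e e0.
have /cvgrPdist_le/(_ _ e0)[N _ hN] := hH.
exists N => // m /= Nm; rewrite ger0_norm ?subr_ge0// lerBlDr -lerBlDl.
apply: bridge_tail_ge => k mk; have := hN k (leq_trans Nm mk).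
by rewrite ler_norml => /andP[_]; lra.
Qed.

Local Open Scope ereal_scope.

(** Its pointwise limit is kept abstract below: it is the limit cost when the bridges converge and
    [+oo] when they diverge. *)
Let G m (p : X1 * X2) := mine (l (bridge_tail m p.1 p.2)) m%:R%:E.

(* The functions [G m] are bounded, continuous and below [l \o h k] for [k >= m],
   so weak convergence applies to each of them. *)
Lemma cost_limn_einf (q : X1 * X2 -> \bar R) :
  (forall p, G m p @[m --> \oo] --> q p) ->
  \int[g]_(p in [set: borel (X1 * X2)%type]) q p <=
  limn_einf (fun k => \int[gamma k]_(p in [set: borel (X1 * X2)%type]) l (h k p.1 p.2)).
Proof.
move=> Gq.
have G0 m p : 0 <= G m p.
  by rewrite le_min lee_fin ler0n andbT; apply: cost_ge0 => //; exact: bridge_tail_ge0.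
have Gm m p : G m p <= m%:R%:E by rewrite ge_min lexx orbT.
have Gfin m p : G m p \is a fin_num.
  by rewrite ge0_fin_numE// (le_lt_trans (Gm m p))// ltry.
have ctail m : continuous (fun p : X1 * X2 => bridge_tail m p.1 p.2).
  by apply: lipschitz2_continuous => x x' y y'; exact: bridge_tail_lipschitz.
have cl m : continuous (fun p : X1 * X2 => l (bridge_tail m p.1 p.2)).
  by apply: (continuous_cost_comp l_cost (ctail m)) => p; exact: bridge_tail_ge0.
have cG m : continuous (fun p : X1 * X2 => fine (G m p)).
  apply: continuous_fine_mine; first exact: cl.
  by move=> p; apply: (cost_ge0 l_cost); exact: bridge_tail_ge0.
have mG m : measurable_fun [set: borel (X1 * X2)%type] (G m).
  rewrite (_ : G m = EFin \o (fun p => fine (G m p))); last first.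
    by apply/funext => p; rewrite /= fineK.
  by apply/measurable_EFinP; exact: continuous_borel_real (cG m).
have IG (nu : fmeasure R (X1 * X2)%type) m :
    \int[nu]_(p in [set: borel (X1 * X2)%type]) G m p =
    (\int[nu]_(p in [set: borel (X1 * X2)%type]) fine (G m p))%R%:E.
  rewrite /Rintegral fineK.
    by apply: eq_integral => p _; rewrite fineK.
  under eq_integral do rewrite fineK//.
  rewrite ge0_fin_numE; last by apply: integral_ge0 => p _; exact: G0.
  apply: (@le_lt_trans _ _ (\int[nu]_(p in [set: borel (X1 * X2)%type]) m%:R%:E)).
    by apply: ge0_le_integral.
  by rewrite integral_cst// ltey_eq fin_numM// fin_num_measure.
have -> : \int[g]_(p in [set: borel (X1 * X2)%type]) q p =
    limn (fun m => \int[g]_(p in [set: borel (X1 * X2)%type]) G m p).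
  rewrite -monotone_convergence//.
  - by apply: eq_integral => p _; apply/esym/cvg_lim.
  - move=> p _ m n mn; rewrite /G le_min !ge_min lee_fin ler_nat mn orbT andbT.
    rewrite (cost_nd l_cost)// bridge_tail_ge0/=.
    exact: bridge_tail_nd.
apply: lime_le.
  apply: ereal_nondecreasing_is_cvgn => m n mn.
  apply: ge0_le_integral => // p _.
  rewrite /G le_min !ge_min lee_fin ler_nat mn orbT andbT.
  by rewrite (cost_nd l_cost)// bridge_tail_ge0/=; exact: bridge_tail_nd.
near=> m; apply: le_limn_einf => e e0.
have bG : exists M : R, forall p, (`|fine (G m p)| <= M)%R.
  by exists m%:R => p; rewrite ger0_norm ?fine_ge0// -lee_fin fineK.
have /cvgrPdist_le/(_ _ e0)[N _ hN] := weak (cG m) bG.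
exists (maxn m N) => // k /=; rewrite geq_max => /andP[mk Nk].
apply: (@le_trans _ _ (\int[gamma k]_(p in [set: borel (X1 * X2)%type]) G m p + e%:E)).
  rewrite !IG -EFinD lee_fin; have := hN k Nk; rewrite ler_norml => /andP[_].
  by rewrite lerBlDl.
apply: leeD2r; apply: ge0_le_integral => //.
- apply: continuous_emeasurable; apply: (continuous_cost_comp l_cost).
    exact: bridge_continuous (bh k).
  by move=> p; exact: bridge_ge0 (bh k).
- move=> p _; rewrite /G ge_min; apply/orP; left; apply: (cost_nd l_cost).
  by rewrite bridge_tail_ge0/=; exact: bridge_tail_le.
Unshelve. all: by end_near. Qed.

End cost_lsc.

(** * Existence of a minimizer *)

Section bridge_subsequence.
Context (R : realType) (X1 X2 : polishMetricType R).
Implicit Type h : nat -> X1 -> X2 -> R.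

Lemma bridge_cvg_dense h (z : nat -> X1 * X2) (c : nat -> R) :
  (forall n, bridge (h n)) ->
  (forall x e, 0 < e -> exists n, ball (z n) e x) ->
  (forall i, h n (z i).1 (z i).2 @[n --> \oo] --> c i) ->
  exists H, bridge H /\ forall x y, h n x y @[n --> \oo] --> H x y.
Proof.
move=> bh zd hc; suff cvgh x y : cvg (h n x y @[n --> \oo]).
  exists (fun x y => lim (h n x y @[n --> \oo])).
  by split; [exact: (bridge_cvg bh)|exact: cvgh].
apply: cauchy_cvg; apply: cauchy_exP => e e0.
have e3 : 0 < e / 3 by rewrite divr_gt0.
have [i [/= zx zy]] := zd (x, y) _ e3.
exists (c i); have /cvgrPdist_lt/(_ _ e3)[N _ hN] := hc i.
exists N => // k /= Nk; have := hN k Nk.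
have := bridge_lipschitz (bh k) (z i).1 x (z i).2 y.
move: zx zy; rewrite !ballEmdist /ball/= => zx zy.
rewrite ler_norml => /andP[? ?]; rewrite !ltr_norml => /andP[? ?].
by apply/andP; split; lra.
Qed.

(** The alternative is decided at one base point: by the Lipschitz bound, bridges bounded there are
    bounded at each point, and bridges diverging there diverge everywhere. *)
Lemma bridge_subsequence h : (forall n, bridge (h n)) ->
  exists phi : nat -> nat, (forall k, (k <= phi k)%N) /\
  ((exists H, bridge H /\ forall x y, h (phi n) x y @[n --> \oo] --> H x y) \/
   (forall x y, h (phi n) x y @[n --> \oo] --> +oo)).
Proof.
move=> bh; pose x0 : X1 := point; pose y0 : X2 := point.
have [[B hB]|nB] := pselect (exists B : R, forall N, exists n, (N <= n)%N /\ h n x0 y0 <= B).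
  have [psi psiP] := choice hB.
  have [z zd] := separable_dense_seq (X1 * X2)%type.
  have ub i n : `|h (psi n) (z i).1 (z i).2| <= B + mdist x0 (z i).1 + mdist y0 (z i).2.
    rewrite ger0_norm; last exact: bridge_ge0.
    have := bridge_lipschitz (bh (psi n)) (z i).1 x0 (z i).2 y0.
    rewrite (metric_sym (z i).1) (metric_sym (z i).2) ler_norml => /andP[_ ?].
    by have [_ ?] := psiP n; lra.
  have [phi [c [kphi cphi]]] := diagonal_subsequence ub.
  exists (psi \o phi); split=> [k|].
    by rewrite (leq_trans (kphi k))//; have [] := psiP (phi k).
  left; exact: (@bridge_cvg_dense (fun k => h (psi (phi k))) z c).
exists id; split => //; right => x y; apply/cvgryPge => A.
move/forallNP : nB => /(_ (A + mdist x x0 + mdist y y0)) /existsNP[N /forallNP hN].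
exists N => // n /= Nn; have /not_andP[//|/negP] := hN n.
rewrite -ltNge => ?; have := bridge_lipschitz (bh n) x x0 y y0.
by rewrite ler_norml => /andP[? _]; lra.
Qed.

End bridge_subsequence.

Section minimizer.
Context (R : realType) (a : R) (F l : R -> \bar R).
Hypothesis reg : regular_ET a F l.
Context (X1 X2 : polishMetricType R) (mu1 : fmeasure R X1) (mu2 : fmeasure R X2).
Local Open Scope ereal_scope.
Implicit Types (g : fmeasure R (X1 * X2)%type) (h : X1 -> X2 -> R).

Let F_Gamma0 := reg_Gamma0 reg.
Let F_finite := reg_finite reg.
Let F_superlinear := reg_superlinear reg.
Let l_cost := reg_cost reg.

Definition bridge_energy g h :=
  F_divergence F (marginal1 g) mu1 + F_divergence F (marginal2 g) mu2 +
  \int[g]_z l (h z.1 z.2).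

Lemma bridge_cost_ge0 h z : bridge h -> 0 <= l (h z.1 z.2).
Proof. by move=> bh; apply: (cost_ge0 l_cost); exact: bridge_ge0. Qed.

Lemma bridge_cost_integral_ge0 g h : bridge h -> 0 <= \int[g]_z l (h z.1 z.2).
Proof. by move=> bh; apply: integral_ge0 => z _; exact: bridge_cost_ge0. Qed.

Lemma bridge_energy_ge0 g h : bridge h -> 0 <= bridge_energy g h.
Proof.
move=> bh; apply: adde_ge0; last exact: bridge_cost_integral_ge0.
by apply: adde_ge0; exact: F_divergence_ge0.
Qed.

Lemma measurable_bridge_cost h : bridge h ->
  measurable_fun [set: borel (X1 * X2)%type] (fun z => l (h z.1 z.2)).
Proof.
move=> bh; apply: continuous_emeasurable.
apply: (continuous_cost_comp l_cost (bridge_continuous bh)) => z.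
exact: bridge_ge0.
Qed.

Lemma null_bridge_cost g h :
  g setT = 0 -> bridge h -> \int[g]_z l (h z.1 z.2) = 0.
Proof. by move=> g0 bh; apply: null_set_integral => //; exact: measurable_bridge_cost. Qed.

(* Balls of a dense sequence capture almost all of [mu1] and [mu2], and the
   divergence bound transfers this to the marginals of the plans. *)
Lemma bounded_energy_tight (gamma : nat -> fmeasure R (X1 * X2)%type) (C : R) :
  (0 <= C)%R ->
  (forall n, F_divergence F (marginal1 (gamma n)) mu1 <= C%:E) ->
  (forall n, F_divergence F (marginal2 (gamma n)) mu2 <= C%:E) ->
  (exists M : R, forall n, gamma n setT <= M%:E) /\
  forall e : R, (0 < e)%R -> exists (z : nat -> X1 * X2) (N : nat), forall n,
    gamma n (~` \bigcup_(i < N) ball (z i) e) <= e%:E.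
Proof.
move=> C0 C1 C2; split.
  have [K K0 hK] := F_divergence_unif_bound F_Gamma0 F_finite F_superlinear C0 ltr01.
  exists (K * fine (mu1 setT) + 1)%R => n.
  have := hK _ _ _ (C1 n) setT measurableT.
  by rewrite EFinD EFinM fineK// fin_num_measure.
move=> e e0.
have e4 : (0 < e / 4)%R by rewrite divr_gt0.
have [K K0 hK] := F_divergence_unif_bound F_Gamma0 F_finite F_superlinear C0 e4.
have K1 : (0 < K + 1)%R by rewrite ltr_wpDl.
have rest (X : polishMetricType R) (mu : fmeasure R X) : exists (x : nat -> X) (N : nat),
    forall nu : fmeasure R X, F_divergence F nu mu <= C%:E ->
    nu (~` \bigcup_(i < N) ball (x i) e) <= (e / 2)%:E.
  have [x xd] := separable_dense_seq X.
  pose B n : set (borel X) := \bigcup_(i < n) ball (x i) e.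
  have mB n : measurable (B n).
    apply: open_borel; apply: bigcup_open => i _; exact: ball_open_metric.
  have ndB : nondecreasing_seq B.
    move=> m n mn; apply/subsetPset => y [i /= im yi].
    by exists i => //=; exact: leq_trans mn.
  have [N hN] := finite_measure_bigcup_approx mu mB ndB (divr_gt0 e4 K1).
  exists x, N => nu nuC.
  have := hK _ _ _ nuC (~` B N) (measurableC (mB N)).
  move=> /le_trans; apply; apply: (@le_trans _ _ (K%:E * (e / 4 / (K + 1))%:E + (e / 4)%:E)).
    apply: leeD2r; apply: lee_wpmul2l; first by rewrite lee_fin.
    apply: le_trans hN; rewrite le_measure ?inE//.
    - exact: measurableC.
    - by apply: measurableD => //; exact: bigcupT_measurable.
    - move=> y By; split => //; have [n xn] := xd y e e0.
      by exists n.+1 => //; exists n => //=.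
  rewrite -EFinM -EFinD lee_fin [leRHS](_ : _ = e / 4 + e / 4)%R; last by field.
  rewrite lerD2r mulrCA; apply: ler_piMr; first exact: ltW.
  by rewrite ler_pdivrMr// mul1r lerDl.
have [x [N xN]] := rest _ mu1; have [y [M yM]] := rest _ mu2.
(* The index [i * M + j] stands for the pair of the [i]-th and the [j]-th center. *)
exists (fun k => (x (k %/ M), y (k %% M))%N), (N * M)%N => n.
pose A : set (borel X1) := ~` \bigcup_(i < N) ball (x i) e.
pose A' : set (borel X2) := ~` \bigcup_(i < M) ball (y i) e.
have mA : measurable A.
  apply: measurableC; apply: open_borel; apply: bigcup_open => i _; exact: ball_open_metric.
have mA' : measurable A'.
  apply: measurableC; apply: open_borel; apply: bigcup_open => i _; exact: ball_open_metric.
have mA1 : measurable (fst @^-1` A : set (borel (X1 * X2)%type)).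
  by rewrite -[X in measurable X]setTI; exact: (continuous_borel_measurable (@fst_continuous _ _)).
have mA2 : measurable (snd @^-1` A' : set (borel (X1 * X2)%type)).
  by rewrite -[X in measurable X]setTI; exact: (continuous_borel_measurable (@snd_continuous _ _)).
apply: (@le_trans _ _ (gamma n (fst @^-1` A `|` snd @^-1` A'))).
  rewrite le_measure ?inE//.
  - apply: measurableC; apply: open_borel; apply: bigcup_open => i _; exact: ball_open_metric.
  - exact: measurableU.
  - move=> [u v] nb; apply: contrapT => /not_orP[/contrapT[i /= iN xi] /contrapT[j /= jM yj]].
    apply: nb; exists (i * M + j)%N => /=.
      by rewrite (@leq_trans (i.+1 * M))// ?leq_mul// mulSnr ltn_add2l.
    have M0 : (0 < M)%N by rewrite (leq_ltn_trans _ jM).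
    by rewrite divnMDl// divn_small// addn0 modnMDl modn_small.
apply: le_trans (measureU2 (gamma n) mA1 mA2) _.
rewrite [in leRHS](splitr e) EFinD; apply: leeD; [exact: xN (C1 n)|exact: yM (C2 n)].
Qed.

Lemma weak_limit_marginals (gamma : nat -> fmeasure R (X1 * X2)%type) g :
  (forall f : X1 * X2 -> R, continuous f -> (exists M : R, forall x, `|f x| <= M)%R ->
    (\int[gamma k]_(x in [set: borel (X1 * X2)%type]) f x)%R @[k --> \oo] -->
    (\int[g]_(x in [set: borel (X1 * X2)%type]) f x)%R) ->
  (forall f : X1 -> R, continuous f -> (exists M : R, forall x, `|f x| <= M)%R ->
    (\int[marginal1 (gamma k)]_(x in [set: borel X1]) f x)%R @[k --> \oo] -->
    (\int[marginal1 g]_(x in [set: borel X1]) f x)%R) /\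
  (forall f : X2 -> R, continuous f -> (exists M : R, forall x, `|f x| <= M)%R ->
    (\int[marginal2 (gamma k)]_(x in [set: borel X2]) f x)%R @[k --> \oo] -->
    (\int[marginal2 g]_(x in [set: borel X2]) f x)%R).
Proof.
move=> weak.
have push (X : polishMetricType R) (p : X1 * X2 -> X) (cp : continuous p)
    (f : X -> R) : continuous f -> (exists M : R, forall x, `|f x| <= M)%R ->
    (\int[cpush cp (gamma k)]_(x in [set: borel X]) f x)%R @[k --> \oo] -->
    (\int[cpush cp g]_(x in [set: borel X]) f x)%R.
  move=> cf [M fM].
  have IE (nu : fmeasure R (X1 * X2)%type) :
      (\int[cpush cp nu]_(x in [set: borel X]) f x)%R =
      (\int[nu]_(z in [set: borel (X1 * X2)%type]) f (p z))%R.
    rewrite /Rintegral; congr fine.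
    have mf : measurable_fun [set: borel X] (EFin \o f).
      by apply/measurable_EFinP; exact: continuous_borel_real.
    have mp := continuous_borel_measurable cp.
    rewrite integralE [RHS]integralE; congr (_ - _).
    - have -> := funepos_comp (EFin \o f) p; apply: (integral_push mp) => //.
      exact: measurable_funepos.
    - have -> := funeneg_comp (EFin \o f) p; apply: (integral_push mp) => //.
      exact: measurable_funeneg.
  have cfp : continuous (f \o p) by move=> z; apply: continuous_comp; [exact: cp|exact: cf].
  have := weak _ cfp (ex_intro _ M (fun z => fM (p z))).
  by rewrite IE; under eq_fun do rewrite -IE.
by split; exact: push.
Qed.

Lemma bridge_energy_limit (gamma : nat -> fmeasure R (X1 * X2)%type)
    (h : nat -> X1 -> X2 -> R) (V : R) (e : nat -> R) :
  (forall n, bridge (h n)) -> (0 <= V)%R -> (forall n, 0 <= e n <= 1)%R ->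
  e n @[n --> \oo] --> 0%R ->
  (forall n, bridge_energy (gamma n) (h n) <= (V + e n)%:E) ->
  exists g H, bridge H /\ bridge_energy g H <= V%:E.
Proof.
move=> bh V0 e01 e0 EV.
have F1_ge0 n := F_divergence_ge0 F_Gamma0 F_superlinear (marginal1 (gamma n)) mu1.
have F2_ge0 n := F_divergence_ge0 F_Gamma0 F_superlinear (marginal2 (gamma n)) mu2.
have c_ge0 n := bridge_cost_integral_ge0 (gamma n) (bh n).
have EV1 n : bridge_energy (gamma n) (h n) <= (V + 1)%:E.
  by rewrite (le_trans (EV n))// lee_fin lerD2l; case/andP : (e01 n).
have C1 n : F_divergence F (marginal1 (gamma n)) mu1 <= (V + 1)%:E.
  by apply: le_trans (EV1 n); rewrite /bridge_energy -addeA leeDl// adde_ge0.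
have C2 n : F_divergence F (marginal2 (gamma n)) mu2 <= (V + 1)%:E.
  by apply: le_trans (EV1 n); rewrite /bridge_energy addeAC leeDr// adde_ge0.
have C3 n : \int[gamma n]_z l (h n z.1 z.2) <= (V + 1)%:E.
  by apply: le_trans (EV1 n); rewrite /bridge_energy leeDr// adde_ge0.
have V1 : (0 <= V + 1)%R by rewrite addr_ge0.
have [phi [kphi hphi]] := bridge_subsequence bh.
have [[M gM] tight] := @bounded_energy_tight (gamma \o phi) (V + 1)%R V1
  (fun n => C1 (phi n)) (fun n => C2 (phi n)).
have [psi [g [kpsi Dg]]] := ET_precompact reg gM tight.
pose k n := phi (psi n).
have kn n : (n <= k n)%N by rewrite (leq_trans (kpsi n)).
have weak := ET_dist_weak reg Dg.
have [weak1 weak2] := weak_limit_marginals weak.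
have lsc1 := F_divergence_lsc F_Gamma0 F_finite F_superlinear weak1 V1 (fun n => C1 (k n)).
have lsc2 := F_divergence_lsc F_Gamma0 F_finite F_superlinear weak2 V1 (fun n => C2 (k n)).
have psi_cvg (T : topologicalType) (u : nat -> T) (G : set_system T) :
    u n @[n --> \oo] --> G -> u (psi n) @[n --> \oo] --> G.
  move=> ux A /ux[N _ hN]; exists N => // n /= Nn; apply: hN => /=.
  exact: leq_trans (kpsi n).
have lsc3 q := @cost_limn_einf R l l_cost X1 X2 (gamma \o k) g (h \o k)
  (fun n => bh (k n)) weak q.
have sum_le : limn_einf (fun n => F_divergence F (marginal1 (gamma (k n))) mu1) +
    limn_einf (fun n => F_divergence F (marginal2 (gamma (k n))) mu2) +
    limn_einf (fun n => \int[gamma (k n)]_z l (h (k n) z.1 z.2)) <= V%:E.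
  apply: (@limn_einf_add3_le _ _ _ _ _ (e \o k)) => //.
    by move=> n; rewrite -EFinD; exact: EV.
  move=> A /e0[N _ hN]; exists N => // n /= Nn; apply: hN => /=.
  exact: leq_trans (kn n).
have conclude (H : X1 -> X2 -> R) : \int[g]_z l (H z.1 z.2) <=
    limn_einf (fun n => \int[gamma (k n)]_z l (h (k n) z.1 z.2)) ->
    bridge_energy g H <= V%:E.
  by move=> H3; apply: le_trans sum_le; apply: leeD => //; exact: leeD.
case: hphi => [[H [bH cH]]|hy].
  exists g, H; split => //; apply: conclude.
  apply: (lsc3 (fun z => l (H z.1 z.2))) => -[x y] /=.
  have [tc tle] := bridge_tail_cvg (fun n => bh (k n)) (psi_cvg _ _ _ (cH x y)).
  apply: cvg_mine_nat.
    rewrite -(ger0_norm (bridge_ge0 x y bH)).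
    apply: cvg_trans (cvg_comp _ _ tc (@cost_continuous_norm _ _ l_cost _)).
    apply: near_eq_cvg; near=> m => /=; rewrite ger0_norm//.
    exact: (bridge_tail_ge0 (fun n => bh (k n))).
  move=> m; apply: (cost_nd l_cost); rewrite tle andbT.
  exact: (bridge_tail_ge0 (fun n => bh (k n))).
have bp := @bridge_point R X1 X2 point point.
exists g; eexists; split; first exact: bp.
(* The truncated costs tend to [+oo] at every point because [l] grows at least linearly; so [+oo]
   has a [g]-integral of at most [V + 1], which forces [g] to be null. *)
have gT0 : g setT = 0.
  have : \int[g]_(p in setT) (cst +oo) p <= (V + 1)%:E.
    apply: (@le_trans _ _ (limn_einf (fun n => \int[gamma (k n)]_z l (h (k n) z.1 z.2)))).
      apply: lsc3 => -[x y] /=; apply: cvg_mine_nat => [|m]; last exact: leey.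
      have [c c0 cl] := cost_linear_growth l_cost.
      apply/cvgeyPge => A.
      have /cvgryPge/(_ (Num.max 1 (A / c))%R)[N _ hN] := psi_cvg _ _ _ (hy x y).
      exists N => // m /= Nm.
      have tm : (Num.max 1 (A / c) <= bridge_tail (h \o k) m x y)%R.
        apply: (bridge_tail_ge (fun n => bh (k n))) => j mj; apply: hN => /=.
        exact: leq_trans mj.
      move: tm; rewrite ge_max => /andP[t1 tA].
      by rewrite (le_trans _ (cl _ t1))// lee_fin mulrC -ler_pdivrMr.
    rewrite limn_einf_lim; apply: lime_le; first exact: is_cvg_einfs.
    near=> n; apply: (@le_trans _ _ (\int[gamma (k n)]_z l (h (k n) z.1 z.2))) => //.
    by apply: ereal_inf_lbound; exists n => /=.
  have gm : measurable [set: borel (X1 * X2)%type] by [].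
  have := integral_cst g gm +oo => /= ->.
  have [//|gT] := eqVneq (g setT) 0.
  by rewrite gt0_mulye// lt_neqAle eq_sym gT measure_ge0.
apply: conclude; apply: (@le_trans _ _ 0).
  by have /eqP := null_bridge_cost gT0 bp; rewrite eq_le => /andP[].
rewrite limn_einf_lim; apply: lime_ge; first exact: is_cvg_einfs.
by near=> n; apply: le_ereal_inf_tmp => _ [j _ <-].
Unshelve. all: by end_near. Qed.

Lemma exists_minimal_bridge_energy : exists g H, bridge H /\
  bridge_energy g H \is a fin_num /\
  forall g' H', bridge H' -> bridge_energy g H <= bridge_energy g' H'.
Proof.
pose V := ereal_inf [set r | exists g h, bridge h /\ r = bridge_energy g h].
pose p (x : X1) (y : X2) := (mdist x point + 1 + mdist point y)%R.
have bp : bridge p by exact: bridge_point.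
have V0 : 0 <= V.
  by apply: le_ereal_inf_tmp => _ [g [h [bh ->]]]; exact: bridge_energy_ge0.
have Vfin : V \is a fin_num.
  rewrite ge0_fin_numE//.
  (* The null plan only pays [F 0] per unit of mass, so the infimum is finite. *)
  pose m0 : fmeasure R (X1 * X2)%type := mzero.
  apply: (@le_lt_trans _ _ (bridge_energy m0 p)).
    by apply: ereal_inf_lbound; exists m0, p.
  rewrite /bridge_energy null_bridge_cost// adde0 lte_add_pinfty//.
    apply: le_lt_trans (F_divergence_le F_Gamma0 F_finite _) _.
      by move=> A _; exact: measure_ge0.
    by rewrite ltey_eq fin_numM// ?F_finite// fin_numB !fin_num_measure.
  apply: le_lt_trans (F_divergence_le F_Gamma0 F_finite _) _.
    by move=> A _; exact: measure_ge0.
  by rewrite ltey_eq fin_numM// ?F_finite// fin_numB !fin_num_measure.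
have /choice[g /choice[h gh]] : forall n : nat, exists g h,
    bridge h /\ bridge_energy g h <= (fine V + n.+1%:R^-1)%:E.
  move=> n; have n0 : (0 < n.+1%:R^-1 :> R)%R by rewrite invr_gt0.
  have [_ [g [h [bh ->]]] hlt] := lb_ereal_inf_adherent n0 Vfin.
  by exists g, h; split => //; rewrite EFinD fineK// ltW.
have [g' [H [bH EV]]] := @bridge_energy_limit g h (fine V) (fun n => n.+1%:R^-1)%R
  (fun n => (gh n).1) (fine_ge0 V0)
  (fun n => ltac:(by rewrite invr_ge0 ler0n/= invf_le1 ?ler1n)) (@cvg_harmonic R)
  (fun n => (gh n).2).
exists g', H; split => //; rewrite fineK// in EV; split => [|g1 h1 bh1].
  rewrite ge0_fin_numE; last exact: bridge_energy_ge0.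
  by rewrite (le_lt_trans EV)// ltey_eq Vfin.
by apply: le_trans EV _; apply: ereal_inf_lbound; exists g1, h1.
Qed.

End minimizer.

(** * Isometric embeddings of the supports *)

Section closed_sets.
Context (R : realType).

Lemma closed_mdist (X : metricType R) (A : set X) (x : X) : closed A ->
  (forall e, 0 < e -> exists2 a, A a & mdist x a < e) -> A x.
Proof.
move=> cA h; apply: cA => B /nbhs_ballP[e /= e0 eB].
have [a Aa xa] := h e e0; exists a; split => //; apply: eB.
by rewrite ballEmdist.
Qed.

Lemma complete_mdist (X : polishMetricType R) (u : nat -> X) :
  (forall m n, mdist (u m) (u n) < m.+1%:R^-1 + n.+1%:R^-1) ->
  exists x, forall e, 0 < e -> exists N, forall n, (N <= n)%N -> mdist (u n) x < e.
Proof.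
move=> hu; have cu : cvg (u n @[n --> \oo]).
  apply: cauchy_cvg; apply: cauchy_exP => e e0.
  have e2 : 0 < e / 2 by rewrite divr_gt0.
  have inv_lt n : (Num.truncn (e / 2)^-1 < n.+1)%N -> (n.+1%:R^-1 : R) < e / 2.
    move=> ne; rewrite -[ltRHS]invrK ltf_pV2 ?posrE ?invr_gt0//.
    by rewrite (lt_le_trans (truncnS_gt _))// ler_nat.
  set N := Num.truncn (e / 2)^-1 in inv_lt.
  exists (u N); exists N => // n /= Nn; rewrite ballEmdist/=.
  rewrite (lt_trans (hu N n))// [ltRHS]splitr ltrD// inv_lt//.
exists (lim (u n @[n --> \oo])) => e e0.
have [N _ hN] := cu _ (nbhsx_ballx _ e e0).
by exists N => n Nn; have := hN n Nn; rewrite /= ballEmdist/= metric_sym.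
Qed.

End closed_sets.

Section embedding_maps.
Context (R : realType) (X Y : polishMetricType R) (mu : fmeasure R X).
Variable psi : isometric_embedding Y (supp mu).
Local Open Scope ereal_scope.

Lemma isometric_embedding_inj : injective psi.
Proof.
move=> p q pq; apply: val_inj; apply: mdist_positivity.
by rewrite -(isom_mdist psi) pq mdistxx.
Qed.

(** Points whose images approach [y] form a Cauchy sequence; its limit exists in the complete space
    [X] and stays in the closed support, where [psi] is defined. *)
Lemma isometric_image_closed (C : set X) :
  closed C -> closed (psi @` [set p | C (set_val p)]).
Proof.
move=> cC y cy.
have /choice[p hp] : forall n : nat, exists p : supp mu,
    C (set_val p) /\ (mdist y (psi p) < n.+1%:R^-1)%R.
  move=> n; have n0 : (0 < n.+1%:R^-1 :> R)%R by rewrite invr_gt0.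
  have [_ [[p Cp <-]]] := cy _ (nbhsx_ballx y _ n0).
  by rewrite ballEmdist/= => yp; exists p.
have [|x xlim] := @complete_mdist R X (fun n => set_val (p n)).
  move=> m n; rewrite -(isom_mdist psi).
  apply: le_lt_trans (metric_triangle _ y _) _.
  by rewrite (metric_sym (psi (p m))) ltrD//; [exact: (hp m).2|exact: (hp n).2].
have lim_in (A : set X) : closed A -> (forall n, A (set_val (p n))) -> A x.
  move=> cA Ap; apply: (closed_mdist cA) => e e0; have [N hN] := xlim e e0.
  by exists (set_val (p N)) => //; rewrite metric_sym; exact: hN.
have sx : supp mu x by apply: lim_in => [|n]; [exact: supp_closed|exact: set_valP].
exists (SigSub (mem_set sx)) => /=.
  by apply: lim_in => // n; exact: (hp n).1.
apply: mdist_positivity; apply/eqP; rewrite eq_le mdist_ge0 andbT.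
apply/ler_addgt0Pl => e e0; have e2 : (0 < e / 2)%R by rewrite divr_gt0.
rewrite addr0; have [N hN] := xlim _ e2.
pose n := maxn N (Num.truncn (e / 2)^-1).
have ne : (n.+1%:R^-1 < e / 2)%R.
  rewrite -[ltRHS]invrK ltf_pV2 ?posrE ?invr_gt0//.
  by rewrite (lt_le_trans (truncnS_gt _))// ler_nat ltnS leq_maxr.
apply: le_trans (metric_triangle _ (psi (p n)) _) _.
rewrite (isom_mdist psi)/= (metric_sym x) [leRHS]splitr ltW// ltrD//.
  exact: hN (leq_maxl _ _).
by rewrite metric_sym (lt_trans (hp n).2).
Qed.

Lemma isometric_range_closed : closed (range psi).
Proof.
have := isometric_image_closed (@closedT X).
by rewrite (_ : [set p | _] = setT)//; apply/seteqP; split.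
Qed.

Lemma isometric_preimage_closed (C : set Y) :
  closed C -> closed (set_val @` (psi @^-1` C)).
Proof.
move=> cC x cx.
have approx e : (0 < e)%R -> exists2 p : supp mu, C (psi p) & (mdist x (set_val p) < e)%R.
  move=> e0; have [_ [[p Cp <-]]] := cx _ (nbhsx_ballx x _ e0).
  by rewrite ballEmdist/= => xp; exists p.
have sx : supp mu x.
  apply: (closed_mdist (@supp_closed _ _ mu)) => e /approx[p _ xp].
  by exists (set_val p) => //; exact: set_valP.
exists (SigSub (mem_set sx)) => //=; apply: (closed_mdist cC) => e /approx[p Cp xp].
by exists (psi p) => //; rewrite (isom_mdist psi).
Qed.

(** Total measurable versions of [psi] and of its inverse, equal to [point] off the support and off
    the range. The preimage of a closed set is a closed set, joined, if [point] is a member, with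
    the complement of the support or of the range. *)
Lemma embedding_maps : exists (f : X -> Y) (g : Y -> X),
  [/\ measurable_fun [set: borel X] (f : borel X -> borel Y),
      measurable_fun [set: borel Y] (g : borel Y -> borel X),
      (forall p, f (set_val p) = psi p) & (forall p, g (psi p) = set_val p)].
Proof.
pose f x := if pselect (supp mu x) is left sx then psi (SigSub (mem_set sx)) else point.
pose g y := if pselect (exists p, psi p = y) is left ey then set_val (projT1 (cid ey)) else point.
have fE p : f (set_val p) = psi p.
  rewrite /f; case: pselect => [sx|/(_ (set_valP p))//].
  by congr (psi _); apply: val_inj.
have gE p : g (psi p) = set_val p.
  rewrite /g; case: pselect => [ey|]; last by case; exists p.
  by congr set_val; apply: isometric_embedding_inj; exact: projT2 (cid ey).
exists f, g; split => //.
- apply: measurable_borel_closed => C cC.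
  have msupp : measurable (supp mu : set (borel X)) by apply: closed_borel; exact: supp_closed.
  rewrite (_ : f @^-1` C = set_val @` (psi @^-1` C) `|`
      (if pselect (C point) then ~` supp mu else set0)).
    apply: measurableU; first by apply: closed_borel; exact: isometric_preimage_closed.
    by case: (pselect (C point)) => ? /=; [exact: measurableC|exact: measurable0].
  apply/seteqP; split => [x Cfx|x [[p Cp <-]|]].
  + have [sx|nsx] := pselect (supp mu x).
      left; exists (SigSub (mem_set sx)) => //.
      by move: Cfx; rewrite /preimage/= -fE.
    right; move: Cfx; rewrite /preimage /f /=; case: pselect => // _ Cp.
    by case: pselect.
  + by rewrite /preimage/= fE.
  + case: pselect => // Cp nsx; rewrite /preimage/= /f.
    by case: pselect.
- apply: measurable_borel_closed => C cC.
  have mrange : measurable (range psi : set (borel Y)).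
    by apply: closed_borel; exact: isometric_range_closed.
  rewrite (_ : g @^-1` C = psi @` [set p | C (set_val p)] `|`
      (if pselect (C point) then ~` range psi else set0)).
    apply: measurableU; first by apply: closed_borel; exact: isometric_image_closed.
    by case: (pselect (C point)) => ? /=; [exact: measurableC|exact: measurable0].
  apply/seteqP; split => [y Cgy|y [[p Cp <-]|]].
  + have [[p py]|ny] := pselect (exists p, psi p = y).
      by left; exists p => //; move: Cgy; rewrite /preimage/= -py gE.
    right; move: Cgy; rewrite /preimage /g /=; case: pselect => // _ Cp.
    by case: pselect => // _ [p _ py]; apply: ny; exists p.
  + by rewrite /preimage/= gE.
  + case: pselect => // Cp ny; rewrite /preimage/= /g.
    by case: pselect => // -[p py]; case: ny; exists p.
Qed.

Lemma eq_measure_supp (A B : set (borel X)) : measurable A -> measurable B ->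
  (forall x, supp mu x -> A x <-> B x) -> mu A = mu B.
Proof.
have msupp : measurable (supp mu : set (borel X)) by apply: closed_borel; exact: supp_closed.
have E (C : set (borel X)) : measurable C -> mu C = mu (C `&` supp mu).
  move=> mC; rewrite -[in LHS](setIT C) -(setUv (supp mu)) setIUr measureU//.
  - rewrite [X in _ + X](_ : _ = 0) ?adde0//; apply/eqP.
    rewrite -measure_le0 -(supp_full mu) le_measure ?inE//.
    + by apply: measurableI => //; exact: measurableC.
    + exact: measurableC.
  - exact: measurableI.
  - by apply: measurableI => //; exact: measurableC.
  - by rewrite setIACA setICr setI0.
move=> mA mB AB; rewrite (E A)// (E B)//; congr (mu _).
by apply/seteqP; split => x [Ax sx]; split => //; apply/AB.
Qed.

Lemma push_suppE (f : X -> Y) :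
  measurable_fun [set: borel X] (f : borel X -> borel Y) ->
  (forall p, f (set_val p) = psi p) ->
  forall B : set (borel Y), measurable B -> push_supp psi B = mu (f @^-1` B).
Proof.
move=> mf fE B mB; rewrite -[LHS]/(mu (set_val @` (psi @^-1` B))).
have msupp : measurable (supp mu : set (borel X)) by apply: closed_borel; exact: supp_closed.
have mfB : measurable (f @^-1` B : set (borel X)) by rewrite -[X in measurable X]setTI; exact: mf.
have E : set_val @` (psi @^-1` B) = f @^-1` B `&` supp mu.
  apply/seteqP; split => [_ [p Bp <-]|x [Bx sx]].
    by split; [rewrite /preimage/= fE|exact: set_valP].
  exists (SigSub (mem_set sx)) => //.
  by rewrite /preimage/= -fE.
apply: eq_measure_supp => //; first by rewrite E; exact: measurableI.
by move=> x sx; rewrite E; split => [[]|].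
Qed.

End embedding_maps.

Section embedding_energy.
Context (R : realType) (a : R) (F l : R -> \bar R).
Hypothesis reg : regular_ET a F l.
Context (X1 X2 Y : polishMetricType R) (mu1 : fmeasure R X1) (mu2 : fmeasure R X2).
Variables (psi1 : isometric_embedding Y (supp mu1)).
Variables (psi2 : isometric_embedding Y (supp mu2)).

(* If a support is empty the inequality is void, but the infimum defining the
   induced bridge would be over the empty set. *)
Lemma embedding_bridge : exists h : X1 -> X2 -> R, bridge h /\
  forall p q, h (set_val p) (set_val q) <= mdist (psi1 p) (psi2 q).
Proof.
have [[p0 _]|np] := pselect (exists p : supp mu1, True); last first.
  exists (fun x y => mdist x point + 1 + mdist point y).
  split; [exact: bridge_point|by move=> p; case: np; exists p].
have [[q0 _]|nq] := pselect (exists q : supp mu2, True); last first.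
  exists (fun x y => mdist x point + 1 + mdist point y).
  split; [exact: bridge_point|by move=> ? q; case: nq; exists q].
(* The length of a path from [x] to the first support, across [Y], and from the second support to
   [y]. *)
pose L x y (z : supp mu1 * supp mu2) : R :=
  mdist x (set_val z.1) + mdist (psi1 z.1) (psi2 z.2) + mdist (set_val z.2) y.
pose h x y := inf (range (L x y)).
have L0 x y z : 0 <= L x y z by rewrite !addr_ge0 ?mdist_ge0.
have hL x y z : h x y <= L x y z.
  by apply: ge_inf; [exists 0 => _ [w _ <-]|exists z].
have hge x y (b : R) : (forall z, b <= L x y z) -> b <= h x y.
  by move=> hb; apply: lb_le_inf; [exists (L x y (p0, q0)), (p0, q0)|move=> _ [z _ <-]].
have hge2 x y x' y' (b : R) : (forall z w, b <= L x y z + L x' y' w) -> b <= h x y + h x' y'.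
  move=> hb; rewrite -lerBlDr; apply: (hge x y) => z; rewrite lerBlDr addrC -lerBlDr.
  by apply: hge => w; rewrite lerBlDr addrC.
exists h; split=> [|p q]; last first.
  by apply: le_trans (hL _ _ (p, q)) _; rewrite /L/= !mdistxx add0r addr0.
split=> [x x' y|x y y'|x x' y|x y y'].
- rewrite addrC -lerBlDr; apply: hge => z; rewrite lerBlDr (le_trans (hL _ _ z))//.
  by have := metric_triangle x x' (set_val z.1); rewrite /L; lra.
- rewrite -lerBlDr; apply: hge => z; rewrite lerBlDr (le_trans (hL _ _ z))//.
  by have := metric_triangle (set_val z.2) y' y; rewrite /L; lra.
- apply: hge2 => z w; rewrite /L.
  have := metric_triangle x (set_val z.1) x'.
  have := metric_triangle (set_val z.1) (set_val w.1) x'.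
  have := metric_triangle (psi1 z.1) (psi2 z.2) (psi1 w.1).
  have := metric_triangle (psi2 z.2) (psi2 w.2) (psi1 w.1).
  have := metric_triangle (set_val z.2) y (set_val w.2).
  rewrite (isom_mdist psi1) (isom_mdist psi2) (metric_sym (psi2 w.2)).
  by rewrite (metric_sym (set_val w.1) x') (metric_sym y (set_val w.2)); lra.
- apply: hge2 => z w; rewrite /L.
  have := metric_triangle y (set_val z.2) y'.
  have := metric_triangle (set_val z.2) (set_val w.2) y'.
  have := metric_triangle (psi2 z.2) (psi1 z.1) (psi2 w.2).
  have := metric_triangle (psi1 z.1) (psi1 w.1) (psi2 w.2).
  have := metric_triangle (set_val z.1) x (set_val w.1).
  rewrite (isom_mdist psi1) (isom_mdist psi2) (metric_sym (psi2 z.2)).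
  by rewrite (metric_sym y (set_val z.2)) (metric_sym (set_val z.1) x); lra.
Qed.

Local Open Scope ereal_scope.

Let F_Gamma0 := reg_Gamma0 reg.
Let F_finite := reg_finite reg.
Let F_superlinear := reg_superlinear reg.
Let l_cost := reg_cost reg.

(** An infinite divergence on the right leaves nothing to prove. Otherwise the marginals of [G] are
    absolutely continuous, hence concentrated on the ranges of the embeddings: pulling [G] back
    preserves both divergences, and the transport cost can only drop. *)
Lemma bridge_energy_le_embedding (G : fmeasure R (Y * Y)%type) :
  exists (g : fmeasure R (X1 * X2)%type) (h : X1 -> X2 -> R), bridge h /\
  bridge_energy F l mu1 mu2 g h <=
    F_divergence F (marginal1 G) (push_supp psi1) +
    F_divergence F (marginal2 G) (push_supp psi2) +
    \int[G]_z l (mdist z.1 z.2).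
Proof.
have [h [bh hle]] := embedding_bridge.
have [fin1|] := ltP (F_divergence F (marginal1 G) (push_supp psi1)) +oo; last first.
  rewrite leye_eq => /eqP ->; exists mzero, h; split => //.
  rewrite -addeA addye ?leey// gt_eqF// (@lt_le_trans _ _ 0)//.
  apply: adde_ge0; first exact: F_divergence_ge0.
  by apply: integral_ge0 => p _; exact: cost_mdist_ge0.
have [fin2|] := ltP (F_divergence F (marginal2 G) (push_supp psi2)) +oo; last first.
  rewrite leye_eq => /eqP ->; exists mzero, h; split => //.
  rewrite addey ?addye ?leey// gt_eqF// (@lt_le_trans _ _ 0)//.
    by apply: integral_ge0 => p _; exact: cost_mdist_ge0.
  exact: F_divergence_ge0.
have [f1 [g1 [mf1 mg1 f1E g1E]]] := embedding_maps psi1.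
have [f2 [g2 [mf2 mg2 f2E g2E]]] := embedding_maps psi2.
have mfst := continuous_borel_measurable (@fst_continuous Y Y).
have msnd := continuous_borel_measurable (@snd_continuous Y Y).
have mg : measurable_fun [set: borel (Y * Y)%type]
    (fun z => (g1 z.1, g2 z.2) : borel (X1 * X2)%type).
  apply: (@measurable_pair_borel R _ (borel (Y * Y)%type) X1 X2).
  - exact: (measurableT_comp mg1 mfst).
  - exact: (measurableT_comp mg2 msnd).
have [g gE] := fmeasure_push mg G.
have div (X : polishMetricType R) (mu : fmeasure R X)
    (psi : isometric_embedding Y (supp mu)) (f : X -> Y) (k : Y -> X)
    (Gi : fmeasure R Y) (gi : fmeasure R X) :
    measurable_fun [set: borel X] (f : borel X -> borel Y) ->
    measurable_fun [set: borel Y] (k : borel Y -> borel X) ->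
    (forall p, f (set_val p) = psi p) -> (forall p, k (psi p) = set_val p) ->
    (forall B : set (borel X), measurable B -> gi B = Gi (k @^-1` B)) ->
    F_divergence F Gi (push_supp psi) < +oo ->
    [/\ F_divergence F gi mu = F_divergence F Gi (push_supp psi),
        measurable (range psi : set (borel Y)) & Gi (~` range psi) = 0].
  move=> mf mk fE kE giE fin.
  have mr : measurable (range psi : set (borel Y)).
    by apply: closed_borel; exact: isometric_range_closed.
  have r0 : push_supp psi (~` range psi) = 0.
    rewrite -[LHS]/(mu (set_val @` (psi @^-1` (~` range psi)))).
    rewrite (_ : _ @` _ = set0) ?measure0//; apply/seteqP; split => // x [p np _].
    by apply: np; exists p.
  split => //.
  - apply: (F_divergence_push F_Gamma0 F_finite F_superlinear mk mf mr r0) => //.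
      by move=> _ [p _ <-]; rewrite kE fE.
    move=> B mB; rewrite (push_suppE mf fE); last first.
      by rewrite -[X in measurable X]setTI; exact: mk.
    apply: eq_measure_supp => //.
      rewrite -[X in measurable X]setTI; apply: mf => //.
      by rewrite -[X in measurable X]setTI; exact: mk.
    move=> x sx; rewrite /preimage/=; have := fE (SigSub (mem_set sx)).
    by move=> /= ->; rewrite kE.
  - have [s [ms _ ->]] := F_divergence_lty F_Gamma0 F_superlinear fin.
      apply: null_set_integral => //; first exact: measurableC.
      exact/measurable_EFinP/measurable_funTS.
    exact: measurableC.
have [div1 mr1 G1r] := div _ _ psi1 f1 g1 (marginal1 G) (marginal1 g) mf1 mg1 f1E g1E
  (fun B _ => gE (fst @^-1` B)) fin1.
have [div2 mr2 G2r] := div _ _ psi2 f2 g2 (marginal2 G) (marginal2 g) mf2 mg2 f2E g2E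
  (fun B _ => gE (snd @^-1` B)) fin2.
exists g, h; split => //; rewrite /bridge_energy div1 div2; apply: leeD2l.
pose N : set (borel (Y * Y)%type) := fst @^-1` (~` range psi1) `|` snd @^-1` (~` range psi2).
have mN1 : measurable (fst @^-1` (~` range psi1) : set (borel (Y * Y)%type)).
  by rewrite -[X in measurable X]setTI; apply: mfst => //; exact: measurableC.
have mN2 : measurable (snd @^-1` (~` range psi2) : set (borel (Y * Y)%type)).
  by rewrite -[X in measurable X]setTI; apply: msnd => //; exact: measurableC.
have mN : measurable N by exact: measurableU.
have N0 : G N = 0.
  apply/eqP; rewrite -measure_le0; apply: le_trans (measureU2 G mN1 mN2) _.
  by rewrite -[X in X + _]/(marginal1 G (~` range psi1))
    -[X in _ + X]/(marginal2 G (~` range psi2)) G1r G2r adde0.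
have mh := measurable_bridge_cost reg bh.
rewrite (integral_push mg (nu := g) (mu := G))//; last first.
  by move=> z; exact: (bridge_cost_ge0 reg).
have mhg : measurable_fun [set: borel (Y * Y)%type] (fun z => l (h (g1 z.1) (g2 z.2))).
  exact: (measurableT_comp mh mg).
have mcost := @cost_mdist_measurable _ _ l_cost Y.
rewrite preimage_setT.
rewrite (ge0_negligible_integral mN measurableT mhg _ N0); last first.
  by move=> z _; exact: (bridge_cost_ge0 reg (g1 z.1, g2 z.2) bh).
rewrite (ge0_negligible_integral mN measurableT mcost _ N0); last first.
  by move=> z _; exact: cost_mdist_ge0.
have mNc : measurable (setT `\` N) by exact: measurableD.
apply: ge0_le_integral => //.
- by move=> z _; exact: (bridge_cost_ge0 reg (g1 z.1, g2 z.2) bh).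
- exact: measurable_funTS.
- exact: measurable_funTS.
- move=> -[y1 y2] [_ /not_orP[/contrapT[p _ /= <-] /contrapT[q _ /= <-]]].
  by rewrite g1E g2E; apply: (cost_nd l_cost); rewrite bridge_ge0/=.
Qed.

End embedding_energy.

(** * The glued space *)

Section isometric_cover.
Context (R : realType) (X : polishMetricType R) (Y : metricType R) (e : X -> Y).
Hypothesis eE : forall x x', mdist (e x) (e x') = mdist x x'.

(** The chosen balls of radius [1 / (n + 1)] belong to [G], so any two of them meet; their centers
    form a Cauchy sequence in the complete space [X]. *)
Lemma isometry_cauchy_cvg (G : set_system Y) : ProperFilter G ->
  (forall r, 0 < r -> exists x, G (ball (e x) r)) -> exists x, G --> e x.
Proof.
move=> PG hG.
have /choice[u hu] : forall n : nat, exists x, G (ball (e x) n.+1%:R^-1).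
  by move=> n; apply: hG; rewrite invr_gt0.
have [|x xlim] := @complete_mdist R X u.
  move=> m n; have [y []] := filter_ex (filterI (hu m) (hu n)).
  rewrite !ballEmdist/= => my ny; rewrite -eE.
  by rewrite (le_lt_trans (metric_triangle _ y _))// (metric_sym y) ltrD.
exists x => A /nbhs_ballP[r /= r0 rA].
have r2 : 0 < r / 2 by rewrite divr_gt0.
have [N hN] := xlim _ r2.
pose n := maxn N (Num.truncn (r / 2)^-1).
have ne : n.+1%:R^-1 < r / 2.
  rewrite -[ltRHS]invrK ltf_pV2 ?posrE ?invr_gt0//.
  by rewrite (lt_le_trans (truncnS_gt _))// ler_nat ltnS leq_maxr.
apply: filterS (hu n) => y; rewrite ballEmdist/= => ny; apply: rA.
rewrite ballEmdist/= (le_lt_trans (metric_triangle _ (e (u n)) _))//.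
rewrite eE (metric_sym x) [ltRHS]splitr ltrD//; first exact: hN (leq_maxl _ _).
exact: lt_trans ny ne.
Qed.

End isometric_cover.

Section glue.
Context (R : realType) (X1 X2 : polishMetricType R).
Variables (h : X1 -> X2 -> R) (bh : bridge h).

(* The metric quotient of the pseudo-metric space [X1 + X2]: points of [X2] at
   distance zero from a point of [X1] are dropped. *)
Definition glue_keep (p : X1 + X2) : bool :=
  if p is inr y then `[< forall x, h x y != 0 >] else true.

(** The type takes the proof of [bridge h] as an argument because its metric structure depends on
    it. *)
Definition glued of bridge h : Type := {p | glue_keep p}.

HB.instance Definition _ := Choice.copy (glued bh) {p | glue_keep p}.

Let dist (p q : glued bh) : R := coupling_of h (sval p) (sval q).

Let bc := pseudometric_coupling_of bh.

Let dist0 p : dist p p = 0. Proof. exact: (pmc_diag bc). Qed.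

Let dist_positivity p q : dist p q = 0 -> p = q.
Proof.
move=> pq; apply: (@val_inj _ glue_keep {p | glue_keep p}); move: pq; rewrite /dist /=.
case: p q => [[x|y] /= py] [[x'|y'] /= qy].
- by move/mdist_positivity => ->.
- by move/eqP; move: qy => /asboolP/(_ x)/negbTE ->.
- by move/eqP; move: py => /asboolP/(_ x')/negbTE ->.
- by move/mdist_positivity => ->.
Qed.

Let dist_sym p q : dist p q = dist q p. Proof. exact: (pmc_sym bc). Qed.

Let dist_triangle q p r : dist p r <= dist p q + dist q r.
Proof. exact: (pmc_triangle bc). Qed.

HB.instance Definition _ := isMetric.Build R (glued bh)
  dist0 dist_positivity dist_sym dist_triangle.

Definition glue1 (x : X1) : glued bh := exist _ (inl x) isT.

Lemma mdist_glue1 x x' : mdist (glue1 x) (glue1 x') = mdist x x'.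
Proof. by []. Qed.

HB.instance Definition _ := isPointed.Build (glued bh) (glue1 point).

(** A dropped [y] is represented by a point of [X1] at distance zero from it. Prescribing all
    distances to the representative treats kept and dropped points alike. *)
Let glue2_subproof y : exists p : glued bh,
  forall q, mdist q p = coupling_of h (sval q) (inr y).
Proof.
have [/asboolP hy|/asboolPn/existsNP[x /negP]] := boolP `[< forall x, h x y != 0 >].
  by exists (exist _ (inr y) (asboolT hy)).
rewrite negbK => /eqP hxy; exists (glue1 x) => -[[x'|y'] hp] /=.
- apply/eqP; rewrite eq_le; apply/andP; split.
    by have := bridge_dl bh x' x y; rewrite hxy addr0.
  by have := bridge_l bh x' x y; rewrite hxy addr0.
- apply/eqP; rewrite eq_le; apply/andP; split.
    by have := bridge_r bh x y' y; rewrite hxy add0r metric_sym.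
  by have := bridge_dr bh x y' y; rewrite hxy addr0.
Qed.

Definition glue2 (y : X2) : glued bh := projT1 (cid (glue2_subproof y)).

Lemma mdist_glue2r p y : mdist p (glue2 y) = coupling_of h (sval p) (inr y).
Proof. by rewrite /glue2; case: cid. Qed.

Lemma mdist_glue12 x y : mdist (glue1 x) (glue2 y) = h x y.
Proof. exact: mdist_glue2r. Qed.

Lemma mdist_glue2 y y' : mdist (glue2 y) (glue2 y') = mdist y y'.
Proof.
have d0 : coupling_of h (sval (glue2 y)) (inr y) = 0.
  by rewrite -mdist_glue2r mdistxx.
rewrite mdist_glue2r; apply/eqP; rewrite eq_le; apply/andP; split.
  have := pmc_triangle bc (sval (glue2 y)) (inr y) (inr y').
  by rewrite d0 add0r.
have := pmc_triangle bc (inr y) (sval (glue2 y)) (inr y').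
by rewrite (pmc_sym bc (inr y) (sval _)) d0 add0r.
Qed.

Lemma glued_cover (p : glued bh) : (exists x, p = glue1 x) \/ (exists y, p = glue2 y).
Proof.
case: p => [[x|y] hp]; [left; exists x|right; exists y].
  exact: (@val_inj _ glue_keep {p | glue_keep p}).
by apply: mdist_positivity; rewrite mdist_glue2r/= mdistxx.
Qed.

(** The filter comes arbitrarily close to one of the two copies: if radii [r1] and [r2] failed for
    them, a ball of radius [min r1 r2] in the filter would have its center in neither, yet the
    copies cover the space. *)
Let glued_cauchy_cvg (G : set_system (glued bh)) :
  ProperFilter G -> cauchy G -> cvg G.
Proof.
move=> PG /cauchyP cG; apply/cvg_ex.
have [h1|n1] := pselect (forall r : R, 0 < r -> exists x, G (ball (glue1 x) r)).
  by have [x Gx] := isometry_cauchy_cvg mdist_glue1 PG h1; exists (glue1 x).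
have [h2|n2] := pselect (forall r : R, 0 < r -> exists y, G (ball (glue2 y) r)).
  by have [y Gy] := isometry_cauchy_cvg mdist_glue2 PG h2; exists (glue2 y).
move/existsNP : n1 => [r1 /not_implyP[r10 n1]].
move/existsNP : n2 => [r2 /not_implyP[r20 n2]].
have r0 : 0 < Num.min r1 r2 by rewrite lt_min r10.
have [p Gp] := cG _ r0.
have [[x px]|[y py]] := glued_cover p.
- case: n1; exists x; rewrite -px; apply: filterS Gp.
  by apply: le_ball; rewrite ge_min lexx.
- case: n2; exists y; rewrite -py; apply: filterS Gp.
  by apply: le_ball; rewrite ge_min lexx orbT.
Qed.

HB.instance Definition _ := Uniform_isComplete.Build (glued bh) glued_cauchy_cvg.

Let glued_separable : exists2 A : set (glued bh), countable A & dense A.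
Proof.
have [u ud] := separable_dense_seq X1.
have [v vd] := separable_dense_seq X2.
pose w (s : nat + nat) := match s with inl n => glue1 (u n) | inr n => glue2 (v n) end.
exists (range w).
  by apply: (sub_countable (card_image_le _ _)); exact: countableP.
move=> O [p Op] oO; move: (oO); rewrite openE => /(_ p Op) /nbhs_ballP[r /= r0 rO].
have [[x px]|[y py]] := glued_cover p.
- have [n] := ud x r r0; rewrite ballEmdist/= => xn.
  exists (glue1 (u n)); split; last by exists (inl n).
  by apply: rO; rewrite ballEmdist/= px mdist_glue1 metric_sym.
- have [n] := vd y r r0; rewrite ballEmdist/= => yn.
  exists (glue2 (v n)); split; last by exists (inr n).
  by apply: rO; rewrite ballEmdist/= py mdist_glue2 metric_sym.
Qed.

HB.instance Definition _ := isSeparable.Build (glued bh) glued_separable.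

End glue.

Lemma bridge_embedding (R : realType) (X1 X2 : polishMetricType R)
    (h : X1 -> X2 -> R) : bridge h ->
  exists (Y : polishMetricType R) (e1 : X1 -> Y) (e2 : X2 -> Y),
  [/\ (forall x x', mdist (e1 x) (e1 x') = mdist x x'),
      (forall y y', mdist (e2 y) (e2 y') = mdist y y') &
      (forall x y, mdist (e1 x) (e2 y) = h x y)].
Proof.
move=> bh; exists (glued bh : polishMetricType R), (@glue1 _ _ _ _ bh), (@glue2 _ _ _ _ bh).
by split; [exact: mdist_glue1|exact: mdist_glue2|exact: mdist_glue12].
Qed.

(** * An ambient space attaining the minimum *)

Section optimal_embedding.
Context (R : realType) (a : R) (F l : R -> \bar R).
Hypothesis reg : regular_ET a F l.
Context (X1 X2 : polishMetricType R) (mu1 : fmeasure R X1) (mu2 : fmeasure R X2).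
Local Open Scope ereal_scope.

Let F_Gamma0 := reg_Gamma0 reg.
Let F_finite := reg_finite reg.
Let F_superlinear := reg_superlinear reg.
Let l_cost := reg_cost reg.

Lemma F_divergence_isometry (X Y : polishMetricType R) (mu nu : fmeasure R X)
    (nu' : fmeasure R Y) (e : X -> Y) (psi : isometric_embedding Y (supp mu)) :
  measurable_fun [set: borel X] (e : borel X -> borel Y) ->
  (forall p, psi p = e (set_val p)) ->
  (forall B : set (borel Y), measurable B -> nu' B = nu (e @^-1` B)) ->
  F_divergence F nu mu < +oo ->
  F_divergence F nu' (push_supp psi) = F_divergence F nu mu.
Proof.
move=> me psiE nuE fin; have [f [g [_ mg _ gE]]] := embedding_maps psi.
have ms : measurable (supp mu : set (borel X)) by apply: closed_borel; exact: supp_closed.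
apply: (F_divergence_push F_Gamma0 F_finite F_superlinear me mg ms (supp_full mu)) => //.
  by move=> x sx; have := gE (SigSub (mem_set sx)); rewrite psiE.
by apply: push_suppE.
Qed.

Lemma bridge_energy_embedding (g : fmeasure R (X1 * X2)%type) (h : X1 -> X2 -> R) :
  bridge h -> bridge_energy F l mu1 mu2 g h \is a fin_num ->
  exists (Y : polishMetricType R) (psi1 : isometric_embedding Y (supp mu1))
    (psi2 : isometric_embedding Y (supp mu2)) (G : fmeasure R (Y * Y)%type),
  F_divergence F (marginal1 G) (push_supp psi1) +
  F_divergence F (marginal2 G) (push_supp psi2) +
  \int[G]_z l (mdist z.1 z.2) = bridge_energy F l mu1 mu2 g h.
Proof.
move=> bh efin.
have d1 := F_divergence_ge0 F_Gamma0 F_superlinear (marginal1 g) mu1.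
have d2 := F_divergence_ge0 F_Gamma0 F_superlinear (marginal2 g) mu2.
have d3 := bridge_cost_integral_ge0 reg g bh.
have elt : bridge_energy F l mu1 mu2 g h < +oo by rewrite ltey_eq efin.
have fin1 : F_divergence F (marginal1 g) mu1 < +oo.
  by apply: le_lt_trans elt; rewrite /bridge_energy -addeA leeDl// adde_ge0.
have fin2 : F_divergence F (marginal2 g) mu2 < +oo.
  by apply: le_lt_trans elt; rewrite /bridge_energy addeAC leeDr// adde_ge0.
have [Y [e1 [e2 [e1E e2E e12]]]] := bridge_embedding bh.
pose psi1 : isometric_embedding Y (supp mu1) :=
  @Build_isometric_embedding R X1 Y (supp mu1) (fun p => e1 (set_val p)) (fun p q => e1E _ _).
pose psi2 : isometric_embedding Y (supp mu2) :=
  @Build_isometric_embedding R X2 Y (supp mu2) (fun p => e2 (set_val p)) (fun p q => e2E _ _).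
have iso_measurable (X : polishMetricType R) (e : X -> Y) :
    (forall x x', mdist (e x) (e x') = mdist x x') ->
    measurable_fun [set: borel X] (e : borel X -> borel Y).
  move=> eE; apply: continuous_borel_measurable => x A /nbhs_ballP[r /= r0 rA].
  apply/nbhs_ballP; exists r => //= y; rewrite ballEmdist/= => xy.
  by apply: rA; rewrite ballEmdist/= eE.
have me1 := iso_measurable _ _ e1E; have me2 := iso_measurable _ _ e2E.
have me : measurable_fun [set: borel (X1 * X2)%type]
    (fun z => (e1 z.1, e2 z.2) : borel (Y * Y)%type).
  apply: (@measurable_pair_borel R _ (borel (X1 * X2)%type) Y Y).
  - exact: (measurableT_comp me1 (continuous_borel_measurable (@fst_continuous X1 X2))).
  - exact: (measurableT_comp me2 (continuous_borel_measurable (@snd_continuous X1 X2))).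
have [G GE] := fmeasure_push me g.
exists Y, psi1, psi2, G; rewrite /bridge_energy; congr (_ + _ + _).
- apply: (F_divergence_isometry me1) => // B _; exact: (GE (fst @^-1` B)).
- apply: (F_divergence_isometry me2) => // B _; exact: (GE (snd @^-1` B)).
- rewrite (integral_push me (mu := g))//.
  + by rewrite preimage_setT; apply: eq_integral => z _; rewrite e12.
  + exact: (@cost_mdist_measurable _ _ l_cost Y).
  + by move=> z; exact: (cost_mdist_ge0 l_cost).
Qed.

End optimal_embedding.

Local Open Scope ereal_scope.

Theorem lemma6 (R : realType) (a : R) (F l : R -> \bar R)
    (reg : regular_ET a F l) (X1 X2 : polishMetricType R)
    (mu1 : fmeasure R X1) (mu2 : fmeasure R X2) :
  (exists (gamma : fmeasure R (X1 * X2)%type) (d : X1 + X2 -> X1 + X2 -> R),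
     pseudometric_coupling d /\
     sturm_ET a F l mu1 mu2 `^ (a^-1)%R =
       F_divergence F (marginal1 gamma) mu1 +
       F_divergence F (marginal2 gamma) mu2 +
       \int[gamma]_z l (d (inl z.1) (inr z.2))) /\
  (exists (Y : polishMetricType R)
     (psi1 : isometric_embedding Y (supp mu1))
     (psi2 : isometric_embedding Y (supp mu2)),
     sturm_ET a F l mu1 mu2 = ET_dist a F l (push_supp psi1) (push_supp psi2)).
Proof.
have /andP[a0 _] := reg_a reg.
have [g [h [bh [efin hmin]]]] := exists_minimal_bridge_energy reg mu1 mu2.
have [Y [psi1 [psi2 [G GE]]]] := bridge_energy_embedding reg bh efin.
have e0 := bridge_energy_ge0 reg mu1 mu2 g bh.
have poweR_le (r s : \bar R) : 0 <= r -> r <= s -> r `^ a <= s `^ a.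
  move=> r0 rs; apply: gt0_ler_poweR => //.
  - exact: ltW.
  - by rewrite in_itv/= r0 leey.
  - by rewrite in_itv/= (le_trans r0)// leey.
have low (Z : polishMetricType R) (phi1 : isometric_embedding Z (supp mu1))
    (phi2 : isometric_embedding Z (supp mu2)) :
    bridge_energy F l mu1 mu2 g h `^ a <= ET_dist a F l (push_supp phi1) (push_supp phi2).
  apply: poweR_le => //; apply: le_ereal_inf_tmp => _ [H _ <-].
  have [g' [h' [bh' le']]] := bridge_energy_le_embedding reg phi1 phi2 H.
  exact: le_trans (hmin g' h' bh') le'.
have upY : ET_dist a F l (push_supp psi1) (push_supp psi2) <=
    bridge_energy F l mu1 mu2 g h `^ a.
  apply: poweR_le; first exact: (ET_ge0 reg).
  by rewrite -GE; apply: ereal_inf_lbound; exists G.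
(* The minimal energy bounds the cost in every ambient space from below and is reached in [Y]; both
   claims follow from this equality. *)
have sturmE : sturm_ET a F l mu1 mu2 = bridge_energy F l mu1 mu2 g h `^ a.
  apply/eqP; rewrite eq_le; apply/andP; split.
    by apply: le_trans upY; apply: ereal_inf_lbound; exists Y, psi1, psi2.
  by apply: le_ereal_inf_tmp => _ [Z [phi1 [phi2 ->]]]; exact: low.
split.
  exists g, (coupling_of h); split; first exact: pseudometric_coupling_of.
  by rewrite sturmE -poweRrM mulfV ?gt_eqF// poweRe1.
exists Y, psi1, psi2; rewrite sturmE; apply/eqP; rewrite eq_le upY andbT.
exact: low.
Qed.
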